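(* Let $p$ be a prime, $q=p^n$, $k$ a positive divisor of $n$, $v>1$ a divisor of $p^k-1$, and let $\mathcal{U}\subseteq\mathbb{F}_q$ be an $\mathbb{F}_{p^k}$-vector space of dimension $m$ such that $\#\mathcal{U}^v>2$ and $1\in\mathcal{U}$. Then the following hold. (i) If $\mathcal{U}\neq\mathbb{F}_{p^{mk}}$, then $m>1$ and $\deg(F)>(p^{n/2}+1)p^{mk}$ for every $F\in\mathcal{P}(\mathcal{U}^v,q)\setminus\{f^v : f\in\mathcal{P}(\mathcal{U},q)\}$. (ii) If $\mathcal{U}=\mathbb{F}_{p^{mk}}$, let $e$ be the smallest positive integer such that $\mathcal{U}^v\subseteq\mathbb{F}_{p^e}\subseteq\mathbb{F}_{p^{mk}}$, and set $t=\frac{v(p^e-1)}{p^{mk}-1}$. In this case, if $F\in\mathcal{P}(\mathcal{U}^v,q)\setminus\{f^t : f\in\mathcal{P}(\mathbb{F}_{p^e},q)\}$, then $t>1$, $\mathcal{U}^v$ is not a subfield of $\mathbb{F}_q$, and $\deg(F)\ge(p^{n/2}+1)p^e$. In particular, if either (a) $\#\mathcal{U}^v>p^{n/2-1}$, or (b) $m>1$ and $(2m-1)k\ge n/2$, then: if $\mathcal{U}$ is not a field, $\mathcal{P}(\mathcal{U}^v,q)=\{f^v : f\in\mathcal{P}(\mathcal{U},q)\}$; and if $\mathcal{U}$ is a field, $$\mathcal{P}(\mathcal{U}^v,q)=\left\{f^{\frac{(p^e-1)v}{p^{mk}-1}} : f\in\mathcal{P}(\mathbb{F}_{p^e},q)\right\},$$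 where $\mathbb{F}_{p^e}\subseteq\mathbb{F}_q$ is the smallest field containing $\mathcal{U}^v$.
   Context: All finite fields of characteristic $p$ are taken inside a fixed algebraic closure of $\mathbb{F}_q$. For $F\in\mathbb{F}_q[x]$, $V_F=\{F(\alpha):\alpha\in\mathbb{F}_q\}$. A polynomial $F\in\mathbb{F}_q[x]$ of positive degree is a minimal value set polynomial (MVSP) over $\mathbb{F}_q$ if $\#V_F=\lfloor (q-1)/\deg F\rfloor+1$. For a nonempty $S\subseteq\mathbb{F}_q$, $\mathcal{P}(S,q)$ denotes the set of all MVSPs $F\in\mathbb{F}_q[x]$ with $V_F=S$, and for an integer $v\ge1$, $S^v=\{s^v: s\in S\}$. Here $p^{n/2}$ and $p^{n/2-1}$ are real numbers ($n$ may be odd). *)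

(* Defs.v *)
From HB Require Import structures.
From mathcomp Require Import all_boot all_order all_algebra all_field.
From mathcomp Require Import reals exp.

Set Implicit Arguments.
Unset Strict Implicit.
Unset Printing Implicit Defensive.

Import Order.TTheory GRing.Theory Num.Theory.
Local Open Scope ring_scope.

Section FiniteField.
Variable F : finFieldType.
Implicit Types (S : {set F}) (P : {poly F}).

Definition value_set P : {set F} := [set P.[a] | a : F].

Definition deg P : nat := (size P).-1.

(* [%/] is division in [nat], hence the floor of the quotient. *)
Definition mvsp P : Prop :=
  (0 < deg P)%N /\ #|value_set P| = ((#|F| - 1) %/ deg P + 1)%N.

(* The class P(S, q), with q the order of F. *)
Definition mvsps S P : Prop := mvsp P /\ value_set P = S.

(* { f ^ r : f in P(S, q) } *)
Definition mvsps_pow S (r : nat) P : Prop :=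
  exists2 f : {poly F}, mvsps S f & P = f ^+ r.

Definition powset S (v : nat) : {set F} := [set s ^+ v | s in S].

Definition is_subfield S : Prop := divring_closed S.

(* S is the field F_{p^d}: inside an algebraic closure of F there is exactly  *)
(* one subfield of order p ^ d. It need not be contained in F, in which case  *)
(* no S satisfies this predicate.                                             *)
Definition is_Fpd (p d : nat) S : Prop := is_subfield S /\ #|S| = (p ^ d)%N.

(* e is the smallest positive integer with A \subset F_{p^e} \subset B, and   *)
(* E is F_{p^e}.                                                              *)
Definition least_Fpe_between (p : nat) (A B : {set F}) (e : nat) (E : {set F})
    : Prop :=
  [/\ (0 < e)%N, is_Fpd p e E, A \subset E, E \subset B
    & forall (e' : nat) (E' : {set F}),
        (0 < e')%N -> is_Fpd p e' E' -> A \subset E' -> E' \subset B ->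
        (e <= e')%N].

(* F_{p^e} = E is the smallest subfield of F containing A. *)
Definition smallest_field (p : nat) (A : {set F}) (e : nat) (E : {set F})
    : Prop :=
  [/\ is_Fpd p e E, A \subset E
    & forall E' : {set F}, is_subfield E' -> A \subset E' -> E \subset E'].

End FiniteField.

(* An abstract extension L of a finite field K is finite, but its finFieldType *)
(* structure lives on the alias [finvect_type L].                              *)
Definition vspace_set (K : finFieldType) (L : fieldExtType K)
    (U : {vspace L}) : {set finvect_type L} :=
  [set x : finvect_type L | (x : L) \in U].

(* v (p^e - 1) / (p^(mk) - 1). When U = F_{p^(mk)} and U^v is contained in     *)
(* F_{p^e}, this division in [nat] is exact: the nonzero elements of U^v form  *)
(* a group of order (p^(mk) - 1) / v, which divides p^e - 1.                   *)
Definition texp (p v m k e : nat) : nat :=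
  (v * (p ^ e - 1)) %/ (p ^ (m * k) - 1).

(* Main.v *)
(* Let the additive polynomial [sum_l M_l u^(kap^l)], [kap = p^k], vanish     *)
(* exactly on [S], and let [T] be the monic polynomial with simple roots      *)
(* [S^v]. If [Phi] is an MVSP with value set [S^v], counting degrees in       *)
(* [X^q - X | T(Phi)] gives [v T(Phi) = M_0 (X - X^q) Phi']. With [L] the     *)
(* product of [X - a] over the zeros [a] of [Phi], this becomes               *)
(*   [sum_l w_l L Phi^(rho l) = (X - X^q) L'],  [rho l = (kap^l - 1) / v],    *)
(* and Wronskian arguments, repeated on p-th roots, yield [L' = C^Q] and      *)
(* [Phi = L^v N^Q] with [Q = #|S|]. Comparing degrees,                        *)
(* [deg Phi >= v q / Q], which is the asserted bound when [q] is large. When  *)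
(* [q] is small, [N] has small degree and [N^((q-1)/v) = 1] off the zeros of  *)
(* [Phi], so a Stepanov argument shows that [N] is a [v]-th power up to a     *)
(* constant; then so is [Phi], say [Phi = f^v], and [f] is an MVSP with value *)
(* set [S]. The theorem applies this to [S = U], or, when [U] is a field, to  *)
(* [S = F_{p^e}] with [t] in place of [v].                                    *)

Require Import Defs.
From HB Require Import structures.
From mathcomp Require Import all_boot all_order all_algebra all_field.
From mathcomp Require Import fingroup reals exp.
From mathcomp Require Import zify ring lra.

Set Implicit Arguments.
Unset Strict Implicit.
Unset Printing Implicit Defensive.

Import Order.TTheory GRing.Theory Num.Theory.
Local Open Scope ring_scope.

(** * Frobenius and degrees *)

(** Let [S] be the kernel of an additive polynomial, with [Q] elements, and let [Phi] be minimal
    with value set [S^v]. Since [Phi] takes only values in [S^v], the polynomial [X^q - X] divides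
    [T(Phi)], and minimality leaves so little room in degree that the quotient is a multiple of
    [Phi'] ([T_Phi]). Passing to [L], the product of [X - a] over the zeros of [Phi], gives
    [base_mvs_eq], a linear equation for [L] whose terms are nearly all [p]-th powers. Wronskians
    turn this into actual [p]-th roots: a nonzero Wronskian would have too many zeros for its
    degree, and a zero one lets every polynomial involved descend to its [p]-th root. The outcome is
    [mvsp_structure]: [L' = C^Q] and [Phi = L^v N^Q].

    Degrees then satisfy [deg Phi = v q / Q + v deg C + deg N], hence [mvsp_degree_lower]. Moreover
    [Phi] is a [v]-th power of a member of [P(S, q)] as soon as [N] is a [v]-th power up to a
    constant ([factor_power]). Off the zeros of [Phi] one has [N^((q-1)/v) = 1] ([factor_good]), and
    [stepanov] concludes whenever [deg N] and the number of zeros are small enough for its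
    parameters to exist ([m1_power], [m2_power]).

    If [U] is not a field, take [S = U]. The dichotomy is [v^2 q < Q^4]: below it Stepanov applies
    ([not_field_power]), above it [v q / Q] already exceeds the asserted bound ([not_power_degree]).
    If [U] is a field, [U^v] is also the set of [t]-th powers of [F_{p^e}], and one takes
    [S = F_{p^e}], of dimension one over itself. Then [n = e], [n = 2e], and [n = 3e] with
    [3t < p^e + 3] give powers ([field_power]), and all other cases have large degree ([far_degree],
    [near_degree]). Conditions (a) and (b) only serve to land in the power regime. *)

Section CharP.
Variables (R : idomainType) (p : nat).
Hypothesis charR : p \in [pchar R].
Implicit Types x y : R.

Lemma pnat_expp i : [pchar R].-nat (p ^ i)%N.
Proof.
rewrite pnatX; apply/orP; left.
by rewrite (eq_pnat _ (pcharf_eq charR)) pnat_id // (pcharf_prime charR).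
Qed.

Lemma exprDp i x y : (x + y) ^+ (p ^ i) = x ^+ (p ^ i) + y ^+ (p ^ i).
Proof. by rewrite exprDn_pchar // pnat_expp. Qed.

Lemma expp_gt0 i : (0 < p ^ i)%N.
Proof. by rewrite expn_gt0 prime_gt0 // (pcharf_prime charR). Qed.

Lemma exprNp i x : (- x) ^+ (p ^ i) = - x ^+ (p ^ i).
Proof. by rewrite exprNn_pchar // pnat_expp. Qed.

Lemma exprBp i x y : (x - y) ^+ (p ^ i) = x ^+ (p ^ i) - y ^+ (p ^ i).
Proof. by rewrite exprDp exprNp. Qed.

Lemma exprp_sum i (I : Type) (r : seq I) (P : pred I) (E : I -> R) :
  (\sum_(j <- r | P j) E j) ^+ (p ^ i) = \sum_(j <- r | P j) E j ^+ (p ^ i).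
Proof.
apply: (big_morph (fun x => x ^+ (p ^ i)) (exprDp i)).
by rewrite expr0n gtn_eqF ?expp_gt0.
Qed.

Lemma exprp_inj i : injective (fun x => x ^+ (p ^ i)).
Proof.
move=> x y /= e; apply/eqP; rewrite -subr_eq0.
have : (x - y) ^+ (p ^ i) == 0 by rewrite exprBp e subrr.
by rewrite expf_eq0 => /andP[].
Qed.

End CharP.

Section FinPoly.
Variables (F : finFieldType) (p : nat).
Hypothesis charF : p \in [pchar F].
Implicit Types (c : F) (f g h : {poly F}).

Let pr : prime p := pcharf_prime charF.

Lemma charFX : p \in [pchar {poly F}].
Proof. by rewrite pchar_poly. Qed.

Lemma finfield_root i c : exists b : F, b ^+ (p ^ i) = c.
Proof.
have [g _ gK] := injF_bij (@exprp_inj _ _ charF i).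
by exists (g c).
Qed.

Lemma deriv_expM f j : (f ^+ (p * j))^`() = 0.
Proof.
by rewrite deriv_exp -mulr_natr natrM (pcharf0 charFX) mul0r mulr0.
Qed.

(** Only exponents divisible by [p] survive, and the coefficients have [p]-th roots because
    Frobenius is bijective on [F]. *)
Lemma deriv_pchar_root f : f^`() = 0 -> exists g, f = g ^+ p.
Proof.
move=> f'0.
have co j : ~~ (p %| j)%N -> f`_j = 0.
  case: j => [|j] nj; first by rewrite dvdn0 in nj.
  have := coef_deriv f j; rewrite f'0 coef0 => /esym/eqP.
  rewrite -mulr_natr mulf_eq0 => /orP[/eqP//|].
  by rewrite -(dvdn_pcharf charF) (negPf nj).
have [/= rt rtE] := fin_all_exists (fun c : F => finfield_root 1 c).
exists (\poly_(j < size f) rt f`_(p * j)).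
rewrite -[p in RHS]expn1.
rewrite poly_def (exprp_sum charFX).
under eq_bigr => j _ do rewrite exprZn rtE expn1 -exprM [(j * p)%N]mulnC.
apply/polyP => j; rewrite coef_sum.
have [/dvdnP[i ->]|nj] := boolP (p %| j)%N; last first.
  rewrite co // big1 // => i _; rewrite coefZ coefXn.
  have [ej|] := eqVneq j (p * i)%N; last by rewrite /= mulr0n mulr0.
  by rewrite ej dvdn_mulr in nj.
have [li|gi] := ltnP i (size f).
  rewrite (bigD1 (Ordinal li)) //= big1 => [|l nl].
    by rewrite coefZ coefXn mulnC eqxx mulr1 addr0.
  rewrite coefZ coefXn [(i * p)%N]mulnC eqn_pmul2l ?prime_gt0 //.
  by rewrite eq_sym; move/eqP/val_eqP: nl => /= /negPf->; rewrite mulr0n mulr0.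
rewrite big1 => [|l _]; last first.
  rewrite coefZ coefXn [(i * p)%N]mulnC eqn_pmul2l ?prime_gt0 //.
  by rewrite gtn_eqF ?mulr0n ?mulr0 // (leq_trans (ltn_ord l)).
rewrite nth_default // (leq_trans gi) // leq_pmulr ?prime_gt0 //.
Qed.

End FinPoly.

Section Degree.
Variable F : finFieldType.
Implicit Types f g : {poly F}.

Lemma size_deg f : f != 0 -> size f = (deg f).+1.
Proof. by rewrite -size_poly_gt0 /deg; case: (size f). Qed.

Lemma deg0 : deg (0 : {poly F}) = 0%N. Proof. by rewrite /deg size_poly0. Qed.

Lemma degC (c : F) : deg c%:P = 0%N.
Proof. by rewrite /deg size_polyC; case: (c != 0). Qed.

Lemma degM f g : f != 0 -> g != 0 -> deg (f * g) = (deg f + deg g)%N.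
Proof. by move=> f0 g0; rewrite {1}/deg size_mul // !size_deg //=; lia. Qed.

Lemma degM_le f g : (deg (f * g) <= deg f + deg g)%N.
Proof.
have [->|f0] := eqVneq f 0; first by rewrite mul0r deg0.
have [->|g0] := eqVneq g 0; first by rewrite mulr0 deg0.
by rewrite degM.
Qed.

Lemma degX f n : deg (f ^+ n) = (n * deg f)%N.
Proof.
have [->|f0] := eqVneq f 0.
  by rewrite expr0n deg0 muln0; case: n => [|n] /=; rewrite ?deg0 ?degC.
elim: n => [|n IH]; first by rewrite expr0 degC.
by rewrite exprS degM ?expf_neq0 // IH mulSn.
Qed.

Lemma deg_leE f n : (deg f <= n)%N = (size f <= n.+1)%N.
Proof. by rewrite /deg; case: (size f). Qed.

Lemma degN f : deg (- f) = deg f. Proof. by rewrite /deg size_polyN. Qed.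

Lemma degZ (c : F) f : c != 0 -> deg (c *: f) = deg f.
Proof. by move=> c0; rewrite /deg size_scale. Qed.

Lemma degZ_le (c : F) f : (deg (c *: f) <= deg f)%N.
Proof. by rewrite /deg -!subn1 leq_sub2r // size_scale_leq. Qed.

Lemma degD_le f g n : (deg f <= n)%N -> (deg g <= n)%N -> (deg (f + g) <= n)%N.
Proof.
by rewrite !deg_leE => hf hg; rewrite (leq_trans (size_polyD f g)) // geq_max hf.
Qed.

Lemma degDl f g : (deg g < deg f)%N -> deg (f + g) = deg f.
Proof.
move=> h; rewrite /deg size_polyDl //; move: h; rewrite /deg.
by case: (size g) => [|a]; case: (size f).
Qed.

Lemma degDr f g : (deg f < deg g)%N -> deg (f + g) = deg g.
Proof. by move=> h; rewrite addrC degDl. Qed.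

Lemma deg_sum_le (I : Type) (r : seq I) (P : pred I) (E : I -> {poly F}) n :
  (forall i, P i -> (deg (E i) <= n)%N) ->
  (deg (\sum_(i <- r | P i) E i) <= n)%N.
Proof.
move=> H; elim/big_rec: _ => [|i f Pi Hf]; first by rewrite deg0.
by apply: degD_le => //; apply: H.
Qed.

Lemma degXn n : deg ('X^n : {poly F}) = n.
Proof. by rewrite /deg size_polyXn. Qed.

Lemma degXsubC (c : F) : deg ('X - c%:P) = 1%N.
Proof. by rewrite /deg size_XsubC. Qed.

Lemma deg_deriv_le f : (deg f^`() <= (deg f).-1)%N.
Proof.
have [->|f0] := eqVneq f 0; first by rewrite linear0 deg0.
by have := lt_size_deriv f0; rewrite deg_leE (size_deg f0); case: (deg f) => [/ltnW|].
Qed.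

Lemma deg_lt_deriv f : f^`() != 0 -> (deg f^`() < deg f)%N.
Proof.
move=> f'0; have f0 : f != 0 by apply: contraNneq f'0 => ->; rewrite linear0.
by have := lt_size_deriv f0; rewrite !size_deg //.
Qed.

Lemma dvdp_deg f g : g != 0 -> f %| g -> (deg f <= deg g)%N.
Proof. by move=> g0 /(dvdp_leq g0); rewrite deg_leE (size_deg g0). Qed.

Lemma dvdp_deg_eq0 f g : (deg g < deg f)%N -> f %| g -> g = 0.
Proof.
by move=> lt dv; apply/eqP; apply: contraTT lt => /dvdp_deg/(_ dv); rewrite -leqNgt.
Qed.

Lemma deg_eq0P f : deg f = 0%N -> f = (f`_0)%:P.
Proof. by move=> h; apply: size1_polyC; rewrite -deg_leE h. Qed.

End Degree.

(** * Wronskians *)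

Section Wronskian.
Variables (F : finFieldType).
Implicit Types A C N V X : {poly F}.

Definition wronskian A C := A^`() * C - A * C^`().

(** By coprimality [C] divides its own derivative, which has smaller degree. *)
Lemma deriv_coprime_eq0 C N : coprimep C N -> C %| N * C^`() -> C^`() = 0.
Proof.
move=> co; rewrite Gauss_dvdpr // => dv.
have [->|C0] := eqVneq C^`() 0 => //.
have := dvdp_leq C0 dv; rewrite leqNgt lt_size_deriv //.
by apply: contraNneq C0 => ->; rewrite deriv0.
Qed.

(** The last hypothesis reads [v V' N = - V N'], and since [X' = 0] the Wronskian is [V C' - V' C].
    The use is that [V] divides [N * wronskian A C], which bounds [deg V] when the Wronskian is
    nonzero. *)
Lemma wronskian_mul A C X N V v :
    X^`() = 0 -> V = - (A + X * C) -> V != 0 -> (0 < v)%N ->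
    (V ^+ v * N)^`() = 0 ->
  v%:R *: (N * wronskian A C) = V * (N^`() * C + v%:R *: (N * C^`())).
Proof.
case: v => // v X'0 defV V0 _; rewrite derivM deriv_exp /= -mulr_natl => e0.
have e1 : v.+1%:R * V^`() * N + V * N^`() = 0.
  apply: (mulfI (expf_neq0 v V0)); rewrite mulr0 -[RHS]e0 exprS; ring.
have V' : V^`() = - (A^`() + X * C^`()).
  by rewrite defV derivN derivD derivM X'0 mul0r add0r.
have W : wronskian A C = V * C^`() - V^`() * C.
  by rewrite V' defV /wronskian; ring.
have e2 : v.+1%:R * V^`() * N = - (V * N^`()) by apply/eqP; rewrite -addr_eq0 e1.
rewrite -!mul_polyC polyCMn W.
transitivity (V * (v.+1%:R * (N * C^`())) - (v.+1%:R * V^`() * N) * C).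
  by ring.
by rewrite e2; ring.
Qed.

(** A zero Wronskian leaves [N' C + v N C' = 0] in [wronskian_mul], so [C] divides [N C']; then
    [C' = 0], and the other two derivatives follow. *)
Lemma wronskian_eq0 A C X N V v :
    X^`() = 0 -> V = - (A + X * C) -> V != 0 -> (0 < v)%N ->
    (v%:R != 0 :> F) -> (V ^+ v * N)^`() = 0 -> coprimep C N -> C != 0 ->
    wronskian A C = 0 ->
  [/\ A^`() = 0, C^`() = 0 & N^`() = 0].
Proof.
move=> X'0 defV V0 v0 vF e0 co C0 W0.
have := wronskian_mul X'0 defV V0 v0 e0; rewrite W0 mulr0 scaler0.
move/esym/eqP; rewrite mulf_eq0 (negPf V0) /= => /eqP e.
have C'0 : C^`() = 0.
  apply: (deriv_coprime_eq0 co); rewrite -(dvdpZr _ _ vF).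
  rewrite -(dvdp_addr _ (dvdp_mull N^`() (dvdpp C))) e dvdp0 //.
split=> //.
  by move/eqP: W0; rewrite /wronskian C'0 mulr0 subr0 mulf_eq0 (negPf C0) orbF => /eqP.
move/eqP: e; rewrite C'0 mulr0 scaler0 addr0 mulf_eq0 (negPf C0) orbF.
by move/eqP.
Qed.

Lemma wronskian_deg A C : wronskian A C != 0 ->
  (deg (wronskian A C) < deg A + deg C)%N.
Proof.
move=> W0; have [A'0|A'0] := eqVneq A^`() 0.
  have C'0 : C^`() != 0.
    by apply: contraNneq W0 => C'0; rewrite /wronskian A'0 C'0 mul0r mulr0 subrr.
  rewrite /wronskian A'0 mul0r add0r degN (leq_ltn_trans (degM_le _ _)) //.
  by rewrite ltn_add2l deg_lt_deriv.
have lA := deg_lt_deriv A'0.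
have [C'0|C'0] := eqVneq C^`() 0.
  rewrite /wronskian C'0 mulr0 subr0 (leq_ltn_trans (degM_le _ _)) //.
  by rewrite ltn_add2r.
have lC := deg_lt_deriv C'0.
rewrite -(ltn_predK lA) addSn ltnS degD_le ?degN //.
  rewrite (leq_trans (degM_le _ _)) // leq_add2r; lia.
rewrite (leq_trans (degM_le _ _)) //; lia.
Qed.

(** Subtracting from [A] the multiple of [C] that cancels its leading term does not change the
    Wronskian. *)
Lemma wronskian_deg_eq A C : wronskian A C != 0 -> deg A = deg C ->
  (deg (wronskian A C) + 2 <= 2 * deg C)%N.
Proof.
move=> W0 eAC.
have C0 : C != 0 by apply: contraNneq W0 => ->; rewrite /wronskian deriv0 !mulr0 subrr.
pose c := lead_coef A / lead_coef C.
have W : wronskian A C = wronskian (A - c *: C) C.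
  rewrite /wronskian derivB derivZ -!mul_polyC; ring.
have lt : A - c *: C = 0 \/ (deg (A - c *: C)%R < deg C)%N.
  have [A0|A0] := eqVneq A 0.
    by left; rewrite /c A0 lead_coef0 mul0r scale0r subr0.
  have c0 : c != 0 by rewrite mulf_neq0 ?invr_eq0 ?lead_coef_eq0.
  have [->|D0] := eqVneq (A - c *: C) 0; [by left|right].
  rewrite ltn_neqAle degD_le ?degN ?degZ ?eAC // andbT.
  apply: contra_neqN D0 => /eqP eD; apply/eqP.
  rewrite -lead_coef_eq0 lead_coefE -/(deg (A - c *: C)) eD coefB coefZ.
  rewrite -{1}eAC /deg -!lead_coefE /c divfK ?subrr ?eqxx // lead_coef_eq0 //.
case: lt => [D0|lt]; first by move: W0; rewrite W D0 /wronskian deriv0 !mul0r subrr eqxx.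
by rewrite W in W0 *; have := wronskian_deg W0; lia.
Qed.

End Wronskian.

(** * Polynomials with prescribed simple roots *)

Section Rootpoly.
Variable F : finFieldType.
Implicit Types (Z : {set F}) (f : {poly F}).

Definition rootpoly Z : {poly F} := \prod_(a <- enum Z) ('X - a%:P).

Lemma rootpoly_monic Z : rootpoly Z \is monic.
Proof. exact: monic_prod_XsubC. Qed.

Lemma rootpoly_neq0 Z : rootpoly Z != 0.
Proof. exact: monic_neq0 (rootpoly_monic Z). Qed.

Lemma deg_rootpoly Z : deg (rootpoly Z) = #|Z|.
Proof. by rewrite /deg size_prod_XsubC cardE. Qed.

Lemma root_rootpoly Z a : root (rootpoly Z) a = (a \in Z).
Proof. by rewrite root_prod_XsubC mem_enum. Qed.

Lemma dvdp_rootpoly Z f : {in Z, forall a, root f a} -> rootpoly Z %| f.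
Proof.
move=> rf; apply: uniq_roots_dvdp; last by rewrite uniq_rootsE enum_uniq.
by apply/allP => a; rewrite mem_enum => /rf.
Qed.

Lemma mup_rootpoly Z a : a \in Z -> mup a (rootpoly Z) = 1%N.
Proof. by move=> aZ; rewrite mu_prod_XsubC count_uniq_mem ?enum_uniq // mem_enum aZ. Qed.

Lemma mup_exp a f n : f != 0 -> mup a (f ^+ n) = (n * mup a f)%N.
Proof.
move=> f0; elim: n => [|n IH].
  by rewrite expr0 mupNroot // rootE hornerC oner_eq0.
by rewrite exprS mupM ?expf_neq0 // IH mulSn.
Qed.

Lemma rootpoly_separable Z : coprimep (rootpoly Z) (rootpoly Z)^`().
Proof.
have : separable_poly (rootpoly Z) by rewrite separable_prod_XsubC enum_uniq.
by rewrite unlock.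
Qed.

(* At a root of multiplicity [mu] of [G] both sides give                      *)
(* [P * mup V = 1 + r * mu], so [mup V = 1] would force [r %| P - 1].         *)
Lemma rootpoly_sqr_dvd Z (V G : {poly F}) (c : F) (P r : nat) :
    (1 < P)%N -> ~~ (r %| P - 1)%N -> c != 0 -> G != 0 ->
    V ^+ P = c *: (rootpoly Z * G ^+ r) ->
  rootpoly Z ^+ 2 %| V.
Proof.
move=> P1 nr c0 G0 e; have L0 := rootpoly_neq0 Z.
have V0 : V != 0.
  have : V ^+ P != 0 by rewrite e scaler_eq0 negb_or c0 /= mulf_neq0 // expf_neq0.
  by apply: contraNneq => ->; rewrite expr0n gtn_eqF // ltnW.
have mE a : a \in Z -> (P * mup a V = 1 + r * mup a G)%N.
  move=> aZ; rewrite -mup_exp // e -mul_polyC.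
  rewrite mupMr ?rootC // mupM ?expf_neq0 ?mup_rootpoly ?mup_exp //.
have dv1 : rootpoly Z %| V.
  apply: dvdp_rootpoly => a aZ; rewrite -dvdp_XsubCl XsubC_dvd //.
  by have := mE _ aZ; case: (mup a V) => //; rewrite muln0.
have [V1 eV] := dvdpP _ _ dv1; rewrite eV in V0 mE *.
have V10 : V1 != 0 by apply: contraNneq V0 => ->; rewrite mul0r.
rewrite expr2 dvdp_mul2r //; apply: dvdp_rootpoly => a aZ.
rewrite -dvdp_XsubCl XsubC_dvd //; have := mE _ aZ.
rewrite mupM // mup_rootpoly //; case: (mup a V1) => // h.
by case/negP: nr; apply/dvdnP; exists (mup a G); lia.
Qed.

Lemma sqr_dvd_deriv (L V : {poly F}) j : L ^+ j.+1 %| V -> L ^+ j %| V^`().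
Proof.
case/dvdpP=> V1 ->; rewrite derivM deriv_exp /= dvdp_add //.
  by rewrite dvdp_mull // dvdp_exp2l.
by rewrite -mulr_natl dvdp_mull // dvdp_mull // dvdp_mull.
Qed.

End Rootpoly.

(** * Factorisation of a minimal value set polynomial *)

Section Rho.
Variables (p k v : nat).
Local Notation kap := (p ^ k)%N.
Hypotheses (kap_gt1 : (1 < kap)%N) (v_gt0 : (0 < v)%N) (v_dvd : (v %| kap - 1)%N).

(* If [sum_l M_l u^(kap^l)] vanishes on [S], then                             *)
(* [sum_l M_l y^(rho l + 1)] vanishes on the [v]-th powers of [S].            *)
Definition rho l := ((kap ^ l - 1) %/ v)%N.

Lemma rho_mul l : (v * rho l + 1 = kap ^ l)%N.
Proof.
have h : (kap - 1 %| kap ^ l - 1)%N.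
  by rewrite -{2}(exp1n l) subn_exp dvdn_mulr.
rewrite mulnC /rho divnK ?(dvdn_trans v_dvd) // subnK //.
by rewrite expn_gt0 ltnW.
Qed.

Lemma rho0 : rho 0 = 0%N. Proof. by rewrite /rho expn0 subnn div0n. Qed.

Lemma rhoD a b : rho (a + b) = (kap ^ b * rho a + rho b)%N.
Proof.
apply/eqP; rewrite -(eqn_pmul2l v_gt0) -(eqn_add2r 1).
by rewrite rho_mul mulnDr mulnCA -addnA rho_mul expnD -rho_mul mulnDl mul1n mulnC.
Qed.

Lemma rhoS l : rho l.+1 = (kap * rho l + rho 1)%N.
Proof. by rewrite -addn1 rhoD expn1. Qed.

Lemma rho1_gt0 : (0 < rho 1)%N.
Proof. by rewrite lt0n; apply: contraL kap_gt1 => /eqP h; rewrite -[kap]expn1 -rho_mul h muln0. Qed.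

Lemma rho_gt0 l : (0 < l)%N -> (0 < rho l)%N.
Proof. by case: l => // l _; rewrite rhoS ltn_addl // rho1_gt0. Qed.

Lemma rho_mono l j : (l <= j)%N -> (rho l <= rho j)%N.
Proof.
move=> h; rewrite /rho leq_div2r // leq_sub2r // leq_exp2l //.
Qed.

Lemma rho_ltn l j : (l < j)%N -> (rho l < rho j)%N.
Proof.
move=> h; have: (kap ^ l < kap ^ j)%N by rewrite ltn_exp2l.
by rewrite -!rho_mul ltn_add2r ltn_pmul2l.
Qed.

End Rho.

Section Structure.
Variables (F : finFieldType) (p n k v m : nat) (w : nat -> F).
Variables (Phi : {poly F}) (Z : {set F}).
Local Notation L := (rootpoly Z).
Local Notation q := (p ^ n)%N.
Local Notation kap := (p ^ k)%N.
Local Notation rh := (rho p k v).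
Hypotheses (charF : p \in [pchar F]) (k_gt0 : (0 < k)%N) (m_gt0 : (0 < m)%N).
Hypotheses (v_gt0 : (0 < v)%N) (v_dvd : (v %| kap - 1)%N) (mk_le : (m * k <= n)%N).
Hypotheses (w0 : w 0 = 1) (wm : w m != 0).
Hypotheses (Phi_deg : (0 < deg Phi)%N) (Z_gt0 : (0 < #|Z|)%N) (L_dvd : L %| Phi).
Hypothesis mvs_eq :
  \sum_(l < m.+1) w l *: (L * Phi ^+ rh l) = ('X - 'X^q) * L^`().
Hypothesis L'_co : coprimep L^`() Phi.
Hypothesis deg_lt : (rh m * deg Phi < q)%N.

Let pr : prime p := pcharf_prime charF.
Let p_gt1 : (1 < p)%N := prime_gt1 pr.
Let p_gt0 : (0 < p)%N := prime_gt0 pr.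

Lemma kap_gt1 : (1 < kap)%N.
Proof. by rewrite -(expn0 p) ltn_exp2l. Qed.

Let rhM l : (v * rh l + 1 = kap ^ l)%N := rho_mul kap_gt1 v_dvd l.

Lemma v_le : (v <= kap - 1)%N.
Proof. by apply: dvdn_leq v_dvd; rewrite subn_gt0 kap_gt1. Qed.

Lemma v_lt : (v < kap)%N.
Proof. by have := v_le; have := kap_gt1; case: kap => // K _; rewrite subn1. Qed.

Lemma natp_eq0 j : (p %| j)%N -> j%:R = 0 :> F.
Proof. by rewrite (dvdn_pcharf charF) => /eqP. Qed.

(** In [F] the right side of [v rho l + 1 = kap^l] vanishes. So [v] is invertible and every exponent
    [rho l] with [l > 0] acts as [-1/v] under differentiation. *)
Lemma vrho_eqN1 l : (0 < l)%N -> v%:R * (rh l)%:R = -1 :> F.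
Proof.
move=> l0; apply/eqP; rewrite -addr_eq0 -natrM natr1 -addn1.
rewrite rhM natp_eq0 //; rewrite -expnM dvdn_exp // muln_gt0 k_gt0 //.
Qed.

Lemma vF_neq0 : v%:R != 0 :> F.
Proof.
apply/eqP => v0; have := @vrho_eqN1 1 isT; rewrite v0 mul0r => /eqP.
by rewrite eq_sym oppr_eq0 oner_eq0.
Qed.

Lemma Phi_neq0 : Phi != 0.
Proof. by apply: contraTneq Phi_deg => ->; rewrite deg0. Qed.

Let L0 : L != 0 := rootpoly_neq0 Z.
Let degL : deg L = #|Z| := deg_rootpoly Z.

Lemma degL_le : (deg L <= deg Phi)%N.
Proof. exact: dvdp_deg Phi_neq0 L_dvd. Qed.

Lemma L'_neq0 : L^`() != 0.
Proof.
apply: contraTneq L'_co => ->; rewrite coprime0p.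
by rewrite /eqp; apply/negP => /andP[/(dvdp_deg (oner_neq0 _))]; rewrite leqNgt degC Phi_deg.
Qed.

Lemma degPhi_lt : (deg Phi < q)%N.
Proof.
apply: leq_ltn_trans deg_lt; rewrite leq_pmull //.
refine (rho_gt0 kap_gt1 v_gt0 v_dvd m_gt0).
Qed.

Lemma degXsubXq : deg ('X - 'X^q : {poly F}) = q.
Proof.
rewrite degDr ?degN ?degXn // -['X]expr1 degXn.
by apply: leq_ltn_trans degPhi_lt; apply: leq_trans Z_gt0 _; rewrite -degL degL_le.
Qed.

Lemma deriv_expp (f : {poly F}) j : (0 < j)%N -> (f ^+ (p ^ j))^`() = 0.
Proof. by case: j => // j _; rewrite expnS (deriv_expM charF f). Qed.

Lemma deriv_exp_kap (f : {poly F}) j l : (0 < j)%N ->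
  (f ^+ (kap ^ j * l))^`() = 0.
Proof.
case: j => // j _; have [i ->] : exists i, (kap ^ j.+1 * l = p * i)%N.
  exists (p ^ k.-1 * (kap ^ j * l))%N.
  by rewrite mulnA -expnS prednK // mulnA -expnS.
exact: deriv_expM.
Qed.

(** The left side of [mvs_eq] divided by [L], without its constant term 1. *)
Definition hisum := \sum_(l < m) w l.+1 *: Phi ^+ rh l.+1.

Lemma mvs_eq1 : L - 'X * L^`() = - ('X^q * L^`()) - L * hisum.
Proof.
apply/eqP; rewrite subr_eq addrAC eq_sym subr_eq eq_sym; apply/eqP.
rewrite addrC -mulrBl -mvs_eq big_ord_recl w0 scale1r rho0 expr0 mulr1.
congr (_ + _); rewrite /hisum mulr_sumr; apply: eq_bigr => l _.
by rewrite scalerAr.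
Qed.

(** By [rho (l+1) = kap rho l + rho 1] the factor [Phi^(rho 1)] splits off and leaves only exponents
    divisible by [kap]. *)
Lemma hisum_fact : exists2 E : {poly F}, hisum = Phi ^+ rh 1 * E ^+ kap
  & (m = 1%N -> E ^+ kap = (w 1)%:P).
Proof.
have [/= rt rtE] := fin_all_exists (fun c : F => finfield_root charF k c).
exists (\sum_(l < m) rt (w l.+1) *: Phi ^+ rh l).
  rewrite (exprp_sum (charFX charF)) mulr_sumr; apply: eq_bigr => l _.
  rewrite exprZn rtE -scalerAr -exprM -exprD; congr (_ *: _ ^+ _).
  by rewrite (rhoS kap_gt1 v_gt0 v_dvd) addnC mulnC.
by move=> m1; rewrite m1 big_ord1 rho0 expr0 exprZn rtE expr1n alg_polyC.
Qed.

(** For [m = 1] degrees alone do not suffice, and powers of [L] dividing the Wronskian are used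
    instead. That [rho 1] does not divide [p^i - 1], so that no smaller [F_{p^i}] contains its roots
    of unity, feeds [rootpoly_sqr_dvd]. *)
Hypothesis nondegenerate :
  (1 < m)%N \/ (m = 1%N /\ (1 < rh 1)%N /\
    forall i, (0 < i < k)%N -> ~~ (rh 1 %| p ^ i - 1)%N).

Lemma rho_m_gt : (1 < m)%N -> (kap < rh m)%N.
Proof.
move=> m1; apply: leq_trans (rho_mono _ kap_gt1 m1).
by rewrite (rhoS kap_gt1 v_gt0 v_dvd) -addn1 leq_add ?leq_pmulr ?(rho1_gt0 kap_gt1 v_dvd).
Qed.

(** One descent step below [kap]: [V^v N] is a [p]-th power, so [wronskian_mul] applies, and a
    nonzero Wronskian of [A] and [C] is excluded by its degree. *)
Lemma stage_low i C A N : (i < k)%N ->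
    L^`() = C ^+ (p ^ i) -> L - 'X * L^`() = A ^+ (p ^ i) ->
    Phi * L ^+ (kap - v) = N ^+ (p ^ i) ->
  [/\ A^`() = 0, C^`() = 0 & N^`() = 0].
Proof.
move=> ik eC eA eN; set P := (p ^ i)%N in eC eA eN.
have P0 : (0 < P)%N by rewrite expn_gt0 p_gt0.
have cFX := charFX charF.
have km : (k <= n)%N by apply: leq_trans mk_le; rewrite leq_pmull.
have iN : (i < n)%N := leq_trans ik km.
have C0 : C != 0.
  by apply: contraNneq L'_neq0 => e; rewrite eC e expr0n gtn_eqF.
have N0 : N != 0.
  have : Phi * L ^+ (kap - v) != 0 by rewrite mulf_neq0 ?Phi_neq0 ?expf_neq0.
  by apply: contraNneq => e; rewrite eN e expr0n gtn_eqF.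
pose V := - (A + 'X^(p ^ (n - i)) * C).
have X'0 : ('X^(p ^ (n - i)) : {poly F})^`() = 0 by rewrite deriv_expp // subn_gt0.
have qE : (p ^ (n - i) * P = q)%N by rewrite -expnD subnK // ltnW.
have VP : V ^+ P = L * hisum.
  rewrite (exprNp cFX) (exprDp cFX) exprMn -/P -eA -eC -exprM qE mvs_eq1.
  by ring.
have [E hE hE1] := hisum_fact.
have V0 : V != 0.
  apply/eqP => V0; have : L * hisum = 0 by rewrite -VP V0 expr0n gtn_eqF.
  move=> h0; have := mvs_eq1; rewrite h0 subr0 => /eqP; rewrite subr_eq addrC.
  rewrite -mulrBl => /eqP eL; have := degL_le; rewrite leqNgt => /negP; apply.
  apply: leq_trans degPhi_lt _; rewrite eL degM ?L'_neq0 ?degXsubXq ?leq_addr //.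
  by apply/eqP => e0; have := degXsubXq; rewrite e0 deg0 => e1; have := degPhi_lt; rewrite -e1.
(* The exponents complete to [kap]: [Phi^(v rho 1) Phi = Phi^kap] and [L^v L^(kap-v) = L^kap]. This
   is why [N] is a root of [Phi L^(kap-v)] and not of [Phi]. *)
have VvN : V ^+ v * N = (L * Phi * E ^+ v) ^+ (p ^ (k - i)).
  apply: (@exprp_inj _ p cFX i); rewrite /= -/P -exprM -expnD subnK ?(ltnW ik) //.
  rewrite exprMn exprAC VP -eN hE !exprMn -!exprM.
  have -> : L ^+ kap = L ^+ v * L ^+ (kap - v).
    by rewrite -exprD subnKC // ltnW // v_lt.
  have -> : Phi ^+ kap = Phi ^+ (rh 1 * v) * Phi.
    by rewrite -exprSr -[kap]expn1 -rhM addn1 mulnC.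
  by rewrite [(kap * v)%N]mulnC; ring.
have dVvN : (V ^+ v * N)^`() = 0.
  by rewrite VvN deriv_expp // subn_gt0.
have co : coprimep C N.
  rewrite -(coprimep_pexpl _ _ P0) -(coprimep_pexpr _ _ P0) -eC -eN.
  rewrite coprimepMr L'_co coprimep_expr // coprimep_sym rootpoly_separable //.
apply: (wronskian_eq0 X'0 (erefl V) V0 v_gt0 vF_neq0 dVvN co C0).
have PA : (P * deg A <= deg L)%N.
  rewrite -degX -eA degD_le // degN (leq_trans (degM_le _ _)) //.
  by rewrite -['X]expr1 degXn; have := deg_lt_deriv L'_neq0.
have PC : (P * deg C < deg L)%N by rewrite -degX -eC deg_lt_deriv ?L'_neq0.
apply/eqP/negPn/negP => W0; have WD := wronskian_deg W0.
case: nondegenerate => [m1|[m1 [r1 nr]]].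
  (* For [m > 1] this divisibility forces [q < (kap + 1) deg Phi], which is at most
     [rho m * deg Phi], against [deg_lt]. *)
  have dv : V %| N * wronskian A C.
    rewrite -(dvdpZr _ _ vF_neq0) (wronskian_mul X'0 (erefl V) V0 v_gt0 dVvN).
    exact: dvdp_mulIl.
  have dN : (P * deg N = deg Phi + (kap - v) * deg L)%N.
    by rewrite -degX -eN degM ?Phi_neq0 ?expf_neq0 // degX.
  have lA : (deg A < p ^ (n - i))%N.
    rewrite -(ltn_pmul2l P0) [X in (_ < X)%N]mulnC qE (leq_ltn_trans PA) //.
    by rewrite (leq_ltn_trans degL_le degPhi_lt).
  have dV : deg V = (p ^ (n - i) + deg C)%N.
    rewrite degN degDr ?degM ?expf_neq0 ?polyX_eq0 // degXn //.
    by rewrite (leq_trans lA) ?leq_addr.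
  have := dvdp_deg (mulf_neq0 N0 W0) dv; rewrite dV degM // => h1.
  have h2 : (q < P * deg N + P * deg A)%N.
    by rewrite -qE [(_ * P)%N]mulnC -mulnDr ltn_pmul2l //; move: h1 WD; clear; lia.
  have := deg_lt; rewrite ltnNge => /negP; apply; apply: ltnW.
  apply: leq_trans h2 _; rewrite dN -addnA.
  have h3 : ((kap - v) * deg L + P * deg A <= kap * deg Phi)%N.
    apply: (@leq_trans (kap * deg L)%N); last by rewrite leq_mul2l degL_le orbT.
    have -> : (kap * deg L = (kap - v) * deg L + v * deg L)%N.
      by rewrite -mulnDl subnK // ltnW // v_lt.
    by rewrite leq_add2l (leq_trans PA) // leq_pmull.
  apply: leq_trans (_ : (kap.+1 * deg Phi <= _)%N); last by rewrite leq_mul2r rho_m_gt ?orbT.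
  by rewrite mulSn leq_add2l.
have VPm : V ^+ P = w 1 *: (L * Phi ^+ rh 1).
  rewrite VP hE (hE1 m1) -mul_polyC; ring.
have w1 : w 1 != 0 by rewrite -m1.
have WV : wronskian A C = V * C^`() - V^`() * C.
  rewrite /wronskian /V derivN derivD derivM X'0 mul0r add0r; ring.
(* For [m = 1] the equation is [V^P = w_1 L Phi^(rho 1)]. Hence [L^2] divides the Wronskian if
   [P = 1], and [L] does if [P > 1]; either exceeds its degree. *)
have [i0|i0] := posnP i.
  have P1 : P = 1%N by rewrite /P i0.
  have dv3 : L ^+ 3 %| V.
    have -> : V = w 1 *: (L * Phi ^+ rh 1) by rewrite -VPm P1 expr1.
    rewrite dvdpZr // exprS dvdp_mul2l //.
    by rewrite (dvdp_trans (dvdp_exp2r 2 L_dvd)) // dvdp_exp2l.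
  have dv : L ^+ 2 %| wronskian A C.
    rewrite WV dvdp_sub //; first by rewrite dvdp_mulr // (dvdp_trans _ dv3) // dvdp_exp2l.
    by rewrite dvdp_mulr // sqr_dvd_deriv.
  by have := dvdp_deg W0 dv; rewrite degX; rewrite P1 in PA PC; move: PA PC WD; clear; lia.
have P1 : (1 < P)%N by rewrite -(expn0 p) ltn_exp2l.
have dv2 : L ^+ 2 %| V.
  by apply: rootpoly_sqr_dvd P1 _ w1 Phi_neq0 VPm; apply: nr; rewrite i0.
have dv : L %| wronskian A C.
  rewrite WV dvdp_sub //; first by rewrite dvdp_mulr // (dvdp_trans _ dv2) // dvdp_exp.
  by rewrite dvdp_mulr // -[L]expr1 sqr_dvd_deriv.
by have := dvdp_deg W0 dv; move: P1 PA PC WD; clear; nia.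
Qed.

Lemma low_structure i : (i <= k)%N -> exists C A N : {poly F},
  [/\ L^`() = C ^+ (p ^ i), L - 'X * L^`() = A ^+ (p ^ i)
    & Phi * L ^+ (kap - v) = N ^+ (p ^ i)].
Proof.
elim: i => [|i IH] ik.
  by exists L^`(), (L - 'X * L^`()), (Phi * L ^+ (kap - v)); rewrite !expr1.
have [C [A [N [eC eA eN]]]] := IH (ltnW ik).
have [A'0 C'0 N'0] := stage_low ik eC eA eN.
have [C1 eC1] := deriv_pchar_root charF C'0.
have [A1 eA1] := deriv_pchar_root charF A'0.
have [N1 eN1] := deriv_pchar_root charF N'0.
exists C1, A1, N1; rewrite expnS.
by split; [rewrite eC eC1|rewrite eA eA1|rewrite eN eN1]; rewrite -exprM.
Qed.

(** After [k] steps [Phi L^(kap-v)] is a [kap]-th power of a multiple of [L]; cancelling [L^(kap-v)]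
    leaves [L^v]. *)
Lemma mid_structure : exists C N : {poly F},
  L^`() = C ^+ kap /\ Phi = L ^+ v * N ^+ kap.
Proof.
have [C [A [N [eC _ eN]]]] := low_structure (leqnn k).
have dvN : L %| N.
  apply: dvdp_rootpoly => a aZ.
  have : root (N ^+ kap) a.
    rewrite -eN rootM; apply/orP; left.
    by rewrite -dvdp_XsubCl (dvdp_trans _ L_dvd) // dvdp_XsubCl root_rootpoly.
  by rewrite /root horner_exp expf_eq0 => /andP[].
have [N1 eN1] := dvdpP _ _ dvN; exists C, N1; split=> //.
apply: (mulIf (expf_neq0 (kap - v) L0)); rewrite eN eN1 exprMn mulrAC -exprD subnKC 1?ltnW ?v_lt //.
by rewrite mulrC.
Qed.

(** Once [Phi = L^v N^P], one has [L Phi^(rho l) = L^(kap^l) N^(P rho l)], a [P]-th power when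
    [l > i / k]. These terms make up [V^P]; the others, together with [- X L'], are then forced to
    be a [P]-th power [A^P]. *)
Lemma stage_high i C N : (1 < m)%N -> (k <= i)%N -> (i < m * k)%N ->
    L^`() = C ^+ (p ^ i) -> Phi = L ^+ v * N ^+ (p ^ i) ->
  C^`() = 0 /\ N^`() = 0.
Proof.
move=> m1 ki im eC eN; set P := (p ^ i)%N in eC eN.
have P0 : (0 < P)%N by rewrite expn_gt0 p_gt0.
have cFX := charFX charF.
have C0 : C != 0.
  by apply: contraNneq L'_neq0 => e; rewrite eC e expr0n gtn_eqF.
have N0 : N != 0.
  by apply: contraNneq Phi_neq0 => e; rewrite eN e expr0n gtn_eqF // mulr0.
have iN : (i < n)%N := leq_trans im mk_le.
have qE : (p ^ (n - i) * P = q)%N by rewrite -expnD subnK // ltnW.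
pose j := (i %/ k)%N.
have jm : (j < m)%N by rewrite ltn_divLR.
have ji l : (j < l)%N -> (i < k * l)%N.
  by move=> jl; rewrite mulnC -ltn_divLR.
have [/= rt rtE] := fin_all_exists (fun c : F => finfield_root charF i c).
pose V := \sum_(l < m.+1 | (j < l)%N) rt (w l) *: (L ^+ (p ^ (k * l - i)) * N ^+ rh l).
pose h := \sum_(l < m.+1 | ~~ (j < l)%N) w l *: (L * Phi ^+ rh l) - 'X * L^`().
pose A := - ('X^(p ^ (n - i)) * C + V).
have defV : V = - (A + 'X^(p ^ (n - i)) * C) by rewrite /A; ring.
have termE l : L * Phi ^+ rh l = L ^+ (kap ^ l) * N ^+ (P * rh l).
  by rewrite eN exprMn -!exprM mulrA -exprS -(rhM l) addn1.
have VP : V ^+ P = \sum_(l < m.+1 | (j < l)%N) w l *: (L * Phi ^+ rh l).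
  rewrite (exprp_sum cFX); apply: eq_bigr => l jl.
  rewrite exprZn rtE termE exprMn -!exprM [(rh l * _)%N]mulnC -expnD subnK ?expnM //.
  by rewrite ltnW // ji.
have AP : A ^+ P = h.
  rewrite (exprNp cFX) (exprDp cFX) exprMn -/P -eC -exprM qE VP.
  have := mvs_eq; rewrite (bigID (fun l : 'I_m.+1 => (j < l)%N)) /= => e.
  have -> : h = ('X - 'X^q) * L^`() - \sum_(l < m.+1 | (j < l)%N) w l *: (L * Phi ^+ rh l)
     - 'X * L^`() by rewrite -e /h; ring.
  ring.
have degh : (deg h <= (1 + rh j) * deg Phi)%N.
  rewrite degD_le //.
    apply: deg_sum_le => l; rewrite -leqNgt => lj.
    rewrite (leq_trans (degZ_le _ _)) // (leq_trans (degM_le _ _)) //.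
    rewrite degX mulnDl mul1n leq_add ?degL_le // leq_mul2r rho_mono ?orbT //.
    exact: kap_gt1.
  rewrite degN (leq_trans (degM_le _ _)) // -['X]expr1 degXn.
  by rewrite (leq_trans _ (leq_trans degL_le (leq_pmull _ _))) // add1n deg_lt_deriv ?L'_neq0.
have rjm : (1 + rh j <= rh m)%N by exact: (rho_ltn kap_gt1 v_gt0 v_dvd).
have PA : (P * deg A <= (1 + rh j) * deg Phi)%N by rewrite -degX AP.
have lt1 : ((1 + rh j) * deg Phi < q)%N.
  by apply: leq_ltn_trans deg_lt; rewrite leq_mul2r rjm orbT.
have lA : (deg A < p ^ (n - i))%N.
  by rewrite -(ltn_pmul2l P0) [X in (_ < X)%N]mulnC qE (leq_ltn_trans PA).
have dXC : deg ('X^(p ^ (n - i)) * C) = (p ^ (n - i) + deg C)%N.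
  by rewrite degM ?expf_neq0 ?polyX_eq0 // degXn.
have dV : deg V = (p ^ (n - i) + deg C)%N.
  by rewrite defV degN degDr dXC // (leq_trans lA) ?leq_addr.
have V0 : V != 0.
  apply: contraTneq (leq_trans lA (leq_addr (deg C) _)) => V0.
  by rewrite -dV V0 deg0 ltn0.
have X'0 : ('X^(p ^ (n - i)) : {poly F})^`() = 0 by rewrite deriv_expp // subn_gt0.
(* With [V = N^(rho (j+1)) E] and [v rho (j+1) + 1 = kap^(j+1)], the product [V^v N] is
   [N^(kap^(j+1)) E^v], whose derivative vanishes. *)
pose E := \sum_(l < m.+1 | (j < l)%N)
  rt (w l) *: (L ^+ (p ^ (k * l - i)) * N ^+ (kap ^ j.+1 * rh (l - j.+1))).
have VE : V = N ^+ rh j.+1 * E.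
  rewrite mulr_sumr; apply: eq_bigr => l jl; rewrite -scalerAr; congr (_ *: _).
  rewrite mulrCA -exprD; congr (_ * _ ^+ _).
  by rewrite addnC -(rhoD kap_gt1 v_gt0 v_dvd) subnK.
have E'0 : E^`() = 0.
  rewrite raddf_sum big1 // => l jl /=; rewrite derivZ derivM deriv_expp ?subn_gt0 ?ji //.
  by rewrite deriv_exp_kap // mul0r mulr0 addr0 scaler0.
have dVvN : (V ^+ v * N)^`() = 0.
  rewrite VE exprMn mulrAC -exprM mulnC -exprSr -addn1 rhM.
  rewrite derivM -[(kap ^ j.+1)%N]muln1 deriv_exp_kap // mul0r add0r.
  by rewrite deriv_exp E'0 mul0r mul0rn mulr0.
have co : coprimep C N.
  rewrite -(coprimep_pexpl _ _ P0) -(coprimep_pexpr _ _ P0) -eC.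
  by have := L'_co; rewrite eN coprimepMr => /andP[].
suff W0 : wronskian A C = 0.
  by case: (wronskian_eq0 X'0 defV V0 v_gt0 vF_neq0 dVvN co C0 W0).
apply/eqP/negPn/negP => W0; have WD := wronskian_deg W0.
have dv : V %| N * wronskian A C.
  rewrite -(dvdpZr _ _ vF_neq0) (wronskian_mul X'0 defV V0 v_gt0 dVvN).
  exact: dvdp_mulIl.
have := dvdp_deg (mulf_neq0 N0 W0) dv; rewrite dV degM // => h1.
have h2 : (q < P * deg N + P * deg A)%N.
  by rewrite -qE [(_ * P)%N]mulnC -mulnDr ltn_pmul2l //; move: h1 WD; clear; lia.
have h3 : (v * deg L + P * deg N = deg Phi)%N.
  by rewrite eN degM ?expf_neq0 // !degX.
(* This sharper bound spends only one [deg L], which the part [v deg L] of [deg Phi] absorbs; so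
   [q < (1 + rho j) deg Phi], contradicting [lt1]. *)
have PA' : (P * deg A <= deg L + rh j * deg Phi)%N.
  rewrite -degX AP degD_le //.
    apply: deg_sum_le => l; rewrite -leqNgt => lj.
    rewrite (leq_trans (degZ_le _ _)) // (leq_trans (degM_le _ _)) //.
    rewrite degX leq_add2l leq_mul2r rho_mono ?orbT //.
    exact: kap_gt1.
  rewrite degN (leq_trans (degM_le _ _)) // -['X]expr1 degXn.
  by rewrite add1n (leq_trans (deg_lt_deriv L'_neq0)) ?leq_addr.
have : (deg L <= v * deg L)%N by rewrite leq_pmull.
by move: lt1 h2 h3 PA'; rewrite mulnDl mul1n; clear; lia.
Qed.

Lemma mvsp_structure : exists C N : {poly F},
  [/\ L^`() = C ^+ (p ^ (m * k)), Phi = L ^+ v * N ^+ (p ^ (m * k)),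
      coprimep C N & coprimep C L].
Proof.
suff [C [N [eC eN]]] : exists C N : {poly F},
    L^`() = C ^+ (p ^ (m * k)) /\ Phi = L ^+ v * N ^+ (p ^ (m * k)).
  have Q0 : (0 < p ^ (m * k))%N by rewrite expn_gt0 p_gt0.
  exists C, N; split=> //.
    rewrite -(coprimep_pexpl _ _ Q0) -(coprimep_pexpr _ _ Q0) -eC.
    by have := L'_co; rewrite eN coprimepMr => /andP[].
  by rewrite -(coprimep_pexpl _ _ Q0) -eC coprimep_sym rootpoly_separable.
case: nondegenerate => [m1|[-> _]]; last by rewrite mul1n; exact: mid_structure.
have k_le : (k <= m * k)%N by rewrite leq_pmull // ltnW.
have [i im ->] : exists2 i, (i <= m * k - k)%N & (m * k = k + i)%N.
  by exists (m * k - k)%N; rewrite ?subnKC.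
elim: i im => [|i IH] im; first by rewrite addn0; exact: mid_structure.
have [C [N [eC eN]]] := IH (ltnW im).
have im' : (k + i < m * k)%N by move: im k_le; clear; lia.
have [C'0 N'0] := stage_high m1 (leq_addr i k) im' eC eN.
have [C1 eC1] := deriv_pchar_root charF C'0.
have [N1 eN1] := deriv_pchar_root charF N'0.
exists C1, N1; rewrite addnS expnS.
by split; [rewrite eC eC1|rewrite {1}eN eN1]; rewrite -exprM.
Qed.
End Structure.

(** * Descent along p-th roots *)

Section IncreasingSum.
Variable F : finFieldType.

Lemma incr_sum (f : nat -> {poly F}) (c : nat -> F) m :
    (forall j, f j != 0) -> (forall i j, (i < j)%N -> (size (f i) < size (f j))%N) ->
  (forall j, (j < m)%N -> c j = 0) \/
  exists j, [/\ (j < m)%N, c j != 0, (forall i, (j < i < m)%N -> c i = 0)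
    & size (\sum_(i < m) c i *: f i) = size (f j)].
Proof.
move=> f0 fm; elim: m => [|m [IH|[j [jm cj cj' sj]]]]; first by left.
  have S0 : \sum_(i < m) c i *: f i = 0.
    by rewrite big1 // => i _; rewrite IH ?scale0r.
  rewrite big_ord_recr /= S0 add0r.
  have [cm|cm] := eqVneq (c m) 0.
    by left=> j; rewrite ltnS leq_eqVlt => /orP[/eqP->|/IH].
  right; exists m; rewrite size_scale //; split=> // i.
  by rewrite ltnS => /andP[/leq_trans h /h]; rewrite ltnn.
right; rewrite big_ord_recr /=.
have [cm|cm] := eqVneq (c m) 0.
  exists j; rewrite cm scale0r addr0 ltnW //; split=> // i /andP[ji].
  by rewrite ltnS leq_eqVlt => /orP[/eqP->//|im]; apply: cj'; rewrite ji.
exists m; rewrite ltnSn; split=> //.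
  by move=> i; rewrite ltnS => /andP[/leq_trans h /h]; rewrite ltnn.
by rewrite addrC size_polyDl size_scale // sj fm.
Qed.

End IncreasingSum.

Section Descent.
Variables (F : finFieldType) (p k v m r : nat).
Local Notation kap := (p ^ k)%N.
Local Notation rh := (rho p k v).
Hypotheses (charF : p \in [pchar F]) (k_gt0 : (0 < k)%N) (v_gt0 : (0 < v)%N).
Hypotheses (v_dvd : (v %| kap - 1)%N) (r_gt0 : (0 < r)%N) (m_gt0 : (0 < m)%N).

Definition twist (w : nat -> F) (A N : {poly F}) :=
  \sum_(j < m) w j *: (A ^+ (kap ^ j) * N ^+ rh j).

(** For [j > 0] the factor [A^(kap^j)] has derivative zero, so only [N^(rho j)] is differentiated,
    and [v rho j = -1] in [F]. *)
Lemma twist_deriv w A N : w 0 = 1 ->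
  v%:R *: (N * (twist w A N)^`()) =
  v%:R *: (N * A^`()) - N^`() * (twist w A N - A).
Proof.
move=> w0; rewrite /twist; case: m m_gt0 => // m' _.
rewrite big_ord_recl w0 scale1r rho0 expr0 mulr1 expr1 derivD mulrDr scalerDr.
rewrite addrAC subrr add0r; congr (_ + _).
rewrite raddf_sum !mulr_sumr scaler_sumr -sumrN; apply: eq_bigr => j _ /=.
rewrite derivZ derivM -[(kap ^ _)%N]muln1 (deriv_exp_kap charF) // mul0r add0r muln1.
have r0 : (0 < rh (bump 0 j))%N.
  exact: (rho_gt0 (kap_gt1 charF k_gt0) v_gt0 v_dvd).
rewrite deriv_exp -[in X in _ = - (_ * (_ *: (_ * X)))](prednK r0) exprS.
have e : v%:R%:P * (rh (bump 0 j))%:R = -1 :> {poly F}.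
  rewrite -(rmorph_nat (@polyC F)) -rmorphM /= (vrho_eqN1 charF) //.
  by rewrite rmorphN1.
rewrite -mulr_natr -!mul_polyC.
transitivity ((v%:R%:P * (rh (bump 0 j))%:R) *
   (N^`() * ((w (bump 0 j))%:P * (A ^+ (kap ^ bump 0 j) * (N * N ^+ (rh (bump 0 j)).-1))))).
  by ring.
by rewrite e mulN1r.
Qed.

(* Either the Wronskian of [twist w A N] and [C] is nonzero, and divisible by *)
(* [N ^ (r - 1)], or [A], [C], [N] are [p]-th powers and one descends to      *)
(* their [p]-th roots.                                                        *)
Lemma descent E (w : nat -> F) (Y A C N R : {poly F}) :
    w 0 = 1 -> (exists2 j, (0 < j < m)%N & w j != 0) ->
    twist w A N + Y ^+ (p ^ E) * C = - (N ^+ r * R) ->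
    coprimep A N -> coprimep C N -> coprimep C R -> A != 0 -> C != 0 ->
    (0 < deg N < p ^ E)%N ->
  exists i N1, [/\ N = N1 ^+ (p ^ i), (0 < deg N1)%N &
    (p ^ i * ((r - 1) * deg N1 + 1) <= deg (twist w A N) + deg C)%N].
Proof.
have p_gt0 : (0 < p)%N by rewrite prime_gt0 ?(pcharf_prime charF).
have cFX := charFX charF.
elim: E w Y A C N R => [|E IH] w Y A C N R w0 wj eq1 coAN coCN coCR A0 C0.
  by case/andP; rewrite expn0 ltnS leqn0 => N0 /eqP e; rewrite e in N0.
case/andP=> N_gt0 N_lt.
have N0 : N != 0 by apply: contraTneq N_gt0 => ->; rewrite deg0.
have X'0 : (Y ^+ (p ^ E.+1))^`() = 0 by rewrite deriv_expp.
set T := twist w A N in eq1 *; set X := Y ^+ (p ^ E.+1) in eq1 X'0.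
have WD : wronskian T C = (T + X * C)^`() * C - (T + X * C) * C^`().
  by rewrite derivD derivM X'0 /wronskian; ring.
have [W0|W0] := eqVneq (wronskian T C) 0; last first.
  exists 0%N, N; rewrite expr1 expn0 mul1n; split=> //.
  rewrite addn1; apply: leq_ltn_trans (wronskian_deg W0).
  rewrite -degX; apply: dvdp_deg => //; rewrite WD eq1 dvdp_sub //.
    rewrite dvdp_mulr // sqr_dvd_deriv // subn1 prednK // dvdpNr dvdp_mulr //.
  by rewrite dvdp_mulr // dvdpNr dvdp_mulr // dvdp_exp2l // leq_subr.
(* Cancelling [N^(r-1)] in the vanishing Wronskian shows that [C] divides [N R C'], while [C] is
   coprime to [N R]. *)
have C'0 : C^`() = 0.
  apply: (@deriv_coprime_eq0 _ C (N * R)); first by rewrite coprimepMr coCN.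
  apply/dvdpP; exists (r%:R * N^`() * R + N * R^`()).
  have : N ^+ r.-1 * (N * R * C^`() - (r%:R * N^`() * R + N * R^`()) * C) = 0.
    have := WD; rewrite W0 eq1 derivN derivM deriv_exp -mulr_natr => e.
    by rewrite [RHS]e; case: r r_gt0 => // s _; rewrite exprS /=; ring.
  by move/eqP; rewrite mulf_eq0 expf_eq0 (negPf N0) andbF subr_eq0 => /eqP.
have T'0 : T^`() = 0.
  move/eqP: W0; rewrite /wronskian C'0 mulr0 subr0 mulf_eq0 (negPf C0) orbF.
  by move/eqP.
have := twist_deriv A N w0; rewrite -/T T'0 mulr0 scaler0 => /esym/eqP.
rewrite subr_eq0 => /eqP tw.
have TAE : T - A = \sum_(j < m) (if (j == 0 :> nat) then 0 else w j) *: (A ^+ (kap ^ j) * N ^+ rh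
  j).
  rewrite /T /twist; case: m m_gt0 => // m' _.
  rewrite !big_ord_recl /= w0 scale1r rho0 !expr0 mulr1 expr1 scale0r add0r.
  by rewrite addrAC subrr add0r; apply: eq_bigr.
have vF : v%:R != 0 :> F := vF_neq0 charF k_gt0 v_dvd.
(* [A] divides every term of [T - A], so [tw] gives [A %| N * A']. *)
have A'0 : A^`() = 0.
  apply: (deriv_coprime_eq0 coAN); rewrite -(dvdpZr _ _ vF) tw dvdp_mull // TAE.
  elim/big_rec: _ => [|j x _ hx]; first exact: dvdp0.
  rewrite dvdp_addl // -mul_polyC dvdp_mull // dvdp_mulr // dvdp_exp //.
  by rewrite expn_gt0 expn_gt0 p_gt0.
(* What remains is [N' (T - A) = 0], and [T - A] is nonzero because its terms have distinct degrees
   and some [w j] with [j > 0] is nonzero. *)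
have N'0 : N^`() = 0.
  move/eqP: tw; rewrite A'0 mulr0 scaler0 eq_sym mulf_eq0 => /orP[/eqP//|].
  rewrite TAE => /eqP S0; case: wj => j /andP[j0 jm] wj.
  have := @incr_sum F (fun j => A ^+ (kap ^ j) * N ^+ rh j)
    (fun j => if j == 0 :> nat then 0 else w j) m.
  case=> [i|a b ab|h|[i [im wi _]]].
  - by rewrite mulf_neq0 ?expf_neq0.
  - rewrite !size_deg ?mulf_neq0 ?expf_neq0 // ltnS !degM ?expf_neq0 // !degX.
    rewrite -addnS leq_add ?leq_mul2r //.
      by rewrite leq_exp2l ?(kap_gt1 charF) // (ltnW ab) orbT.
    by rewrite ltn_pmul2r // (rho_ltn (kap_gt1 charF k_gt0) v_gt0 v_dvd).
  - by move: wj; have := h _ jm; rewrite gtn_eqF // => ->; rewrite eqxx.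
  - by rewrite S0 size_poly0 => /esym/eqP;
    rewrite size_poly_eq0 mulf_eq0 !expf_eq0 (negPf A0) (negPf N0) !andbF.
have [C1 eC] := deriv_pchar_root charF C'0.
have [A1 eA] := deriv_pchar_root charF A'0.
have [N1 eN] := deriv_pchar_root charF N'0.
have [/= rt rtE] := fin_all_exists (fun c : F => finfield_root charF 1 c).
have degp (f : {poly F}) : deg (f ^+ p) = (p * deg f)%N by exact: degX.
pose w1 j := if (j == 0)%N then 1 else rt (w j).
have w1E j : w1 j ^+ p = w j.
  by rewrite /w1; case: eqP => [->|_]; rewrite ?expr1n ?w0 // -[p]expn1 rtE.
have eT : T = (twist w1 A1 N1) ^+ p.
  rewrite /T /twist -[p in RHS]expn1 (exprp_sum cFX); apply: eq_bigr => j _.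
  by rewrite expn1 exprZn w1E eA eN exprMn -!exprM !(mulnC p).
have eX : X = (Y ^+ (p ^ E)) ^+ p by rewrite /X -exprM expnSr.
have N10 : N1 != 0 by apply: contraNneq N0 => h; rewrite eN h expr0n gtn_eqF.
have e2 : T + X * C = (twist w1 A1 N1 + Y ^+ (p ^ E) * C1) ^+ p.
  by rewrite -[p in RHS]expn1 (exprDp cFX) expn1 exprMn -eT -eX -eC.
have dv : N1 ^+ r %| twist w1 A1 N1 + Y ^+ (p ^ E) * C1.
  have NE : N1 ^+ r ^+ p = N ^+ r by rewrite eN -!exprM mulnC.
  by rewrite -(dvdp_pexp2r _ _ p_gt0) -e2 eq1 dvdpNr NE dvdp_mulr.
have [R1 eR1] := dvdpP _ _ dv.
have eR : R = (- R1) ^+ p.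
  apply: (mulfI (expf_neq0 r N0)); apply: oppr_inj.
  rewrite -eq1 e2 eR1 eN -[p in RHS]expn1 (exprNp cFX) expn1 exprMn -!exprM.
  by rewrite mulrN opprK mulrC [(p * r)%N]mulnC.
have [] := IH w1 Y A1 C1 N1 (- R1).
- by [].
- case: wj => j /andP[j0 jm] wj; exists j; first by rewrite j0.
  rewrite /w1 gtn_eqF //; apply: contraNneq wj => h.
  by rewrite -w1E /w1 gtn_eqF // h expr0n gtn_eqF.
- by rewrite eR1 mulrN opprK mulrC.
- by rewrite -(coprimep_pexpl _ _ p_gt0) -(coprimep_pexpr _ _ p_gt0) -eA -eN.
- by rewrite -(coprimep_pexpl _ _ p_gt0) -(coprimep_pexpr _ _ p_gt0) -eC -eN.
- by rewrite -(coprimep_pexpl _ _ p_gt0) -(coprimep_pexpr _ _ p_gt0) -eC -eR.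
- by apply: contraNneq A0 => h; rewrite eA h expr0n gtn_eqF.
- by apply: contraNneq C0 => h; rewrite eC h expr0n gtn_eqF.
- move: N_gt0 N_lt; rewrite eN degp muln_gt0 p_gt0 /= => -> /=.
  by rewrite expnS ltn_pmul2l.
move=> i [N2 [eN1 N2_gt0 hi]]; exists i.+1, N2; split=> //.
  by rewrite eN eN1 -exprM mulnC -expnS.
rewrite eT eC !degp expnS -mulnA -mulnDr leq_pmul2l //.
Qed.

End Descent.

(** * Stepanov's method *)

Section Stepanov.
Variable F : finFieldType.

(** There are more unknown coefficients than conditions. Since they enter through [p^s]-th powers,
    the map is additive but not linear over [F]; counting inputs against outputs replaces the rank
    argument, and the difference of two colliding inputs is the solution. *)
Lemma kernel_pigeonhole p s (M B D0 D1 : nat) (G : {poly F}) :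
    p \in [pchar F] -> (M < B * (D0 + D1))%N ->
    (p ^ s * (B - 1) + D0 <= M)%N -> (p ^ s * (B - 1) + (D1 + deg G) <= M)%N ->
    (0 < B)%N ->
  exists h0 : nat -> {poly F}, exists h1 : nat -> {poly F},
    [/\ forall j, (deg (h0 j) < B)%N, forall j, (deg (h1 j) < B)%N,
       (exists2 j, (j < D0)%N & h0 j != 0) \/ (exists2 j, (j < D1)%N & h1 j != 0)
     & \sum_(j < D0) h0 j ^+ (p ^ s) * 'X^j
       + G * \sum_(j < D1) h1 j ^+ (p ^ s) * 'X^j = 0].
Proof.
move=> charF ltM M0 M1 B0; set l := (p ^ s)%N in M0 M1 *.
have cFX := charFX charF.
pose T := ({ffun 'I_D0 -> 'rV[F]_B} * {ffun 'I_D1 -> 'rV[F]_B})%type.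
pose psi (u : T) : {poly F} := \sum_(j < D0) rVpoly (u.1 j) ^+ l * 'X^j
       + G * \sum_(j < D1) rVpoly (u.2 j) ^+ l * 'X^j.
have degr (a : 'rV[F]_B) : (deg (rVpoly a) <= B - 1)%N.
  by rewrite deg_leE subn1 [X in (_ <= X)%N]prednK // size_poly.
have dS D (a : {ffun 'I_D -> 'rV[F]_B}) :
    (deg (\sum_(j < D) rVpoly (a j) ^+ l * 'X^j) <= l * (B - 1) + D.-1)%N.
  apply: deg_sum_le => j _; rewrite (leq_trans (degM_le _ _)) // degX degXn.
  by rewrite leq_add ?leq_mul2l ?degr ?orbT //; case: D j {a} => [[]|D j] //=; rewrite -ltnS.
have szpsi u : (size (psi u) <= M)%N.
  have M_gt0 : (0 < M)%N.
    rewrite lt0n; apply/eqP => Me; move: ltM M0 M1; rewrite Me; clear => h h0 h1.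
    have [D00 D10] : D0 = 0%N /\ D1 = 0%N by split; move: (l * _)%N h0 h1 => y; lia.
    by rewrite D00 D10 muln0 in h.
  rewrite -(prednK M_gt0) -deg_leE degD_le //.
    have [D00|D00] := posnP D0.
      by rewrite big1 ?deg0 // => j _; have := ltn_ord j; rewrite [X in (_ < X)%N]D00.
    by rewrite (leq_trans (dS _ _)) //; move: M0 D00; clear; lia.
  have [D10|D10] := posnP D1.
    by rewrite big1 ?mulr0 ?deg0 // => j _; have := ltn_ord j; rewrite [X in (_ < X)%N]D10.
  rewrite (leq_trans (degM_le _ _)) // (leq_trans (leq_add (leqnn _) (dS _ _))) //.
  by move: M1 D10; clear; lia.
have /injectivePn[u [u' neq e]] : ~~ injectiveb (fun u : T => poly_rV (psi u) : 'rV[F]_M).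
  apply/negP => /injectiveP /leq_card; rewrite leqNgt => /negP; apply.
  rewrite card_prod !card_ffun !card_mx !card_ord !mul1n -!expnM -expnD -mulnDr.
  by rewrite ltn_exp2l // finNzRing_gt1.
have {}e : psi u = psi u'.
  by move/(congr1 rVpoly): e; rewrite !poly_rV_K.
pose h D (a b : {ffun 'I_D -> 'rV[F]_B}) (j : nat) : {poly F} :=
  if insub j is Some i then rVpoly (a i) - rVpoly (b i) else 0.
have hE D a b (i : 'I_D) : h D a b i = rVpoly (a i) - rVpoly (b i).
  by rewrite /h valK.
have hd D a b j : (deg (h D a b j) < B)%N.
  rewrite /h; case: insubP => [i _ _|_]; last by rewrite deg0.
  by apply: leq_ltn_trans (_ : B - 1 < B)%N; rewrite ?ltn_subrL ?B0 // degD_le ?degN ?degr.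
have hn D (a b : {ffun 'I_D -> 'rV[F]_B}) : a != b -> exists2 j, (j < D)%N & h D a b j != 0.
  move=> ab; have [i ni] : exists i, a i != b i.
    apply/existsP; apply: contraR ab; rewrite negb_exists => /forallP H.
    by apply/eqP/ffunP => i; apply/eqP; move: (H i); rewrite negbK.
  exists i => //; rewrite hE subr_eq0; apply: contraNneq ni => /(congr1 (poly_rV (d:=B))).
  by rewrite !rVpolyK => ->.
exists (h D0 u.1 u'.1), (h D1 u.2 u'.2); split=> [j|j||]; try exact: hd.
  have [e1|n1] := eqVneq u.1 u'.1; last by left; apply: hn.
  by right; apply: hn; apply: contraNneq neq => e2;
    rewrite [u]surjective_pairing [u']surjective_pairing e1 e2.
have sE D (a b : {ffun 'I_D -> 'rV[F]_B}) : \sum_(j < D) h D a b j ^+ l * 'X^j =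
   \sum_(j < D) rVpoly (a j) ^+ l * 'X^j - \sum_(j < D) rVpoly (b j) ^+ l * 'X^j.
  by rewrite -sumrB; apply: eq_bigr => j _; rewrite hE (exprBp cFX) mulrBl.
rewrite !sE mulrBr.
transitivity (psi u - psi u'); first by rewrite /psi; ring.
by rewrite e subrr.
Qed.

(** The outer variable [Y] of [U] is later specialised to [X^P]; the bound concerns the degree in
    [X]. *)
Definition coef_bound b (U : {poly {poly F}}) := forall i, (deg U`_i <= b)%N.

Lemma coef_boundM a b U V :
  coef_bound a U -> coef_bound b V -> coef_bound (a + b) (U * V).
Proof.
move=> hU hV i; rewrite coefM; apply: deg_sum_le => j _.
by rewrite (leq_trans (degM_le _ _)) ?leq_add.
Qed.

Lemma coef_boundX b U n : coef_bound b U -> coef_bound (n * b) (U ^+ n).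
Proof.
move=> hU; elim: n => [|n IH].
  by rewrite expr0 mul0n => i; rewrite coef1; case: eqP => _; rewrite ?deg0 ?degC.
by rewrite exprS mulSn; apply: coef_boundM.
Qed.

(** Coefficients of degree below [P] act as digits in base [X^P]: distinct powers of [Y] cannot
    cancel. *)
Lemma horner_Xn_eq0 P b (U : {poly {poly F}}) :
  coef_bound b U -> (b < P)%N -> U.['X^P] = 0 -> U = 0.
Proof.
move=> hU bP; rewrite horner_coef => e; apply/eqP/negPn/negP => U0.
move: e; have sU : (0 < size U)%N by rewrite size_poly_gt0.
rewrite -(prednK sU) big_ord_recr /= -lead_coefE => e.
have lU : lead_coef U != 0 by rewrite lead_coef_eq0.
have e1 : deg (lead_coef U * 'X^P ^+ (size U).-1) = (deg (lead_coef U) + (size U).-1 * P)%N.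
  by rewrite -exprM degM ?expf_neq0 ?polyX_eq0 // degXn mulnC.
have e2 : lead_coef U * 'X^P ^+ (size U).-1 = - \sum_(i < (size U).-1) U`_i * 'X^P ^+ i.
  by apply/eqP; rewrite -addr_eq0 addrC e.
have nz : lead_coef U * 'X^P ^+ (size U).-1 != 0.
  by rewrite mulf_neq0 // -exprM expf_neq0 ?polyX_eq0.
have [s0|s0] := posnP (size U).-1.
  by move: nz; rewrite e2 s0 big_ord0 oppr0 eqxx.
have : (deg (lead_coef U * 'X^P ^+ (size U).-1) <= b + (size U).-2 * P)%N.
  rewrite e2 degN; apply: deg_sum_le => i _; rewrite (leq_trans (degM_le _ _)) //.
  rewrite leq_add // -exprM degXn mulnC leq_mul2r -ltnS prednK // ltn_ord orbT //.
by rewrite e1 -{1}(prednK s0) mulSn; move: bP; clear; lia.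
Qed.

(* Stepanov's method with the nonvanishing order replaced by an [l]-th power: *)
(* if [N ^ ((q - 1) / v) = 1] off [Z], the relation                           *)
(* [sum h0_j ^ l X^j + N^((l-1)/v) sum h1_j ^ l X^j = 0] makes the [l]-th     *)
(* root of [sum h0_j ^ l X^(j q) N^((q-l)/v) + sum h1_j ^ l X^(j q)] vanish   *)
(* off [Z].                                                                   *)
Lemma stepanov p s a v (N : {poly F}) (Z : {set F}) (B D0 D1 K0 K1 : nat) :
    p \in [pchar F] -> #|F| = (p ^ s * p ^ a)%N -> (0 < v)%N ->
    (v * K0 = p ^ a - 1)%N -> (v * K1 = p ^ s - 1)%N -> (1 < p ^ a)%N ->
    N != 0 -> (forall x, x \notin Z -> N.[x] ^+ (p ^ s * K0 + K1) = 1) ->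
    (0 < B)%N -> (v * (B - 1) + deg N < p ^ a)%N ->
    (K0 * deg N + (B - 1) + (D0 - 1) * p ^ a + #|Z| < #|F|)%N ->
    ((B - 1) + (D1 - 1) * p ^ a + #|Z| < #|F|)%N ->
    (p ^ s * (B - 1) + D0 < B * (D0 + D1))%N ->
    (p ^ s * (B - 1) + (D1 + K1 * deg N) < B * (D0 + D1))%N ->
  exists c (g : {poly F}), N = c *: g ^+ v.
Proof.
move=> charF cardF v0 eK0 eK1 P1 N0 goodN B0 hB hD0 hD1 hM0 hM1.
have cFX := charFX charF.
set l := (p ^ s)%N in cardF eK1 goodN hM0 hM1 *; set P := (p ^ a)%N in cardF eK0 P1 hB hD0 hD1 *.
have l0 : (0 < l)%N := expp_gt0 charF s.
have K00 : (0 < l * K0 + K1)%N.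
  rewrite addn_gt0 muln_gt0 l0 lt0n; apply/orP; left.
  by apply: contraTneq P1 => k0; rewrite -leqNgt -subn_eq0 -eK0 k0 muln0.
have := @kernel_pigeonhole p s (l * (B - 1) + maxn D0 (D1 + K1 * deg N)) B D0 D1 (N ^+ K1) charF.
rewrite -/l degX; case=> //.
- by case: (leqP D0 (D1 + K1 * deg N)).
- by rewrite leq_add2l leq_maxl.
- by rewrite leq_add2l leq_maxr.
move=> h0 [h1 [d0 d1 nz e]].
pose g D (h : nat -> {poly F}) := \poly_(j < D) h j.
pose H := N ^+ K0 * (g D0 h0).['X^P] + (g D1 h1).['X^P].
have gE D h : (g D h).['X^P] = \sum_(j < D) h j * 'X^(P * j).
  by rewrite horner_poly; apply: eq_bigr => j _; rewrite -exprM.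
have glE D h : (g D h).['X^P] ^+ l = \sum_(j < D) h j ^+ l * 'X^(#|F| * j).
  rewrite gE (exprp_sum cFX); apply: eq_bigr => j _.
  by rewrite exprMn -/l -exprM cardF mulnAC [(P * l)%N]mulnC.
have ev D h x : ((g D h).['X^P] ^+ l).[x] = (\sum_(j < D) h j ^+ l * 'X^j).[x].
  rewrite glE !horner_sum; apply: eq_bigr => j _.
  by rewrite !hornerM !hornerXn exprM expf_card.
have rootH x : x \notin Z -> root H x.
  move=> xZ; have Nx : N.[x] != 0.
    apply: contra_eq_neq (goodN x xZ) => ->.
    by rewrite expr0n (gtn_eqF K00) mulr0n eq_sym oner_eq0.
  have : (H ^+ l).[x] * N.[x] ^+ K1 = 0.
    rewrite (exprDp cFX) -/l exprMn hornerD hornerM !ev -exprM horner_exp mulrDl.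
    rewrite mulrAC -exprD [(K0 * l)%N]mulnC goodN // mul1r.
    have := congr1 (horner^~ x) e; rewrite /= hornerD hornerM horner_exp horner0.
    by move=> <-; congr (_ + _); exact: mulrC.
  move/eqP; rewrite mulf_eq0 [in X in _ || X]expf_eq0 (negPf Nx) andbF orbF.
  by rewrite horner_exp expf_eq0 => /andP[].
have cb D h : (forall j, (deg (h j) < B)%N) -> coef_bound (B - 1) (g D h).
  move=> hd i; rewrite coef_poly; case: ifP => _; last by rewrite deg0.
  by have := hd i; case: (B) => // b; rewrite subn1.
have degg D h : (forall j, (deg (h j) < B)%N) ->
    (deg (g D h).['X^P] <= B - 1 + (D - 1) * P)%N.
  move=> hd; rewrite gE; apply: deg_sum_le => j _.
  rewrite (leq_trans (degM_le _ _)) // degXn mulnC leq_add //.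
    by have := hd j; case: (B) => // b; rewrite subn1.
  by rewrite leq_mul2r subn1; case: (D) j => [[]|D' j] //=; rewrite -ltnS ltn_ord orbT.
(* The degree hypotheses keep [deg H] below the number of points off [Z], at all of which [H]
   vanishes. *)
have H0 : H = 0.
  apply: (@dvdp_deg_eq0 _ (rootpoly (~: Z))); last first.
    by apply: dvdp_rootpoly => x; rewrite in_setC; apply: rootH.
  rewrite deg_rootpoly cardsCs setCK; set z := #|Z| in hD0 hD1 *.
  have b0 := degg D0 h0 d0; have b1 := degg D1 h1 d1.
  have degNK : deg (N ^+ K0) = (K0 * deg N)%N by rewrite degX.
  move: hD0 hD1 b0 b1 degNK.
  move: #|F| (K0 * deg N)%N ((D0 - 1) * P)%N ((D1 - 1) * P)%N => f x y t.
  move=> hD0 hD1 b0 b1 degNK.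
  have degH0 : (deg (N ^+ K0 * (g D0 h0).['X^P]) <= f - z.+1)%N.
    rewrite (leq_trans (degM_le _ _)) // degNK; move: b0 hD0; clear; lia.
  apply: (@leq_ltn_trans (f - z.+1)); last by move: hD1; clear; lia.
  by rewrite degD_le // (leq_trans b1) //; move: hD1; clear; lia.
have g_eq0 D h : (forall j, (deg (h j) < B)%N) -> (g D h).['X^P] = 0 -> g D h = 0.
  move=> hd; apply: (@horner_Xn_eq0 P (B - 1)); first exact: cb.
  by apply: leq_ltn_trans hB; rewrite (leq_trans (leq_pmull _ v0)) ?leq_addr.
have g_neq0 D h : (exists2 j, (j < D)%N & h j != 0) -> g D h != 0.
  case=> j jD; apply: contraNneq => /(congr1 (fun f : {poly {poly F}} => f`_j)).
  by rewrite coef_poly jD coef0 => ->.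
have g1n0 : g D1 h1 != 0.
  apply/eqP => g1; case: nz => [/g_neq0|/g_neq0]; last by rewrite g1 eqxx.
  case/eqP; apply: g_eq0 => //; move/eqP: H0; rewrite /H g1 horner0 addr0.
  by rewrite mulf_eq0 expf_eq0 (negPf N0) andbF => /eqP.
(* In characteristic [p] the power [N^P] is a polynomial in [X^P] with constant coefficients. *)
have [fr [frE frb fr0]] : exists fr : {poly {poly F}},
    [/\ N ^+ P = fr.['X^P], coef_bound 0 fr & fr != 0].
  have e1 : N ^+ P = (\poly_(i < size N) (N`_i ^+ P)%:P).['X^P].
    rewrite horner_poly {1}[N](_ : _ = \sum_(i < size N) N`_i *: 'X^i).
      rewrite (exprp_sum cFX); apply: eq_bigr => i _.
      by rewrite exprZn mul_polyC exprAC.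
    by rewrite -[LHS]coefK poly_def.
  exists (\poly_(i < size N) (N`_i ^+ P)%:P); split=> //.
    by move=> i; rewrite coef_poly; case: ifP => _; rewrite ?deg0 ?degC.
  have : N ^+ P != 0 by rewrite expf_neq0.
  by apply: contraNneq => f0; rewrite e1 f0 horner0.
have sg2 : (- 1) ^+ v * (- 1) ^+ v = 1 :> {poly F}.
  by rewrite -exprD addnn -mul2n exprM sqrrN expr1n expr1n.
(* The [v]-th power of [N^K0 g0 = - g1], times [N], contains [N^(v K0 + 1) = N^P]. This identity at
   [Y = X^P] has coefficients of [X]-degree below [P], so it holds for an independent [Y]. *)
pose U := fr * g D0 h0 ^+ v - ((- 1) ^+ v * N)%:P * g D1 h1 ^+ v.
have U0 : U = 0.
  apply: (@horner_Xn_eq0 P (v * (B - 1) + deg N)) => //.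
    move=> i; rewrite coefB degD_le // ?degN.
      apply: leq_trans (leq_addr _ _); rewrite -[X in (_ <= X)%N]add0n.
      by apply: (coef_boundM frb); apply: coef_boundX; apply: cb.
    rewrite addnC; apply: coef_boundM; last by apply: coef_boundX; apply: cb.
    move=> j; rewrite coefC; case: eqP => _; rewrite ?deg0 //.
    by rewrite -signr_odd mulr_sign; case: odd; rewrite ?degN.
  have e3 : (g D1 h1).['X^P] = - (N ^+ K0 * (g D0 h0).['X^P]).
    by apply/eqP; rewrite -addr_eq0 addrC -/H H0.
  rewrite /U hornerD hornerN !hornerM !horner_exp hornerC -frE e3.
  rewrite [(- (N ^+ K0 * _)) ^+ v]exprNn exprMn -exprM.
  have -> : N ^+ P = N * N ^+ (K0 * v).
    by rewrite -exprS mulnC eK0 -addn1 subnK // ltnW.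
  move: ((- 1) ^+ v) sg2 => sg sg2; rewrite [X in _ - X](_ : _ =
     (sg * sg) * (N * (N ^+ (K0 * v) * (g D0 h0).['X^P] ^+ v))); last by ring.
  by rewrite sg2; ring.
(* Compare leading coefficients in [Y]: that of [fr] is a constant, so [N] is a constant times a
   quotient of [v]-th powers. *)
have lcE : lead_coef fr * lead_coef (g D0 h0) ^+ v
      = (- 1) ^+ v * (N * lead_coef (g D1 h1) ^+ v).
  have /eqP := U0; rewrite subr_eq0 => /eqP/(congr1 lead_coef).
  by rewrite !lead_coefM !lead_coef_exp lead_coefC mulrA.
have lfr : deg (lead_coef fr) = 0%N by apply/eqP; rewrite -leqn0 lead_coefE.
set G0 := lead_coef (g D0 h0) in lcE; set G1 := lead_coef (g D1 h1) in lcE.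
have G10 : G1 != 0 by rewrite lead_coef_eq0.
rewrite (deg_eq0P lfr) in lcE; set c := _`_0 in lcE.
have c0 : c != 0.
  have : lead_coef fr != 0 by rewrite lead_coef_eq0.
  by rewrite (deg_eq0P lfr) polyC_eq0.
have NE : N * G1 ^+ v = ((- 1) ^+ v * c) *: G0 ^+ v.
  rewrite -mul_polyC rmorphM rmorphXn rmorphN rmorph1 /= -mulrA lcE mulrA.
  by rewrite sg2 mul1r.
have c1 : (- 1) ^+ v * c != 0 :> F by rewrite mulf_neq0 // signr_eq0.
have dv : G1 %| G0.
  rewrite -(dvdp_pexp2r _ _ v0) -(dvdpZr _ _ c1) -NE; exact: dvdp_mulIr.
have [g' eg] := dvdpP _ _ dv; exists ((- 1) ^+ v * c), g'.
apply: (mulIf (expf_neq0 v G10)); rewrite NE eg exprMn scalerAl //.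
Qed.

End Stepanov.

(** * The last factor: one-dimensional case *)

Lemma arith_delta_le2 k1 v d : (v <= k1)%N -> (3 * v < k1 + 4)%N ->
  (k1 * d + 2 * d <= 2 * k1 + 2 + v * d)%N -> (d <= 2)%N.
Proof.
move=> vk vk3 h; rewrite leqNgt; apply/negP => d3.
have : ((k1 + 2 - v) * 3 <= (k1 + 2 - v) * d)%N by rewrite leq_mul2l d3 orbT.
rewrite !mulnBl !mulnDl; move: h vk3; move: (k1 * d)%N (v * d)%N => x y; lia.
Qed.

(** Used for [n = 3k] with [r = rho 1], [r v + 1 = kap], [nu = deg N], [n0 = #|Z|], [a = deg A],
    [c = deg C]. The alternatives say which term of [L = A^kap + X C^kap] has the larger degree,
    each with its Wronskian bound. *)
Lemma arith_m1 r v nu n0 a c :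
    (1 < r)%N -> (1 < v)%N -> (3 * v < r * v + 4)%N -> (0 < nu)%N ->
    (n0 + r * nu = (r * v + 1) * (r * v + 1) + c)%N ->
    [/\ a <= c, n0 = (r * v + 1) * c + 1 & (r - 1) * nu + 2 <= 2 * c]%N \/
    [/\ c < a, n0 = (r * v + 1) * a & (r - 1) * nu + 1 <= a + c]%N ->
  exists dl, [/\ (0 < dl <= 2)%N, (nu <= v * dl)%N &
    (n0 <= (r * v + 1) * (r * v + 2 - dl) + 1)%N].
Proof.
move=> r1 v1; have r0 : (0 < r)%N := ltnW r1.
have vk : (v <= r * v)%N by rewrite leq_pmull.
have rB x : (r * x = (r - 1) * x + x)%N by rewrite -{3}[x]mul1n -mulnDl subnK.
have mA x : (r * v * x = r * (v * x))%N by rewrite mulnA.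
move: (r * v)%N vk mA => k1 vk mA vk3 nu0 e; have k0 : (0 < k1)%N by lia.
case=> [[ac en W]|[ca en W]].
  rewrite en !mulnDl !mulnDr !mul1n !muln1 in e.
  have cle : (c <= k1 + 2)%N.
    by rewrite -(leq_pmul2l k0) mulnDr; move: e; move: (r * nu)%N (k1 * c)%N (k1 * k1)%N =>
      x y z; lia.
  (* The witness is [kap + 1] minus the larger of [a] and [c]; here [k1 + 2 = kap + 1]. *)
  have [d ed] : exists d, (c + d = k1 + 2)%N by exists (k1 + 2 - c)%N; lia.
  have e2 : (k1 * c + k1 * d = k1 * k1 + k1 * 2)%N by rewrite -!mulnDr ed.
  have e3 : (r * nu = r * (v * d))%N.
    by rewrite -mA; move: e e2; move: (r * nu)%N (k1 * c)%N (k1 * k1)%N (k1 * d)%N => x y z t; lia.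
  have enu : nu = (v * d)%N by apply/eqP; rewrite -(eqn_pmul2l r0) e3.
  exists d; split; last by rewrite en leq_add2r leq_mul2l; apply/orP; right; lia.
    have -> /= : (0 < d)%N by case: (d) enu nu0 => // ->; rewrite muln0.
    apply: (arith_delta_le2 vk vk3); rewrite mA rB -enu.
    by move: W ed; move: ((r - 1) * nu)%N => x; lia.
  by rewrite enu.
have rnu2 : (0 < r * nu)%N by rewrite muln_gt0 r0.
rewrite en !mulnDl !mulnDr !mul1n !muln1 in e.
have ale : (a < k1 + 2)%N.
  rewrite -(ltn_pmul2l k0) mulnDr.
  by move: e ca rnu2; move: (r * nu)%N (k1 * a)%N (k1 * k1)%N => x y z; lia.
have [d ed] : exists d, (a + d = k1 + 2)%N by exists (k1 + 2 - a)%N; lia.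
have [g eg] : exists g, (c + 1 + g = a)%N by exists (a - c - 1)%N; lia.
have e2 : (k1 * a + k1 * d = k1 * k1 + k1 * 2)%N by rewrite -!mulnDr ed.
have e3 : (r * nu + g = r * (v * d))%N.
  by rewrite -mA; move: e e2 eg; move: (r * nu)%N (k1 * a)%N (k1 * k1)%N (k1 * d)%N => x y z t; lia.
have enu : (nu <= v * d)%N by rewrite -(leq_pmul2l r0) -e3 leq_addr.
exists d; split=> //; last by rewrite en; apply: leq_trans (leq_addr _ _); rewrite leq_mul2l;
  apply/orP; right; lia.
have -> /= : (0 < d)%N by lia.
apply: (arith_delta_le2 vk vk3); rewrite mA rB.
have W2 : (r * ((r - 1) * nu + 1) <= r * (a + c))%N by rewrite leq_mul2l W orbT.
have W3 : ((r - 1) * (v * d) + 2 <= 2 * a)%N.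
  rewrite -(leq_pmul2l r0) mulnDr [(r * (2 * a))%N]mulnCA mulnCA -e3 mulnDr.
  rewrite mulnDr muln1 mulnCA in W2.
  have eg2 : (r * c + r + r * g = r * a)%N by rewrite -{2}[r]muln1 -!mulnDr eg.
  have := rB g; rewrite mulnDr in W2; move: W2 eg2.
  move: ((r - 1) * (r * nu))%N ((r - 1) * g)%N (r * g)%N (r * a)%N (r * c)%N => x y z t u.
  lia.
by lia.
Qed.

(** * Degrees in the factored equation, in any dimension *)

Section Structure2.
Variables (F : finFieldType) (p n k v m : nat) (w : nat -> F) (Z : {set F}).
Variables C N : {poly F}.
Local Notation L := (rootpoly Z).
Local Notation q := (p ^ n)%N.
Local Notation kap := (p ^ k)%N.
Local Notation Q := (p ^ (m * k))%N.
Local Notation rh := (rho p k v).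
Hypotheses (charF : p \in [pchar F]) (k_gt0 : (0 < k)%N) (m_gt0 : (0 < m)%N).
Hypotheses (v_gt0 : (0 < v)%N) (v_dvd : (v %| kap - 1)%N) (mk_le : (m * k <= n)%N).
Hypotheses (wm : w m != 0) (Z_gt0 : (0 < #|Z|)%N) (N_neq0 : N != 0).
Hypothesis eC : L^`() = C ^+ Q.
Hypothesis mvs_eq : \sum_(l < m.+1) w l *: (L ^+ (kap ^ l) * N ^+ (Q * rh l))
  = ('X - 'X^q) * L^`().
Hypothesis coCL : coprimep C L.

Let pr : prime p := pcharf_prime charF.
Let p_gt1 : (1 < p)%N := prime_gt1 pr.
Let kap1 : (1 < kap)%N := kap_gt1 charF k_gt0.
Let L0 : L != 0 := rootpoly_neq0 Z.
Let degL : deg L = #|Z| := deg_rootpoly Z.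
Let Q0 : (0 < Q)%N := expp_gt0 charF (m * k).

Lemma Q_kap : Q = (kap ^ m)%N. Proof. by rewrite -expnM mulnC. Qed.

Lemma size_expM_incr i j : (i < j)%N ->
  (size (L ^+ (kap ^ i) * N ^+ (Q * rh i))%R < size (L ^+ (kap ^ j) * N ^+ (Q * rh j))%R)%N.
Proof.
move=> ij; rewrite !size_deg ?mulf_neq0 ?expf_neq0 // ltnS !degM ?expf_neq0 // !degX.
rewrite -addSn leq_add //.
  by rewrite ltn_pmul2r ?degL // ltn_exp2l.
rewrite leq_mul2r leq_mul2l; apply/orP; right; apply/orP; right.
by rewrite ltnW // (rho_ltn kap1).
Qed.

Lemma C_neq0 : C != 0.
Proof.
apply: contraTneq coCL => ->; rewrite coprime0p.
apply/negP => /andP[/(dvdp_deg (oner_neq0 _))]; rewrite degL degC.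
by rewrite leqNgt Z_gt0.
Qed.

Lemma L'_nz : L^`() != 0.
Proof. by rewrite eC expf_neq0 ?C_neq0. Qed.

Lemma degC_lt : (Q * deg C + 1 <= #|Z|)%N.
Proof. by rewrite -degX -eC addn1 -degL deg_lt_deriv ?L'_nz. Qed.

(** The term [l = m] strictly dominates the left side of [mvs_eq]; its degree is compared with
    [q + Q deg C] and [Q] is cancelled. *)
Lemma deg_relation : (#|Z| + rh m * deg N = p ^ (n - m * k) + deg C)%N.
Proof.
have q1 : (1 < q)%N by rewrite -(expn0 p) ltn_exp2l // (leq_trans _ mk_le) // muln_gt0 m_gt0.
have X0 : deg ('X - 'X^q : {poly F}) = q by rewrite degDr ?degN ?degXn // -['X]expr1 degXn.
have dR : deg (('X - 'X^q) * L^`()) = (q + Q * deg C)%N.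
  rewrite degM ?L'_nz // ?X0; first by rewrite eC degX.
  by apply/eqP => h; move: X0 q1; rewrite h deg0 => <-.
have dL : deg (L ^+ (kap ^ m) * N ^+ (Q * rh m)) = (Q * (#|Z| + rh m * deg N))%N.
  by rewrite degM ?expf_neq0 // !degX degL -Q_kap mulnDr mulnA.
have [i|i j|h|[j [jm _ wj sj]]] := @incr_sum F (fun l => L ^+ (kap ^ l) * N ^+ (Q * rh l)) w m.+1.
- by rewrite mulf_neq0 ?expf_neq0.
- exact: size_expM_incr.
- by move: wm; rewrite h ?eqxx.
have ej : j = m.
  move: jm; rewrite ltnS leq_eqVlt => /orP[/eqP//|jm].
  by move: wm; rewrite wj ?eqxx // jm /=.
rewrite ej mvs_eq in sj; have := congr1 predn sj; rewrite -/(deg _) dR -/(deg _) dL.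
have -> : q = (Q * p ^ (n - m * k))%N by rewrite -expnD subnKC.
by rewrite -mulnDr => /eqP; rewrite eqn_pmul2l // => /eqP.
Qed.

End Structure2.

(** The inequalities of [stepanov] for [l = K], [P = K^2], [B = K], [D0 = K - 2], [D1 = K - 1], in
    the case [deg N <= v]. *)
Lemma stepanov_range1 K x y z : (4 < K)%N -> (x <= (K * K - 1) * 1)%N ->
    (y <= (K - 1) * 1)%N -> (z <= K * (K + 1 - 1) + 1)%N ->
  [/\ (x + (K - 1) + (K - 2 - 1) * (K * K) + z < K * (K * K))%N,
      (K - 1 + (K - 1 - 1) * (K * K) + z < K * (K * K))%N,
      (K * (K - 1) + (K - 2) < K * (K - 2 + (K - 1)))%N &
      (K * (K - 1) + (K - 1 + y) < K * (K - 2 + (K - 1)))%N].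
Proof.
move=> K4 hx hy hz; have [j eK] : exists j, K = (j + 5)%N by exists (K - 5)%N; lia.
have e i : (i <= K)%N -> (K * (K * K) = (K - i) * (K * K) + i * (K * K))%N.
  by move=> iK; rewrite -mulnDl subnK.
have e1 := e 3 (ltnW (ltnW K4)); have e2 := e 2 (ltnW (ltnW (ltnW K4))).
subst K; rewrite -!subnDA !addn1.
split.
- by rewrite e1 addnAC addnC ltn_add2l; move: hx hz; clear; nia.
- by rewrite e2 addnAC addnC ltn_add2l; move: hz; clear; nia.
- by clear; nia.
- by move: hy; clear; nia.
Qed.
(** The same for [deg N <= 2v] and a smaller [Z], with [B = K - 1], [D0 = K - 2], [D1 = K]. *)
Lemma stepanov_range2 K x y z : (4 < K)%N -> (x <= (K * K - 1) * 2)%N ->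
    (y <= (K - 1) * 2)%N -> (z <= K * (K + 1 - 2) + 1)%N ->
  [/\ (x + (K - 1 - 1) + (K - 2 - 1) * (K * K) + z < K * (K * K))%N,
      (K - 1 - 1 + (K - 1) * (K * K) + z < K * (K * K))%N,
      (K * (K - 1 - 1) + (K - 2) < (K - 1) * (K - 2 + K))%N &
      (K * (K - 1 - 1) + (K + y) < (K - 1) * (K - 2 + K))%N].
Proof.
move=> K4 hx hy hz; have [j eK] : exists j, K = (j + 5)%N by exists (K - 5)%N; lia.
have e i : (i <= K)%N -> (K * (K * K) = (K - i) * (K * K) + i * (K * K))%N.
  by move=> iK; rewrite -mulnDl subnK.
have e1 := e 3 (ltnW (ltnW K4)).
have e2 := e 1 (ltnW (ltnW (ltnW (ltnW K4)))).
subst K; rewrite -!subnDA !addn1.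
split.
- by rewrite e1 addnAC addnC ltn_add2l; move: hx hz; clear; nia.
- by rewrite e2 addnAC addnC ltn_add2l; move: hz; clear; nia.
- by clear; nia.
- by move: hy; clear; nia.
Qed.

Lemma rootpoly_exp_dvd (F : finFieldType) (Z : {set F}) (f : {poly F}) v :
  f != 0 -> {in Z, forall a, (v <= mup a f)%N} -> rootpoly Z ^+ v %| f.
Proof.
elim: v f => [|v IH] f f0 hf; first by rewrite expr0 dvd1p.
have /dvdpP[g eg] : rootpoly Z %| f.
  apply: dvdp_rootpoly => a aZ.
  by rewrite -dvdp_XsubCl XsubC_dvd // (leq_trans _ (hf a aZ)).
have g0 : g != 0 by apply: contraNneq f0 => h; rewrite eg h mul0r.
rewrite eg exprSr dvdp_mul2r ?rootpoly_neq0 //; apply: IH => // a aZ.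
by have := hf a aZ; rewrite eg mupM ?rootpoly_neq0 // mup_rootpoly // addn1.
Qed.

(** * Dimension one: [N] is a [v]-th power up to a constant *)

Section M1.
Variables (F : finFieldType) (p n k v : nat) (w1 : F) (Z : {set F}).
Variables C N : {poly F}.
Local Notation L := (rootpoly Z).
Local Notation q := (p ^ n)%N.
Local Notation kap := (p ^ k)%N.
Local Notation rh := (rho p k v).
Local Notation r := (rho p k v 1).
Hypotheses (charF : p \in [pchar F]) (k_gt0 : (0 < k)%N) (v_gt1 : (1 < v)%N).
Hypotheses (v_dvd : (v %| kap - 1)%N) (k_le : (k <= n)%N) (cardF : #|F| = q).
Hypotheses (w1_neq0 : w1 != 0) (Z_gt0 : (0 < #|Z|)%N) (N_neq0 : N != 0) (C0 : C != 0).
Hypothesis eC : L^`() = C ^+ kap.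
Hypothesis mvs_eq : L + w1 *: (L ^+ kap * N ^+ (kap * r)) = ('X - 'X^q) * L^`().
Hypotheses (coCL : coprimep C L).
Hypothesis degC_lt : (kap * deg C + 1 <= #|Z|)%N.
Hypothesis deg_rel : (#|Z| + r * deg N = p ^ (n - k) + deg C)%N.
Hypothesis r_gt1 : (1 < r)%N.
Hypothesis r_ndvd : forall i, (0 < i < k)%N -> ~~ (r %| p ^ i - 1)%N.

Let pr : prime p := pcharf_prime charF.
Let p_gt1 : (1 < p)%N := prime_gt1 pr.
Let kap1 : (1 < kap)%N := kap_gt1 charF k_gt0.
Let v_gt0 : (0 < v)%N := ltnW v_gt1.
Let rhM l : (v * rh l + 1 = kap ^ l)%N := rho_mul kap1 v_dvd l.
Let L0 : L != 0 := rootpoly_neq0 Z.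
Let degL : deg L = #|Z| := deg_rootpoly Z.
Let cFX := charFX charF.

Local Notation X := ('X^(p ^ (n - k)) : {poly F}).

Lemma m1_setup : exists A w', [/\ A ^+ kap = L - 'X * C ^+ kap, w' != 0
  & - (A + X * C) = w' *: (L * N ^+ r)].
Proof.
have [w' ew] := finfield_root charF k w1.
exists (- (X * C + w' *: (L * N ^+ r))), w'; split; last by ring.
  rewrite (exprNp cFX) (exprDp cFX) exprZn ew !exprMn -!exprM -expnD subnK // mulnC -eC.
  have -> : w1 *: (L ^+ kap * N ^+ (kap * r)) = ('X - 'X^q) * L^`() - L.
    by rewrite -mvs_eq; ring.
  by ring.
have : w1 != 0 by [].
by rewrite -ew; apply: contraNneq => ->; rewrite expr0n (gtn_eqF (ltnW kap1)).
Qed.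

Section WithA.
Variables (A : {poly F}) (w' : F).
Hypotheses (eA : A ^+ kap = L - 'X * C ^+ kap) (w'0 : w' != 0).
Hypothesis eW : - (A + X * C) = w' *: (L * N ^+ r).

Lemma m1_coprime : coprimep C A.
Proof.
have kap0 : (0 < kap)%N := ltnW kap1.
have cCL : coprimep (C ^+ kap) L by rewrite coprimep_pexpl.
rewrite -(coprimep_pexpr _ _ kap0) -(coprimep_pexpl _ _ kap0) eA.
by rewrite -mulNr addrC coprimep_addl_mul.
Qed.

Lemma m1_degA : (kap * deg A <= #|Z|)%N.
Proof.
rewrite -degX eA degD_le ?degL // degN (leq_trans (degM_le _ _)) // degX -['X]expr1 degXn.
by rewrite addnC.
Qed.

(** At each stage [V^P = w' L N^r] with [r] not dividing [P - 1], so [L^2] divides [V] and [L]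
    divides the Wronskian of the current roots. Its degree is too small, so it vanishes again and
    one more [p]-th root exists. *)
Lemma m1_iter i : wronskian A C = 0 -> (k < n)%N -> (k <= n - k)%N -> (0 < i <= k)%N ->
  exists A1 C1 : {poly F}, A = A1 ^+ (p ^ i) /\ C = C1 ^+ (p ^ i).
Proof.
move=> W0 kn kn2; elim: i => // -[_ _|i IH /= ik].
  have C'0 : C^`() = 0.
    apply: (deriv_coprime_eq0 m1_coprime); apply/dvdpP; exists A^`().
    by apply/eqP; rewrite eq_sym -subr_eq0; apply/eqP.
  have A'0 : A^`() = 0.
    by move/eqP: W0; rewrite /wronskian C'0 mulr0 subr0 mulf_eq0 (negPf C0) orbF => /eqP.
  have [C1 eC1] := deriv_pchar_root charF C'0.
  have [A1 eA1] := deriv_pchar_root charF A'0.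
  by exists A1, C1; rewrite expn1.
have [A1 [C1 [eA1 eC1]]] := IH (ltnW ik).
set P := (p ^ i.+1)%N in eA1 eC1.
have P1 : (1 < P)%N by rewrite -(expn0 p) ltn_exp2l.
pose X1 : {poly F} := 'X^(p ^ (n - k - i.+1)).
have ik' : (i.+1 < n - k)%N := leq_trans ik kn2.
have X'0 : X1^`() = 0 by rewrite deriv_expp // subn_gt0.
pose V := - (A1 + X1 * C1).
have VP : V ^+ P = w' *: (L * N ^+ r).
  rewrite (exprNp cFX) (exprDp cFX) exprMn -/P -eA1 -eC1 -exprM -expnD subnK ?(ltnW ik') //.
have dv2 : L ^+ 2 %| V.
  by apply: rootpoly_sqr_dvd P1 _ w'0 N_neq0 VP; apply: r_ndvd; rewrite ik.
have WV : wronskian A1 C1 = V * C1^`() - V^`() * C1.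
  by rewrite /wronskian /V derivN derivD derivM X'0; ring.
have dv : L %| wronskian A1 C1.
  rewrite WV dvdp_sub //; first by rewrite dvdp_mulr // (dvdp_trans _ dv2) // dvdp_exp.
  by rewrite dvdp_mulr // -[L]expr1 sqr_dvd_deriv.
have P0 : (0 < P)%N := ltnW P1.
have W1 : wronskian A1 C1 = 0.
  apply/eqP/negPn/negP => W1; have := wronskian_deg W1; have := dvdp_deg W1 dv.
  have := m1_degA; have := degC_lt; rewrite eA1 eC1 !degX degL.
  have dA : (2 * deg A1 <= kap * (P * deg A1))%N by rewrite mulnA leq_mul2r (leq_trans kap1)
    ?orbT // leq_pmulr // ltnW.
  have dC : (2 * deg C1 <= kap * (P * deg C1))%N by rewrite mulnA leq_mul2r (leq_trans kap1)
    ?orbT // leq_pmulr // ltnW.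
  move: dA dC; move: (kap * (P * _))%N (kap * (P * _))%N => x y; clear; lia.
have co1 : coprimep C1 A1.
  by rewrite -(coprimep_pexpl _ _ P0) -(coprimep_pexpr _ _ P0) -eA1 -eC1 m1_coprime.
have C10 : C1 != 0 by apply: contraNneq C0 => h; rewrite eC1 h expr0n gtn_eqF.
have C'0 : C1^`() = 0.
  apply: (deriv_coprime_eq0 co1); apply/dvdpP; exists A1^`().
  by apply/eqP; rewrite eq_sym -subr_eq0; apply/eqP.
have A'0 : A1^`() = 0.
  by move/eqP: W1; rewrite /wronskian C'0 mulr0 subr0 mulf_eq0 (negPf C10) orbF => /eqP.
have [C2 eC2] := deriv_pchar_root charF C'0.
have [A2 eA2] := deriv_pchar_root charF A'0.
exists A2, C2; rewrite expnS; split; rewrite exprM.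
  by rewrite -eA2.
by rewrite -eC2.
Qed.


(** Constant [A] and [C] make [L] linear, say [X - al], and [L N^r] a constant times
    [(X - al)^(p^(n-k))]. So [N] is a power of [X - al] with exponent [(p^(n-k) - 1) / r], a
    multiple of [v] because [r v = kap - 1]. *)
Lemma m1_const : deg A = 0%N -> deg C = 0%N -> (kap - 1 %| p ^ (n - k) - 1)%N ->
  exists c (g : {poly F}), N = c *: g ^+ v.
Proof.
move=> dA dC dv; have eA' := eA; have eW' := eW; have C0' := C0.
rewrite (deg_eq0P dA) (deg_eq0P dC) in eA' eW' C0'.
move: (A`_0) (C`_0) eA' eW' C0' => a c eA' eW'; rewrite polyC_eq0 => c0.
have L1 : deg L = 1%N.
  have -> : L = a%:P ^+ kap + 'X * c%:P ^+ kap by rewrite eA' subrK.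
  have e1 : deg ('X * c%:P ^+ kap) = 1%N.
    rewrite degM ?polyX_eq0 -?polyC_exp ?polyC_eq0 ?expf_neq0 //.
    by rewrite degC -['X]expr1 degXn.
  by rewrite degDr e1 // -polyC_exp degC.
have /cards1P[al eZ] : #|Z| == 1%N by rewrite -degL L1.
have LE : L = 'X - al%:P by rewrite /rootpoly eZ enum_set1 big_seq1.
have dX : w' *: (L * N ^+ r) %| ('X - al%:P) ^+ (p ^ (n - k)).
  rewrite -eW' dvdpNl.
  have -> : a%:P + X * c%:P = c%:P * ('X - al%:P) ^+ (p ^ (n - k)).
    rewrite (exprBp cFX) mulrBr -polyC_exp -rmorphM /= [c%:P * _]mulrC addrC.
    congr (_ + _); rewrite -polyCN; congr (_%:P); apply/eqP; rewrite eq_sym eqr_oppLR.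
    have : root (w' *: (L * N ^+ r)) al by rewrite rootZ // rootM LE root_XsubC eqxx.
    rewrite -eW' rootN /root hornerD hornerM !hornerC hornerXn addr_eq0 => /eqP ->.
    by rewrite opprK mulrC.
  by rewrite mul_polyC dvdpZl.
have /dvdp_exp_XsubCP[i _ eN] : N %| ('X - al%:P) ^+ (p ^ (n - k)).
  apply: dvdp_trans dX; rewrite -mul_polyC dvdp_mull // dvdp_mull // dvdp_exp //.
  exact: ltnW r_gt1.
have di : deg N = i by rewrite /deg (eqp_size eN) -/(deg _) degX degXsubC muln1.
have vi : (v %| i)%N.
  rewrite -(dvdn_pmul2l (ltnW r_gt1)).
  have -> : (r * v = kap - 1)%N by rewrite mulnC -[kap]expn1 -rhM addnK.
  have -> : (r * i = p ^ (n - k) - 1)%N.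
    by have := deg_rel; rewrite di dC addn0 -degL L1 => <-; rewrite addKn.
  by [].
have /eqpP[[c1 c2] /= /andP[c10 c20] eN2] := eN.
exists (c1^-1 * c2), (('X - al%:P) ^+ (i %/ v)).
rewrite -exprM divnK // -scalerA -eN2 scalerA mulVf // scale1r //.
Qed.

(** Now [A] and [C] are [kap]-th powers, and multiplicities at a zero of [L] satisfy
    [kap * mup V = 1 + r * mup N], so [mup N >= v]. Then [L^v] divides [N] while [#|Z| >= kap^2],
    which contradicts [deg_rel]. *)
Lemma m1_large : wronskian A C = 0 -> (k < n)%N -> (k <= n - k <= 2 * k)%N ->
  (0 < deg A + deg C)%N -> False.
Proof.
move=> W0 kn /andP[kn2 kn3] hAC.
have kk : (0 < k <= k)%N by rewrite k_gt0 leqnn.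
have [A1 [C1 [eA1 eC1]]] := m1_iter W0 kn kn2 kk.
pose V := - (A1 + 'X^(p ^ (n - k - k)) * C1).
have VP : V ^+ kap = w' *: (L * N ^+ r).
  by rewrite (exprNp cFX) (exprDp cFX) exprMn -eA1 -eC1 -exprM -expnD subnK.
have V0 : V != 0.
  have : V ^+ kap != 0 by rewrite VP scaler_eq0 negb_or w'0 /= mulf_neq0 // expf_neq0.
  by apply: contraNneq => ->; rewrite expr0n (gtn_eqF (ltnW kap1)).
have dvN : L ^+ v %| N.
  apply: rootpoly_exp_dvd => // a aZ.
  have e : (kap * mup a V = 1 + r * mup a N)%N.
    rewrite -mup_exp // VP -mul_polyC mupMr ?rootC //.
    by rewrite mupM ?expf_neq0 // mup_rootpoly // mup_exp.
  rewrite -(leq_pmul2l (ltnW r_gt1)).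
  have rv : (r * v + 1 = kap)%N by rewrite mulnC rhM expn1.
  have om : (0 < mup a V)%N by rewrite lt0n; apply/eqP => h; rewrite h muln0 in e.
  have : (kap <= kap * mup a V)%N by rewrite leq_pmulr.
  by rewrite e -{1}rv addn1 add1n ltnS.
have dN : (v * #|Z| <= deg N)%N by rewrite -degL -degX dvdp_deg.
have n0Q : (kap * kap <= #|Z|)%N.
  have dA := m1_degA; have dC := degC_lt; rewrite eA1 eC1 !degX in hAC dA dC.
  move: hAC; rewrite -mulnDr muln_gt0 => /andP[_].
  rewrite addn_gt0 => /orP[h|h].
    by apply: leq_trans dA; rewrite leq_mul2l leq_pmulr // orbT.
  apply: leq_trans dC; apply: leq_trans (leq_addr _ _).
  by rewrite leq_mul2l leq_pmulr // orbT.
have pk : (p ^ (n - k) <= kap * kap)%N by rewrite -expnD leq_exp2l // addnn -mul2n.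
have rd : (r * (v * #|Z|) <= r * deg N)%N by rewrite leq_mul2l dN orbT.
have rv : (r * v + 1 = kap)%N by rewrite mulnC rhM expn1.
have rz : (r * (v * #|Z|) + #|Z| = kap * #|Z|)%N by rewrite mulnA -rv mulnDl mul1n.
have k3 : (3 * #|Z| <= kap * #|Z|)%N.
  by rewrite leq_mul2r -rv addn1 ltnS; apply/orP; right; apply: leq_trans (leq_pmulr _ _).
have c1 : (deg C < #|Z|)%N.
  by rewrite -addn1; apply: leq_trans degC_lt; rewrite leq_add2r leq_pmull // ltnW.
by move: deg_rel rd rz k3 c1 pk n0Q Z_gt0; clear; lia.
Qed.


Lemma m1_degZ : (deg C < deg A)%N /\ #|Z| = (kap * deg A)%N \/
  (deg A <= deg C)%N /\ #|Z| = (kap * deg C + 1)%N.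
Proof.
have eL : L = A ^+ kap + 'X * C ^+ kap by rewrite eA subrK.
have dC : deg ('X * C ^+ kap) = (kap * deg C + 1)%N.
  by rewrite degM ?polyX_eq0 ?expf_neq0 // degX -['X]expr1 degXn addnC.
have [ca|ac] := ltnP (deg C) (deg A); [left|right]; split=> //.
  rewrite -degL eL degDl ?dC degX // addn1.
  have : (kap * (deg C).+1 <= kap * deg A)%N by rewrite leq_mul2l ca orbT.
  by rewrite mulnS => h; apply: leq_trans h; rewrite -add2n leq_add2r.
by rewrite -degL eL degDr ?dC // degX addn1 ltnS leq_mul2l ac orbT.
Qed.

Lemma m1_wr : (0 < n - k)%N -> wronskian A C != 0 ->
  ((r - 1) * deg N <= deg (wronskian A C))%N.
Proof.
move=> nk W0; rewrite -degX; apply: dvdp_deg => //.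
have X'0 : X^`() = 0 by rewrite deriv_expp.
have -> : wronskian A C = (- (A + X * C)) * C^`() - (- (A + X * C))^`() * C.
  by rewrite /wronskian derivN derivD derivM X'0; ring.
have dv j : (j <= r)%N -> N ^+ j %| - (A + X * C).
  by move=> jr; rewrite eW dvdpZr // dvdp_mull // dvdp_exp2l.
by rewrite dvdp_sub // dvdp_mulr ?dv ?leq_subr // sqr_dvd_deriv // subn1 prednK ?dv // ltnW.
Qed.

End WithA.

Lemma m1_power : n = k \/ n = (2 * k)%N \/ n = (3 * k)%N /\ (3 * v < kap + 3)%N ->
    (forall x, x \notin Z -> N.[x] ^+ ((q - 1) %/ v) = 1) ->
  exists c (g : {poly F}), N = c *: g ^+ v.
Proof.
move=> nE goodN.
have [dN0|dN0] := posnP (deg N).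
  by exists N`_0, 1; rewrite expr1n -mul_polyC mulr1 -deg_eq0P.
have [A [w' [eA w'0 eW]]] := m1_setup.
have rv : (r * v + 1 = kap)%N by rewrite mulnC rhM expn1.
have rnu : (0 < r * deg N)%N by rewrite muln_gt0 dN0 (ltnW r_gt1).
have cZ := degC_lt; have eZ := deg_rel; have HZ := m1_degZ eA.
have kn : (k < n)%N.
  case: nE => [nk|]; last by case=> [->|[-> _]]; rewrite ltn_Pmull.
  have c0 : (deg C <= kap * deg C)%N by rewrite leq_pmull // ltnW.
  by move: eZ cZ c0 rnu; rewrite nk subnn expn0; clear; lia.
have nk : n = (2 * k)%N \/ n = (3 * k)%N /\ (3 * v < kap + 3)%N by case: nE => // e;
  rewrite e ltnn in kn.
have knk : (k <= n - k <= 2 * k)%N by case: nk => [->|[-> _]]; clear; lia.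
have nk0 : (0 < n - k)%N by rewrite subn_gt0.
have [W0|W0] := eqVneq (wronskian A C) 0.
  have [/eqP|hAC] := posnP (deg A + deg C)%N; last by case: (m1_large eA w'0 eW W0 kn knk hAC).
  rewrite addn_eq0 => /andP[/eqP dA /eqP dC]; apply: (m1_const eA w'0 eW dA dC).
  have [j ->] : exists j, (n - k = k * j)%N.
    by case: nk => [->|[-> _]]; [exists 1%N|exists 2%N]; clear; lia.
  by rewrite expnM -{2}(exp1n j) subn_exp dvdn_mulr.
have W1 := m1_wr w'0 eW nk0 W0; have W2 := wronskian_deg W0.
have W3 := wronskian_deg_eq W0.
(* For [n = 2k] the degree relation contradicts a nonzero Wronskian with [deg N > 0]. For [n = 3k]
   it leaves [deg N <= 2v], and Stepanov applies with [l = p^k], [P = p^(2k)]. *)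
case: nk => [nk|[nk vk]].
  have c0 : (0 < deg A + deg C)%N by apply: leq_ltn_trans W2.
  move: eZ; have -> : (n - k = k)%N by rewrite nk; clear; lia.
  case: HZ => [[ca ->]|[ac ->]] e.
    have h : (kap * (deg C).+1 <= kap * deg A)%N by rewrite leq_mul2l ca orbT.
    have c1 : (deg C <= kap * deg C)%N by rewrite leq_pmull // ltnW.
    by move: e h c1 rnu; rewrite mulnS; clear; lia.
  have c1 : (0 < deg C)%N by move: ac c0; clear; lia.
  have h : (deg C + kap <= kap * deg C + 1)%N.
    move: c1; case: (deg C) => // d _; rewrite mulnS.
    by rewrite addnC -addnA leq_add2l addn1 ltnS leq_pmull // ltnW.
  by move: e h rnu; clear; lia.
have rv4 : (3 * v < r * v + 4)%N by move: vk; rewrite -rv -addnA.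
have e3 : (n - k = k + k)%N by rewrite nk; clear; lia.
have eZ' : (#|Z| + r * deg N = (r * v + 1) * (r * v + 1) + deg C)%N.
  by rewrite eZ e3 expnD rv.
have [] := @arith_m1 r v (deg N) #|Z| (deg A) (deg C) r_gt1 v_gt1 rv4 dN0 eZ'.
  case: HZ => [[ca e]|[ac e]]; [right|left]; rewrite rv; split=> //.
    by rewrite addn1 (leq_ltn_trans W1).
  have [eAC|nAC] := eqVneq (deg A) (deg C).
    by rewrite (leq_trans _ (W3 eAC)) // leq_add2r.
  by move: W1 W2 ac nAC; clear; lia.
move=> dl [/andP[dl0 dl2] nudl n0dl].
rewrite -[2%N]/(1 + 1)%N addnA !rv in n0dl.
have kap4 : (4 < kap)%N.
  by rewrite -rv addn1 ltnS; apply: (@leq_trans (2 * 2)); rewrite ?leq_mul.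
have rh2 : (v * rh 2 = p ^ (2 * k) - 1)%N by rewrite mulnC [(2 * k)%N]mulnC expnM -rhM mulnC addnK.
have cF : #|F| = (p ^ k * p ^ (2 * k))%N by rewrite cardF nk -expnD; congr (_ ^ _)%N; clear; lia.
have good x : x \notin Z -> N.[x] ^+ (p ^ k * rh 2 + rh 1) = 1.
  move=> xZ; rewrite -(goodN x xZ); congr (_ ^+ _).
  rewrite -(rhoS kap1 v_gt0 v_dvd) /rho -expnM; congr (((_ ^ _) - 1) %/ _)%N.
  by rewrite nk mulnC.
have P1 : (1 < p ^ (2 * k))%N by rewrite -(expn0 p) ltn_exp2l // muln_gt0.
have rh1 : (v * r = p ^ k - 1)%N by rewrite mulnC -rv addnK.
have vkap : (v < kap)%N by rewrite -rv addn1 ltnS leq_pmull // ltnW.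
have P2 : (p ^ (2 * k) = kap * kap)%N by rewrite mul2n -addnn expnD.
have rv2 : (rh 2 * v + 1 = kap * kap)%N by rewrite mulnC rh2 P2 subnK // -P2 ltnW.
have hr : (r * deg N <= (kap - 1) * dl)%N.
  by rewrite -rv addnK -mulnA leq_mul2l nudl orbT.
have hr2 : (rh 2 * deg N <= (kap * kap - 1) * dl)%N.
  by rewrite -rv2 addnK -mulnA leq_mul2l nudl orbT.
have vk1 : (v * kap < kap * kap)%N by rewrite ltn_pmul2r // ltnW.
have [e1|e2] : dl = 1%N \/ dl = 2%N by move: dl0 dl2; clear; lia.
  rewrite e1 in hr hr2 n0dl.
  have [g1 g2 g3 g4] := @stepanov_range1 kap (rh 2 * deg N) (r * deg N) #|Z| kap4 hr2 hr n0dl.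
  apply: (@stepanov F p k (2 * k) v N Z kap (kap - 2) (kap - 1) (rh 2) r) => //.
  - exact: ltnW kap1.
  - move: nudl vk1; rewrite e1 P2 mulnBr !muln1.
    have : (v <= v * kap)%N by rewrite leq_pmulr // ltnW.
    by clear; lia.
  - by rewrite cF P2.
  - by rewrite cF P2.
rewrite e2 in hr hr2 n0dl.
have [g1 g2 g3 g4] := @stepanov_range2 kap (rh 2 * deg N) (r * deg N) #|Z| kap4 hr2 hr n0dl.
apply: (@stepanov F p k (2 * k) v N Z (kap - 1) (kap - 2) kap (rh 2) r) => //.
- by rewrite subn_gt0.
- move: nudl vk1; rewrite e2 P2 -subnDA.
  have -> : (v * kap = v * (kap - (1 + 1)) + v * 2)%N by rewrite -mulnDr subnK // ltnW // ltnW.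
  by clear; lia.
- by rewrite cF P2.
- by rewrite cF P2.
Qed.

End M1.

(** * The last factor: higher-dimensional case *)

(** The numerical hypotheses of [stepanov] with [G] for [p^s], [R] for [p^a], [nu] for [deg N] and
    [n0] for [#|Z|]. *)
Definition stepanov_range v G R nu n0 K0 K1 := exists B D0 D1,
  [/\ (0 < B)%N, (v * (B - 1) + nu < R)%N,
      (K0 * nu + (B - 1) + (D0 - 1) * R + n0 < G * R)%N,
      (B - 1 + (D1 - 1) * R + n0 < G * R)%N &
      (G * (B - 1) + D0 < B * (D0 + D1))%N /\
      (G * (B - 1) + (D1 + K1 * nu) < B * (D0 + D1))%N].

Lemma range_small v R nu n0 K0 : (0 < K0)%N -> (v * K0 + 1 = R)%N ->
  (nu < v)%N -> (n0 <= K0)%N -> stepanov_range v 1 R nu n0 K0 0.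
Proof.
move=> K00 eK nuv n0K; exists 1%N, 1%N, 1%N.
have h : (K0 * nu + n0 < R)%N.
  have : (K0 * nu.+1 <= K0 * v)%N by rewrite leq_mul2l nuv orbT.
  by rewrite mulnS [(K0 * v)%N]mulnC; move: eK n0K; clear; lia.
split=> //; [|move: h; clear; lia|move: h; clear; lia].
rewrite subnn muln0 add0n; have : (v <= v * K0)%N; last by move: eK nuv; clear; lia.
by rewrite leq_pmulr.
Qed.

(** With [B = G], the numbers [D0 = G - E0] and [D1 = G - E1] are the largest allowed by the two
    root counts. The last hypothesis bounds [E0 + E1], so that [G - E0 - E1] is at least [nu / v],
    and enough unknowns remain. *)
Lemma range_large v G R nu n0 K0 K1 :
    (0 < nu)%N -> (1 < v)%N -> (v * K0 + 1 = R)%N -> (v * K1 + 1 = G)%N ->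
    (v * v * G < R)%N -> (12 * nu <= 5 * (v * G))%N ->
    (2 * (nu * R) + 2 * (v * (G + n0)) <= v * (G * R))%N ->
  stepanov_range v G R nu n0 K0 K1.
Proof.
move=> nu0 v1 eK0 eK1 vG nuG N1.
have R0 : (0 < R)%N by rewrite -eK0 addn1.
have v0 : (0 < v)%N := ltnW v1.
pose X0 := (K0 * nu + (G - 1) + n0)%N; pose X1 := (G - 1 + n0)%N.
pose E0 := (X0 %/ R)%N; pose E1 := (X1 %/ R)%N.
have l0 : (E0 * R <= X0)%N := leq_trunc_div _ _.
have u0 : (X0 < E0.+1 * R)%N := ltn_ceil _ R0.
have l1 : (E1 * R <= X1)%N := leq_trunc_div _ _.
have u1 : (X1 < E1.+1 * R)%N := ltn_ceil _ R0.
have G0 : (0 < G)%N by rewrite -eK1 addn1.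
have key : (v * (E0 + E1) + nu <= v * G)%N.
  rewrite -(leq_pmul2r R0) -mulnA; apply: leq_trans N1.
  rewrite mulnDl -mulnA mulnDl mulnDr.
  apply: leq_trans (_ : v * X0 + v * X1 + nu * R <= _)%N.
    by rewrite leq_add2r leq_add // leq_mul2l ?l0 ?l1 orbT.
  rewrite /X0 /X1 !mulnDr mulnA.
  have -> : (v * K0 = R - 1)%N by rewrite -eK0 addnK.
  have h : ((R - 1) * nu <= nu * R)%N by rewrite mulnC leq_mul2l leq_subr orbT.
  have h2 : (v * (G - 1) <= v * G)%N by rewrite leq_mul2l leq_subr orbT.
  by move: h h2; move: ((R - 1) * nu)%N (nu * R)%N (v * (G - 1))%N (v * G)%N (v * n0)%N => *; lia.
have e_lt : (E0 + E1 < G)%N.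
  rewrite -(ltn_pmul2l v0); apply: leq_trans key; rewrite -addn1 leq_add2l //.
have [g eg] : exists g, (G = E0 + E1 + g.+1)%N by exists (G - (E0 + E1).+1)%N; move: e_lt; clear;
  lia.
have nug : (nu <= v * g.+1)%N.
  have h : (v * G = v * (E0 + E1) + v * g.+1)%N by rewrite -mulnDr -eg.
  by rewrite h leq_add2l in key.
have K1nu : (K1 * nu < G * g.+1)%N.
  rewrite -(ltn_pmul2l v0) mulnA mulnCA.
  apply: (@leq_trans (G * nu)); last by rewrite leq_mul2l nug orbT.
  by rewrite ltn_pmul2r // -eK1 addn1.
have D01 : (G * (G - E0 + (G - E1)) = G * (G - 1) + (G + G * g.+1))%N.
  transitivity (G * (G - 1 + (1 + g.+1)))%N; last by rewrite !mulnDr muln1.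
  by congr (_ * _)%N; move: e_lt eg; clear; lia.
have lB : (v * (G - 1) + nu < R)%N.
  apply: leq_ltn_trans vG; have h2 : (2 * (v * G) <= v * v * G)%N.
    by rewrite -mulnA leq_mul2r v1 orbT.
  have h3 : (v * (G - 1) <= v * G)%N by rewrite leq_mul2l leq_subr orbT.
  by move: h2 h3 nuG; move: (v * (G - 1))%N (v * G)%N (v * v * G)%N => *; lia.
have dE E X : (E < G)%N -> (X < E.+1 * R)%N -> (X + (G - E - 1) * R < G * R)%N.
  move=> EG XE; have -> : (G * R = E.+1 * R + (G - E - 1) * R)%N.
    by rewrite -mulnDl; congr (_ * _)%N; move: EG; clear; lia.
  by rewrite ltn_add2r.
exists G, (G - E0)%N, (G - E1)%N; split=> //.
- rewrite addnAC; apply: dE u0; move: e_lt; clear; lia.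
- rewrite addnAC; apply: dE u1; move: e_lt; clear; lia.
rewrite D01 !ltn_add2l; split.
  apply: leq_ltn_trans (leq_subr _ _) _; rewrite -[X in (X < _)%N]addn0 ltn_add2l.
  by rewrite muln_gt0 G0.
apply: leq_ltn_trans (leq_add (leq_subr _ _) (leqnn _)) _.
by rewrite ltn_add2l.
Qed.

(** Put [u = v c + nu]. The degree relation gives [8 u <= 9 v G]; inserted in the descent inequality
    it yields [12 nu <= 5 v G], as [range_large] requires. *)
Lemma range_generic kap Q v G nu n0 c K0 K1 :
    (1 < v)%N -> (v < kap)%N -> (0 < nu)%N -> (0 < G)%N ->
    (kap = 3 /\ 27 <= Q)%N \/ (4 <= kap /\ kap * kap <= Q)%N ->
    (v * K0 + 1 = Q * Q)%N -> (v * K1 + 1 = G)%N -> (v * v * G < Q * Q)%N ->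
    (v * n0 + (Q - 1) * nu = v * (G * Q + c))%N -> (Q * c + 1 <= n0)%N ->
    (kap * (Q - v) * nu <= v * n0 + kap * (v * c) + Q * nu)%N ->
  stepanov_range v G (Q * Q) nu n0 K0 K1.
Proof.
move=> v1 vk nu0 G0 kQ eK0 eK1 vG eE cn0 W.
have v0 : (0 < v)%N := ltnW v1.
have [Q27 kQ2] : (16 <= Q)%N /\ (kap < Q)%N by case: kQ => [[-> h]|[k4 h]]; move: h; [|move: k4];
  clear; split; nia.
have vQ : (v < Q)%N := ltn_trans vk kQ2.
have [u eu] : exists u, u = (v * c + nu)%N by exists (v * c + nu)%N.
have hu : ((Q - 1) * u <= v * (G * Q))%N.
  have h : (v * (Q * c) + v <= v * n0)%N by rewrite -{2}[v]muln1 -mulnDr leq_mul2l cn0 orbT.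
  have e1 : (v * (Q * c) = (Q - 1) * (v * c) + v * c)%N.
    by rewrite mulnCA -{3}[(v * c)%N]mul1n -mulnDl subnK // (leq_trans _ Q27).
  have e2 : (v * (G * Q + c) = v * (G * Q) + v * c)%N by rewrite mulnDr.
  rewrite eu mulnDr; move: h e1 e2 eE; clear.
  move: (v * (Q * c))%N ((Q - 1) * (v * c))%N (v * c)%N (v * n0)%N ((Q - 1) * nu)%N (v * (G *
    Q))%N (v * (G * Q + c))%N.
  by move=> *; lia.
have hu8 : (8 * u <= 9 * (v * G))%N.
  have h1 : (8 * ((Q - 1) * u) <= 8 * (v * (G * Q)))%N by rewrite leq_mul2l hu.
  have h2 : (8 * (v * (G * Q)) <= 9 * (v * G) * (Q - 1))%N.
    have h3 : (v * G * (8 * Q) <= v * G * (9 * (Q - 1)))%N.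
      by rewrite leq_mul2l; apply/orP; right; move: Q27; clear; lia.
    by move: h3; move: (Q - 1)%N => x; clear; lia.
  have Q1 : (0 < Q - 1)%N by move: Q27; clear; lia.
  rewrite -(leq_pmul2r Q1); move: (leq_trans h1 h2); move: (Q - 1)%N => x; clear; lia.
have en0 : (v * n0 + Q * nu = v * (G * Q) + u)%N.
  have e2 : (v * (G * Q + c) = v * (G * Q) + v * c)%N by rewrite mulnDr.
  have e3 : (Q * nu = (Q - 1) * nu + nu)%N by rewrite -{3}[nu]mul1n -mulnDl subnK // (leq_trans _
    Q27).
  by rewrite e3 eu; move: e2 eE; clear;
    move: (v * n0)%N ((Q - 1) * nu)%N (v * (G * Q))%N (v * c)%N (v * (G * Q + c))%N => *; lia.
have nu12 : (12 * nu <= 5 * (v * G))%N.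
  have W2 : (kap * (Q - v + 1) * nu <= v * (G * Q) + (kap + 1) * u)%N.
    rewrite !mulnDr !mulnDl muln1 mul1n eu mulnDr.
    move: W en0; rewrite eu;
      move: (kap * (Q - v) * nu)%N (v * n0)%N (kap * (v * c))%N (Q * nu)%N => *; lia.
  have W3 : (8 * (kap * (Q - v + 1) * nu) <= v * G * (8 * Q + 9 * (kap + 1)))%N.
    have h : ((kap + 1) * (8 * u) <= (kap + 1) * (9 * (v * G)))%N by rewrite leq_mul2l hu8 orbT.
    by move: W2 h; clear; lia.
  have W4 : (12 * (8 * Q + 9 * (kap + 1)) <= 40 * (kap * (Q - v + 1)))%N.
    case: kQ => [[k3 Q27']|[k4 Qk]].
      move: vk v1; rewrite k3 => vk v1; have -> : v = 2%N by move: vk v1; clear; lia.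
      by move: Q27'; clear; lia.
    apply: leq_trans (_ : 40 * (kap * (Q - kap + 2)) <= _)%N; last first.
      by rewrite !leq_mul2l; apply/orP; right; apply/orP; right; move: vk kQ2; clear; lia.
    have [j ej] : exists j, kap = (j + 4)%N by exists (kap - 4)%N; move: k4; clear; lia.
    have [t et] : exists t, Q = (kap * kap + t)%N by exists (Q - kap * kap)%N; rewrite subnKC.
    have -> : (Q - kap + 2 = (j + 4) * (j + 3) + t + 2)%N by rewrite et ej; clear; lia.
    by rewrite et ej; clear; nia.
  have kQv : (0 < kap * (Q - v + 1))%N by rewrite muln_gt0 addn1 andbT (leq_trans _ vk).
  rewrite -(leq_pmul2l (isT : 0 < 8)%N) -(leq_pmul2r kQv).
  have h : (v * G * (12 * (8 * Q + 9 * (kap + 1))) <= v * G * (40 * (kap * (Q - v + 1))))%N.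
    by rewrite leq_mul2l W4 orbT.
  move: W3 h; move: (kap * (Q - v + 1))%N => x; clear; lia.
apply: range_large => //.
have h : (12 * nu * (Q * (Q - 1)) <= 5 * (v * G) * (Q * (Q - 1)))%N by rewrite leq_mul2r nu12 orbT.
have hQ : (v * G * (7 * Q + 26) <= v * G * (Q * Q))%N.
  by rewrite leq_mul2l; apply/orP; right; move: Q27; clear; nia.
have [Q' eQ] : exists Q', Q = Q'.+1 by exists Q.-1; rewrite prednK // (leq_trans _ Q27).
move: h hQ hu8 en0; rewrite eQ subn1 /=; clear; lia.
Qed.

(** The case [kap = 3], [v = 2], [m = 2], where [Q = 9] is too small for [range_generic]; explicit
    parameters work. *)
Lemma range_nine G nu n0 c K1 : (G = 3 \/ G = 9)%N -> (2 * K1 + 1 = G)%N ->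
    (2 * n0 + 8 * nu = 2 * (G * 9 + c))%N -> (9 * c + 1 <= n0)%N ->
    (12 * nu + 6 <= 2 * n0 + 6 * c)%N ->
  stepanov_range 2 G 81 nu n0 40 K1.
Proof.
case=> -> e1 e2 e3 e4.
  have -> : K1 = 1%N by lia.
  by exists 6%N, 2%N, 2%N; split=> //; lia.
have -> : K1 = 4%N by lia.
by exists 18%N, 4%N, 8%N; split=> //; lia.
Qed.

(** Here [q = kap^g Q^2]. For [g = 0] the inequalities force [c = 0] and [nu < v], so constants
    suffice in Stepanov's relation; otherwise only [kap = 3], [m = 2] escapes the generic
    estimate. *)
Lemma stepanov_rangeP kap m g v nu n0 c K0 K1 :
    (1 < v)%N -> (v < kap)%N -> (0 < nu)%N -> (1 < m)%N ->
    (v * K0 + 1 = kap ^ m * kap ^ m)%N -> (v * K1 + 1 = kap ^ g)%N ->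
    (v * v * kap ^ g < kap ^ m * kap ^ m)%N ->
    (v * n0 + (kap ^ m - 1) * nu = v * (kap ^ g * kap ^ m + c))%N ->
    (kap ^ m * c + 1 <= n0)%N ->
    (kap * (kap ^ m - v) * nu + kap * v <= v * n0 + kap * (v * c) + kap ^ m * nu)%N ->
  stepanov_range v (kap ^ g) (kap ^ m * kap ^ m) nu n0 K0 K1.
Proof.
move=> v1 vk nu0 m1 eK0 eK1 vG eE cn0 W.
have v0 : (0 < v)%N := ltnW v1.
have k3 : (2 < kap)%N := leq_ltn_trans v1 vk.
have k0 : (0 < kap)%N := ltnW (ltnW k3).
have Qk : (kap * kap <= kap ^ m)%N.
  by rewrite -(expnD kap 1 1) leq_exp2l // ltnW.
have [g0|g0] := posnP g.
  rewrite g0 expn0 in eK1 vG eE *.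
  have -> : K1 = 0%N.
    by apply/eqP; move: eK1 v0; case: (K1) => // j; rewrite mulnS; case: (v) => // i; clear; lia.
  move: (kap ^ m)%N Qk vG eK0 eE cn0 W => Q Qk vG eK0 eE cn0 W.
  have kQ : (kap < Q)%N by apply: leq_trans Qk; rewrite ltn_Pmull // ltnW.
  have [Q' eQ] : exists Q', Q = Q'.+1 by exists Q.-1; rewrite prednK // (leq_trans _ kQ).
  rewrite mul1n eQ subn1 /= in eE.
  have c0 : c = 0%N.
    apply/eqP; rewrite -leqn0 leqNgt; apply/negP => c_gt0.
    have h1 : (v * (Q * c + 1) <= v * n0)%N by rewrite leq_mul2l cn0 orbT.
    have h2 : (v * Q' * 1 <= v * Q' * c)%N by rewrite leq_mul2l c_gt0 orbT.
    have Q0 : (0 < Q')%N by rewrite -ltnS -eQ (leq_trans _ kQ) // ltnW.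
    have h3 : (0 < Q' * nu)%N by rewrite muln_gt0 Q0.
    by move: h1 h2 h3 eE; rewrite eQ; clear; lia.
  rewrite c0 addn0 in eE; rewrite c0 !muln0 addn0 in W.
  have nuv : (nu < v)%N.
    rewrite ltnNge; apply/negP => vnu.
    have W2 : (kap * (Q - v) * nu + kap * v <= v * Q + nu)%N.
      by move: W eE; rewrite eQ; move: (kap * _ * nu)%N (kap * v)%N => x y; clear; lia.
    have vQ : (v < Q)%N := ltn_trans vk kQ.
    have h1 : (v * (kap * (Q - v) - 1) <= nu * (kap * (Q - v) - 1))%N by rewrite leq_mul2r vnu orbT.
    have h2 : (0 < kap * (Q - v))%N by rewrite muln_gt0 k0 subn_gt0.
    have h3 : (v * (kap * (Q - v) - 1) + kap * v <= v * Q)%N.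
      by move: h1 h2 W2; move: (kap * (Q - v))%N => x; case: x => // x; rewrite subn1 /=; clear;
        lia.
    have h4 : (kap * (Q - v) - 1 + kap <= Q)%N.
      by rewrite -(leq_pmul2l v0) mulnDr [X in (_ + X)%N]mulnC.
    have h5 : (kap * (Q - kap + 1) <= kap * (Q - v))%N.
      by rewrite leq_mul2l; apply/orP; right; move: vk kQ; clear; lia.
    have [j ej] : exists j, Q = (kap + j)%N by exists (Q - kap)%N; rewrite subnKC // ltnW.
    move: h4 h5 kQ k3; rewrite ej addKn; move: (kap * (kap + j - v))%N => x; clear; nia.
  apply: (range_small _ eK0 nuv).
    rewrite lt0n; apply: contraTneq kQ => h; move: eK0 k3; rewrite h muln0 add0n; clear; nia.
  rewrite -(leq_pmul2l v0); apply: (@leq_trans (v * Q)).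
    by rewrite eQ -eE leq_addr.
  have h1 : (v.+1 * Q <= Q * Q)%N by rewrite leq_mul2r (leq_trans vk) ?orbT // ltnW.
  by move: h1 eK0; rewrite mulSn eQ; clear; lia.
have [e3|k4] : kap = 3%N \/ (4 <= kap)%N by move: k3; clear; lia.
  rewrite {}e3 {k3 k0 Qk} in vk eK0 eK1 vG eE cn0 W *.
  have ev : v = 2%N by move: v1 vk; clear; lia.
  have [m2|m3] : m = 2%N \/ (2 < m)%N by move: m1; clear; lia.
    rewrite {}m2 {}ev in eK0 eK1 vG eE cn0 W *.
    have eK : K0 = 40%N by move: eK0; clear; lia.
    have g3 : (g < 3)%N by rewrite -(ltn_exp2l _ _ (isT : 1 < 3)%N); move: vG; clear; lia.
    have eG : (3 ^ g = 3 \/ 3 ^ g = 9)%N by case: g g0 g3 {vG eE eK1} => // [[|[|]]] //;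
      [left|right].
    rewrite eK; apply: (@range_nine _ nu n0 c) => //.
    by move: W; clear; lia.
  apply: (@range_generic 3 (3 ^ m) v (3 ^ g) nu n0 c) => //.
  - by rewrite expn_gt0.
  - by left; split=> //; rewrite -(leq_exp2l 3 m (isT : 1 < 3)%N) in m3.
  - by apply: leq_trans W; rewrite leq_addr.
apply: (@range_generic kap (kap ^ m) v (kap ^ g) nu n0 c) => //.
- by rewrite expn_gt0 k0.
- by right.
- by apply: leq_trans W; rewrite leq_addr.
Qed.

Section PPower.
Variables (F : finFieldType) (p : nat).
Hypothesis charF : p \in [pchar F].
Implicit Types f g : {poly F}.

Definition ppower e f := exists g, f = g ^+ (p ^ e).

Lemma ppowerD e f g : ppower e f -> ppower e g -> ppower e (f + g).
Proof. by move=> [a ->] [b ->]; exists (a + b); rewrite (exprDp (charFX charF)). Qed.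

Lemma ppowerN e f : ppower e f -> ppower e (- f).
Proof. by move=> [a ->]; exists (- a); rewrite (exprNp (charFX charF)). Qed.

Lemma ppowerM e f g : ppower e f -> ppower e g -> ppower e (f * g).
Proof. by move=> [a ->] [b ->]; exists (a * b); rewrite exprMn. Qed.

Lemma ppowerZ e c f : ppower e f -> ppower e (c *: f).
Proof.
by have [b <-] := finfield_root charF e c; move=> [a ->]; exists (b *: a); rewrite exprZn.
Qed.

Lemma ppower0 e : ppower e 0.
Proof. by exists 0; rewrite expr0n gtn_eqF // (expp_gt0 charF). Qed.

Lemma ppower_sum e (I : Type) (r : seq I) (P : pred I) (E : I -> {poly F}) :
  (forall i, P i -> ppower e (E i)) -> ppower e (\sum_(i <- r | P i) E i).
Proof.
by move=> H; elim/big_rec: _ => [|i f Pi]; [exact: ppower0|apply: ppowerD; apply: H].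
Qed.

Lemma ppowerX e f j : (p ^ e %| j)%N -> ppower e (f ^+ j).
Proof. by case/dvdnP=> i ->; exists (f ^+ i); rewrite -exprM. Qed.

Lemma ppowerXD e a f : ppower e f -> ppower (e + a) (f ^+ (p ^ a)).
Proof. by move=> [g ->]; exists g; rewrite -exprM expnD. Qed.

Lemma ppower_le e e' f : (e <= e')%N -> ppower e' f -> ppower e f.
Proof. by move=> h [g ->]; apply: ppowerX; rewrite dvdn_exp2l. Qed.

End PPower.

(** * Higher dimension: twists, the descent inequality, and [N] as a [v]-th power *)

Section M2.
Variables (F : finFieldType) (p n k v m : nat) (w : nat -> F) (Z : {set F}).
Variables C N : {poly F}.
Local Notation L := (rootpoly Z).
Local Notation q := (p ^ n)%N.
Local Notation kap := (p ^ k)%N.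
Local Notation Q := (p ^ (m * k))%N.
Local Notation rh := (rho p k v).
Hypotheses (charF : p \in [pchar F]) (k_gt0 : (0 < k)%N) (m_gt1 : (1 < m)%N).
Hypotheses (v_gt1 : (1 < v)%N) (v_dvd : (v %| kap - 1)%N) (mk_le : (m * k <= n)%N).
Hypotheses (w0 : w 0 = 1) (wm : w m != 0) (Z_gt0 : (0 < #|Z|)%N) (N_neq0 : N != 0).
Hypothesis cardF : #|F| = q.
Hypothesis eC : L^`() = C ^+ Q.
Hypothesis mvs_eq : \sum_(l < m.+1) w l *: (L ^+ (kap ^ l) * N ^+ (Q * rh l))
  = ('X - 'X^q) * L^`().
Hypotheses (coCN : coprimep C N) (coCL : coprimep C L).
Hypothesis w_mid : exists2 j, (0 < j < m)%N & w j != 0.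

Let pr : prime p := pcharf_prime charF.
Let p_gt1 : (1 < p)%N := prime_gt1 pr.
Let p_gt0 : (0 < p)%N := prime_gt0 pr.
Let kap1 : (1 < kap)%N := kap_gt1 charF k_gt0.
Let v_gt0 : (0 < v)%N := ltnW v_gt1.
Let m_gt0 : (0 < m)%N := ltnW m_gt1.
Let rhM l : (v * rh l + 1 = kap ^ l)%N := rho_mul kap1 v_dvd l.
Let degL : deg L = #|Z| := deg_rootpoly Z.
Let Q0 : (0 < Q)%N := expp_gt0 charF (m * k).
Let cFX := charFX charF.
Let QE : Q = (kap ^ m)%N := Q_kap p k m.
Let C0 : C != 0.
Proof. exact: (C_neq0 Z_gt0 coCL). Qed.

(** The [j]-th iterate of the additive map sending [f] to [f^kap N^(Q rho 1)]; [mvs_eq] says that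
    its combination [twM] maps [L] to [(X - X^q) L']. *)
Definition tw j (f : {poly F}) := f ^+ (kap ^ j) * N ^+ (Q * rh j).

Lemma kapE j : (kap ^ j = p ^ (k * j))%N. Proof. by rewrite expnM. Qed.

Lemma tw0 f : tw 0 f = f.
Proof. by rewrite /tw expn0 expr1 rho0 muln0 expr0 mulr1. Qed.

Lemma tw_tw i j f : tw i (tw j f) = tw (i + j) f.
Proof.
rewrite /tw exprMn -!exprM -expnD -mulrA -exprD addnC; congr (_ * _ ^+ _).
by rewrite [(i + j)%N]addnC (rhoD kap1 v_gt0 v_dvd) mulnDr -mulnA [(rh j * _)%N]mulnC.
Qed.

Lemma twD j f g : tw j (f + g) = tw j f + tw j g.
Proof. by rewrite /tw kapE (exprDp cFX) mulrDl. Qed.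

Lemma twN j f : tw j (- f) = - tw j f.
Proof. by rewrite /tw kapE (exprNp cFX) mulNr. Qed.

Lemma twZ j c f : tw j (c *: f) = c ^+ (kap ^ j) *: tw j f.
Proof. by rewrite /tw exprZn scalerAl. Qed.

Definition twM f := \sum_(l < m.+1) w l *: tw l f.

Lemma twMD f g : twM (f + g) = twM f + twM g.
Proof. by rewrite -big_split; apply: eq_bigr => l _; rewrite twD scalerDr. Qed.

Lemma twMN f : twM (- f) = - twM f.
Proof. by rewrite -sumrN; apply: eq_bigr => l _; rewrite twN scalerN. Qed.

Lemma twM_rec f : twM f = f + \sum_(l < m) w l.+1 *: tw l.+1 f.
Proof. by rewrite /twM big_ord_recl w0 scale1r tw0. Qed.

(** [twM] has constant term 1 as a series in the twist, so it is inverted term by term; truncation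
    leaves an error spread over [m] consecutive twists. *)
Lemma twM_inverse f s : exists th mu : nat -> F,
  twM (\sum_(i < s.+1) th i *: tw i f) = f + \sum_(i < m) mu i *: tw (s.+1 + i) f.
Proof.
elim: s => [|s [th [mu IH]]].
  exists (fun _ => 1), (fun i => w i.+1).
  by rewrite big_ord_recl big_ord0 addr0 scale1r tw0 twM_rec.
pose th' i := if (i == s.+1)%N then - mu 0%N else th i.
pose mu' i := (if (i.+1 < m)%N then mu i.+1 else 0) + w i.+1 * (- mu 0%N) ^+ (kap ^ i.+1).
exists th', mu'; rewrite big_ord_recr twMD /= {2}/th' eqxx.
rewrite (eq_bigr (fun i : 'I_s.+1 => th i *: tw i f)) => [|i _]; last first.
  by rewrite /th' ltn_eqF.
rewrite IH; have -> : \sum_(i < m) mu i *: tw (s.+1 + i) f = mu 0%N *: tw s.+1 f +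
          \sum_(i < m) (if (i.+1 < m)%N then mu i.+1 else 0) *: tw (s.+2 + i) f.
  move: m_gt0; clear; case: (m) => // m' _; rewrite big_ord_recl addn0; congr (_ + _).
  rewrite big_ord_recr /= ltnn scale0r addr0; apply: eq_bigr => i _.
  by rewrite ltnS ltn_ord /bump /= add1n addnS.
rewrite twM_rec -addrA; congr (_ + _).
rewrite addrACA scaleNr subrr add0r -big_split; apply: eq_bigr => i _ /=.
rewrite -scaleNr twZ tw_tw scalerA /mu' scalerDl; congr (_ + _ *: tw _ _).
by rewrite addSn addnC addSn.
Qed.

Lemma twm_pow f : tw m f = (f * N ^+ rh m) ^+ Q.
Proof. by rewrite /tw -QE exprMn -exprM [(Q * _)%N]mulnC. Qed.

(** Bootstrapping: [f] is [twM f] minus proper twists of [f], each raising [f] to at least the power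
    [kap]. Every pass gains a factor [kap] until [Q], which divides all exponents of [N]. *)
Lemma twM_ppower f : ppower p (m * k) (twM f) -> ppower p (m * k) f.
Proof.
move=> hM; suff H s : (s <= m)%N -> ppower p (s * k) f by exact: H.
elim: s => [_|s IH sm]; first by exists f; rewrite expr1.
have -> : f = twM f - \sum_(l < m) w l.+1 *: tw l.+1 f by rewrite twM_rec addrK.
apply: (ppowerD charF); first by apply: ppower_le hM; rewrite leq_mul2r sm orbT.
apply: (ppowerN charF); apply: (ppower_sum charF) => l _; apply: (ppowerZ charF).
apply: ppowerM.
  apply: (@ppower_le _ _ _ (s * k + k * l.+1)); last first.
    by rewrite kapE; apply: ppowerXD; apply: IH; apply: ltnW.
  by rewrite mulnS addnA mulSn [(s * k + k)%N]addnC leq_addr.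
by apply: ppowerX; rewrite dvdn_mulr // dvdn_exp2l // leq_mul2r sm orbT.
Qed.

Hypothesis good : forall x, x \notin Z -> N.[x] ^+ ((q - 1) %/ v) = 1.
Hypothesis N_gt0 : (0 < deg N)%N.

Lemma deg_relation2 :
  [/\ (Q * deg C + 1 <= #|Z|)%N &
      (#|Z| + rh m * deg N = p ^ (n - m * k) + deg C)%N].
Proof.
split; first exact: (degC_lt Z_gt0 eC coCL).
exact: (deg_relation charF k_gt0 m_gt0 v_gt0 v_dvd mk_le wm Z_gt0 N_neq0 eC mvs_eq coCL).
Qed.

Lemma Q_gt1 : (1 < Q)%N.
Proof. by rewrite -(expn0 p) ltn_exp2l // muln_gt0 m_gt0. Qed.

Lemma outside_Z : exists a, a \notin Z.
Proof.
have [h1 h2] := deg_relation2.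
have h3 : (p ^ (n - m * k) * Q = #|F|)%N by rewrite cardF -expnD subnK.
have [/eqP h|[a aZ]] := set_0Vmem (~: Z); last by exists a; rewrite -in_setC.
have h4 : #|Z| = #|F| by rewrite -[in LHS](setCK Z) (eqP h) setC0 cardsT.
move: h1 h2; rewrite h4 -h3; move: Q_gt1 (expp_gt0 charF (n - m * k)) => q1 g0.
case: Q q1 => [|[|x]] // _; move: (p ^ _)%N g0 => G; move: (_ * deg N)%N (deg C) => y c; clear.
rewrite !mulnS !mulSn; move=> G0 h1 h2.
have h : (G <= c)%N by move: h2; move: (G * x)%N => t; lia.
move: h1 h2; have : (G * x <= x * c)%N by rewrite mulnC leq_mul2l h orbT.
by move: (G * x)%N (x * c)%N h G0; lia.
Qed.

Section WithAlpha.
Variable al : F.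
Hypothesis alZ : al \notin Z.
Let xh : {poly F} := 'X - al%:P.
Let f0 : {poly F} := xh * C ^+ Q.
Let H := (n - m * k)%N.

Lemma xh_eq : 'X - 'X^q = xh - (xh ^+ (p ^ H)) ^+ Q.
Proof.
rewrite -exprM -expnD subnK // /xh (exprBp cFX) -polyC_exp.
by rewrite -cardF expf_card opprB addrA addrNK.
Qed.

Lemma roots_fun e : exists rt : F -> F, forall c, rt c ^+ (p ^ e) = c.
Proof. exact: (fin_all_exists (finfield_root charF e)). Qed.

(* As [X - X^q = xh - xh^q], subtracting from [L] a truncated inverse image   *)
(* of [f0] under [twM] leaves a [Q]-th power.                                 *)
Lemma m2_setup1 : exists A (th mu : nat -> F),
  A ^+ Q = L - \sum_(i < m) th i *: tw i f0 /\
  twM (A ^+ Q) = - (xh ^+ (p ^ H) * C + N ^+ rh m * \sum_(i < m) mu i *: tw i f0) ^+ Q.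
Proof.
have [rt rtK] := roots_fun (m * k).
have [th [mu]] := twM_inverse f0 m.-1; rewrite prednK // => E.
pose B := L - \sum_(i < m) th i *: tw i f0.
have eB : twM B = - (xh ^+ (p ^ H) * C + N ^+ rh m * \sum_(i < m) rt (mu i) *: tw i f0) ^+ Q.
  rewrite twMD twMN E /twM mvs_eq eC xh_eq mulrBl -/f0 opprD [f0 - _]addrC addrA addrK.
  rewrite [(_ + N ^+ _ * _) ^+ _](exprDp cFX) opprD !exprMn; congr (_ - _).
  rewrite (exprp_sum cFX) mulr_sumr; apply: eq_bigr => i _.
  by rewrite -tw_tw twm_pow exprMn exprZn rtK -scalerAr mulrC.
have [A eA] : ppower p (m * k) B.
  by apply: twM_ppower; rewrite eB; apply: (ppowerN charF); eexists.
by exists A, th, (fun i => rt (mu i)); rewrite -eA.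
Qed.

Lemma deg_tw i f : f != 0 -> deg (tw i f) = (kap ^ i * deg f + Q * rh i * deg N)%N.
Proof. by move=> f1; rewrite degM ?expf_neq0 // !degX. Qed.

Lemma deg_f0 : deg f0 = (1 + Q * deg C)%N.
Proof. by rewrite degM ?polyXsubC_eq0 ?expf_neq0 // degXsubC degX. Qed.

Lemma f0_neq0 : f0 != 0.
Proof. by rewrite mulf_neq0 ?polyXsubC_eq0 ?expf_neq0. Qed.

(* The degree of a combination of twists of [f0] is not divisible by [Q]. *)
Lemma m2_degA A (th : nat -> F) : A ^+ Q = L - \sum_(i < m) th i *: tw i f0 ->
  (Q * deg A <= #|Z|)%N.
Proof.
move=> eA; rewrite -degX eA -degL; set S := \sum_(i < m) _ in eA *.
have [h|h] := leqP (deg S) (deg L); first by apply: degD_le; rewrite ?degN.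
have e : (Q * deg A = deg S)%N by rewrite -degX eA degDr ?degN.
have [i|i j ij|t|[j [jm _ _ sj]]] := @incr_sum F (fun i => tw i f0) th m.
- by rewrite mulf_neq0 ?expf_neq0 ?f0_neq0.
- rewrite !size_deg ?mulf_neq0 ?expf_neq0 ?f0_neq0 // ltnS !deg_tw ?f0_neq0 // -addSn leq_add //.
    by rewrite ltn_pmul2r ?deg_f0 // ltn_exp2l.
  by rewrite leq_mul2r leq_mul2l ltnW ?orbT // (rho_ltn kap1).
- by move: h; rewrite /S big1 ?deg0 // => i _; rewrite t ?scale0r.
have : (Q %| deg S)%N by rewrite -e dvdn_mulr.
rewrite /deg sj -/(deg _) deg_tw ?f0_neq0 // deg_f0 mulnDr muln1 -addnA.
rewrite dvdn_addl; last by apply: dvdn_add; [rewrite mulnCA|rewrite -mulnA]; apply: dvdn_mulr.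
have kj : (0 < kap ^ j)%N by rewrite !expn_gt0 p_gt0.
by move/(dvdn_leq kj); rewrite QE leq_exp2l // leqNgt jm.
Qed.

Lemma deg_twist_le (w' : nat -> F) A :
  (deg (twist p k v m w' A N) <= kap ^ m.-1 * deg A + rh m.-1 * deg N)%N.
Proof.
apply: deg_sum_le => j _; apply: leq_trans (degZ_le _ _) _.
have jm : (j <= m.-1)%N by rewrite -ltnS prednK.
apply: leq_trans (degM_le _ _) _; rewrite !degX leq_add // leq_mul2r.
  by rewrite leq_exp2l // jm orbT.
by rewrite (rho_mono v kap1) ?orbT.
Qed.

(** The [Q]-th root of the equation for the [A] of [m2_setup1] has the shape required by [descent].
    The resulting bound, combined with [m2_degA] and multiplied by [kap v], is the claim. *)
Lemma m2_ineq : (v <= q - 1)%N ->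
  (kap * (Q - v) * deg N + kap * v <= v * #|Z| + kap * (v * deg C) + Q * deg N)%N.
Proof.
move=> vq.
have [A [th [mu [eA eM]]]] := m2_setup1.
have dA := m2_degA eA.
have [rt rtK] := roots_fun (m * k).
pose w' j := rt (w j).
have Qinj := exprp_inj cFX (i := m * k).
(* It collects what carries the factor [N^(rho m)]: the top term of [twM (A ^+ Q)] and the
   truncation error. *)
pose R := w' m *: A ^+ (kap ^ m) + \sum_(i < m) mu i *: tw i f0.
have w'0 : w' 0%N = 1.
  by apply: (exprp_inj charF (i := m * k)); rewrite /= rtK w0 expr1n.
have eT : twist p k v m w' A N + xh ^+ (p ^ H) * C = - (N ^+ rh m * R).
  have e1 : (twist p k v m w' A N + w' m *: (A ^+ (kap ^ m) * N ^+ rh m)) ^+ Q = twM (A ^+ Q).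
    rewrite /twist -(big_ord_recr m (fun j => w' j *: (A ^+ (kap ^ j) * N ^+ rh j))) /=.
    rewrite (exprp_sum cFX); apply: eq_bigr => j _.
    by rewrite exprZn rtK exprMn /tw -!exprM [(Q * rh j)%N]mulnC [(Q * kap ^ j)%N]mulnC.
  move: e1; rewrite eM -(exprNp cFX) => /Qinj e1.
  rewrite -[twist _ _ _ _ _ _ _](addrK (w' m *: (A ^+ (kap ^ m) * N ^+ rh m))) e1.
  rewrite /R mulrDr -scalerAr [N ^+ _ * A ^+ _]mulrC.
  move: (_ *: _) (xh ^+ _ * C) (N ^+ _ * _) => x y z; rewrite opprD addrAC -addrA; ring.
have NZ : ~~ root N al.
  apply/negP => /rootP h; have := good alZ; rewrite h expr0n.
  by rewrite gtn_eqF ?divn_gt0 // => /esym/eqP; rewrite oner_eq0.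
(* Were [A] zero, [L] would be a combination of twists of [f0], which all vanish at [al], outside
   [Z]. *)
have A_neq0 : A != 0.
  apply: contraNneq alZ => Az; rewrite -root_rootpoly.
  move: eA; rewrite Az expr0n gtn_eqF // => /esym/eqP; rewrite subr_eq0 => /eqP ->.
  apply/rootP; rewrite horner_sum big1 // => i _.
  rewrite hornerZ /tw hornerM horner_exp /f0 hornerM hornerXsubC subrr mul0r expr0n.
  by rewrite gtn_eqF ?mul0r ?mulr0 // !expn_gt0 p_gt0.
have C_th (t : nat -> F) : exists D, \sum_(i < m) t i *: tw i f0 = D * C.
  apply/dvdpP; apply: (big_ind (fun f => C %| f)) => [|x y|i _].
  - exact: dvdp0.
  - exact: dvdp_add.
  have kj : (0 < kap ^ i)%N by rewrite !expn_gt0 p_gt0.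
  rewrite -mul_polyC dvdp_mull // dvdp_mulr // -(prednK kj) exprS dvdp_mulr //.
  by rewrite dvdp_mull // -(prednK Q0) exprS dvdp_mulr.
have coCA : coprimep C A.
  have [D eD] := C_th th.
  have : coprimep C (A ^+ Q).
    by rewrite eA eD addrC -mulNr coprimep_addl_mul.
  by rewrite coprimep_pexpr.
have coCR : coprimep C R.
  have [D eD] := C_th mu; rewrite /R eD addrC coprimep_addl_mul coprimepZr.
    by apply: coprimep_expr.
  by apply: contraNneq wm => h; rewrite -(rtK (w m)) -/(w' m) h expr0n gtn_eqF.
have r_gt0 : (0 < rh m)%N by exact: (rho_gt0 kap1 v_gt0 v_dvd).
have coAN : coprimep A N.
  have [D eD] : exists D, twist p k v m w' A N = D * A.
    apply/dvdpP; apply: (big_ind (fun f => A %| f)) => [|x y|j _].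
    - exact: dvdp0.
    - exact: dvdp_add.
    have kj : (0 < kap ^ j)%N by rewrite !expn_gt0 p_gt0.
    by rewrite -mul_polyC dvdp_mull // dvdp_mulr // -(prednK kj) exprS dvdp_mulr.
  have : coprimep N (xh ^+ (p ^ H) * C).
    rewrite coprimepMr [coprimep N C]coprimep_sym coCN andbT coprimep_expr //.
    by rewrite coprimep_XsubC.
  have -> : xh ^+ (p ^ H) * C = (- (N ^+ (rh m).-1 * R)) * N + (- D) * A.
    rewrite !mulNr -eD; move: eT; rewrite -(prednK r_gt0) exprS.
    move=> e; rewrite -[LHS](addKr (twist p k v m w' A N)) e.
    by rewrite addrC -mulrA [N * _]mulrC.
  by rewrite coprimep_addl_mul coprimepMr [coprimep N A]coprimep_sym => /andP[].
have [cZ eZ] := deg_relation2.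
have dC0 : (deg C <= Q * deg C)%N by rewrite leq_pmull.
have degN_lt : (0 < deg N < p ^ H)%N.
  rewrite N_gt0; have : (deg N <= rh m * deg N)%N by rewrite leq_pmull.
  by move: cZ eZ dC0; rewrite -/H; clear; lia.
have [j jm wj] := w_mid.
have w'j : exists2 j, (0 < j < m)%N & w' j != 0.
  by exists j => //; apply: contraNneq wj => h; rewrite -(rtK (w j)) -/(w' j) h expr0n gtn_eqF.
have [i [N1 [eN N1_gt0 dN]]] :=
  descent charF k_gt0 v_gt0 v_dvd r_gt0 m_gt0 w'0 w'j eT coAN coCN coCR A_neq0 C0 degN_lt.
have dT := deg_twist_le w' A.
have {}dN : ((rh m - 1) * deg N + 1 <= kap ^ m.-1 * deg A + rh m.-1 * deg N + deg C)%N.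
  apply: leq_trans (leq_add dT (leqnn _)); apply: leq_trans dN.
  have pi0 : (0 < p ^ i)%N by rewrite expn_gt0 p_gt0.
  by rewrite {1}eN degX mulnCA mulnDr muln1 leq_add2l.
have eQ : (Q - v = v * (rh m - 1) + 1)%N.
  by rewrite mulnBr muln1 QE -(rhM m) addnBAC ?leq_pmulr.
have eQ' : (Q = kap * (v * rh m.-1 + 1))%N.
  by rewrite rhM -expnS prednK.
have hA : (kap * v * (kap ^ m.-1 * deg A) <= v * #|Z|)%N.
  by rewrite mulnAC mulnA -expnS prednK // -QE mulnC leq_mul2l dA orbT.
move: dN; rewrite -(leq_pmul2l (m := (kap * v)%N)) ?muln_gt0 ?v_gt0 ?(ltnW kap1) //.
rewrite eQ eQ' !mulnDr !mulnDl !muln1 !mulnA; move: hA; rewrite !mulnA.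
move: (kap * v * _ * deg A)%N (kap * v * _ * deg N)%N (kap * v * _ * deg N)%N => x y t.
by move: (kap * deg N)%N (v * #|Z|)%N (kap * v * deg C)%N (kap * v)%N; clear; lia.
Qed.

End WithAlpha.

Lemma m2_power : (k %| n)%N -> (v * v * q < Q * Q * (Q * Q))%N ->
  exists c (g : {poly F}), N = c *: g ^+ v.
Proof.
move=> /dvdnP[h hn] vq; have [cZ eZ] := deg_relation2.
have [al alZ] := outside_Z.
have vk : (v < kap)%N by exact: (v_lt charF k_gt0 v_dvd).
have kq : (kap <= q)%N.
  by rewrite leq_exp2l // (leq_trans _ mk_le) // leq_pmull.
have vq1 : (v <= q - 1)%N by move: vk kq; clear; lia.
have W := m2_ineq alZ vq1.
have mh : (m <= h)%N by move: mk_le; rewrite hn leq_pmul2r.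
have eH : (n - m * k = k * (h - m))%N by rewrite hn -mulnBl mulnC.
(* For [h < 2m] the degree relation gives [deg C = 0] and then contradicts [deg N > 0]. Otherwise
   [q = kap^g Q^2], and Stepanov runs with [l = kap^g], [P = Q^2]. *)
have [hm|hm] := ltnP h (2 * m).
  have hG : (kap ^ (h - m) <= kap ^ m.-1)%N.
    by rewrite leq_exp2l //; move: hm m_gt0; clear; lia.
  have k'1 : (1 < kap ^ m.-1)%N.
    by rewrite -(expn0 kap) ltn_exp2l //; move: m_gt1; clear; lia.
  have eQ' : (Q = kap * kap ^ m.-1)%N by rewrite -expnS prednK.
  have rQ : (v * rh m + 1 = Q)%N by rewrite rhM.
  have c0 : deg C = 0%N.
    have [//|c1] := posnP (deg C); exfalso; move: eZ cZ; rewrite eH expnM eQ'.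
    have : (kap ^ m.-1 + deg C <= kap * kap ^ m.-1 * deg C)%N.
      move: kap1 k'1 c1; case: kap => [|[|K]] //= _; case: (_ ^ _)%N => [|[|x]] // _.
      by case: (deg C) => // y _; clear; nia.
    by move: hG; move: (kap ^ _)%N (kap ^ _)%N (rh m * _)%N (kap * _ * _)%N; clear; lia.
  have : (v * (rh m * deg N) <= v * kap ^ m.-1)%N.
    by rewrite leq_mul2l; move: eZ hG; rewrite eH expnM c0; clear; lia.
  have : (v * kap ^ m.-1 + kap ^ m.-1 <= Q)%N by rewrite -mulSnr eQ' leq_mul2r vk orbT.
  have : (v * rh m <= v * rh m * deg N)%N by rewrite leq_pmulr.
  by rewrite mulnA; move: rQ k'1; clear; lia.
pose g := (h - 2 * m)%N.
have eh : h = (g + m + m)%N by rewrite /g; move: hm; clear; lia.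
have eG : (p ^ (n - m * k) = kap ^ g * kap ^ m)%N.
  by rewrite eH eh addnK expnM expnD.
have eq : (q = kap ^ g * (kap ^ m * kap ^ m))%N by rewrite hn eh mulnC expnM !expnD mulnA.
have vg : (v * v * kap ^ g < kap ^ m * kap ^ m)%N.
  by move: vq; rewrite eq QE mulnA ltn_pmul2r // muln_gt0 !expn_gt0 p_gt0.
have e1 : (v * #|Z| + (kap ^ m - 1) * deg N = v * (kap ^ g * kap ^ m + deg C))%N.
  by rewrite -eG -eZ mulnDr -(rhM m) addnK mulnA.
have e2 : (kap ^ m * deg C + 1 <= #|Z|)%N by rewrite -QE.
have rhMg := rhM g; have rhM2 := rhM (m + m)%N.
rewrite expnD in rhM2; rewrite QE in W.
have [B [D0 [D1 [r1 r2 r3 r4 [r5 r6]]]]] :=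
  stepanov_rangeP v_gt1 vk N_gt0 m_gt1 rhM2 rhMg vg e1 e2 W.
have eP : (kap ^ m * kap ^ m = p ^ (k * (m + m)))%N by rewrite -expnD expnM.
have eGk : (kap ^ g = p ^ (k * g))%N by rewrite expnM.
rewrite eP eGk in r1 r2 r3 r4 r5 r6.
have cF : #|F| = (p ^ (k * g) * p ^ (k * (m + m)))%N by rewrite cardF eq eP eGk.
have vK0 : (v * rh (m + m) = p ^ (k * (m + m)) - 1)%N by rewrite -eP -rhM2 addnK.
have vK1 : (v * rh g = p ^ (k * g) - 1)%N by rewrite -eGk -rhMg addnK.
have R1 : (1 < p ^ (k * (m + m)))%N.
  by rewrite -(expn0 p) ltn_exp2l // muln_gt0 k_gt0 addn_gt0 m_gt0.
have goodN x : x \notin Z -> N.[x] ^+ (p ^ (k * g) * rh (m + m) + rh g) = 1.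
  move=> xZ; rewrite -[RHS](good xZ); congr (_ ^+ _).
  rewrite -[LHS](mulKn _ v_gt0); congr (_ %/ _)%N.
  rewrite mulnDr mulnCA vK0 vK1 eq eP eGk mulnBr muln1.
  by rewrite addnBA ?expn_gt0 ?p_gt0 // subnK // leq_pmulr // expn_gt0 p_gt0.
rewrite -cF in r3 r4.
exact: (stepanov charF cF v_gt0 vK0 vK1 R1 N_neq0 goodN r1 r2 r3 r4 r5 r6).
Qed.

End M2.

(** * The differential equation of a minimal value set polynomial *)

Section ValueSets.
Variable F : finFieldType.
Implicit Types (f : {poly F}) (S : {set F}).

Lemma root_count f (A : {set F}) : f != 0 -> {in A, forall a, root f a} -> (#|A| <= deg f)%N.
Proof.
by move=> f0 /dvdp_rootpoly/(dvdp_deg f0); rewrite deg_rootpoly.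
Qed.

Lemma value_set_lower f : (0 < deg f)%N -> ((#|F| - 1) %/ deg f < #|value_set f|)%N.
Proof.
move=> f0; have Fgt0 : (0 < #|F|)%N by apply/card_gt0P; exists 0.
suff h : (#|F| <= #|value_set f| * deg f)%N.
  by rewrite ltn_divLR // subn1 prednK.
rewrite -[leqLHS]sum1_card (partition_big (horner f) (mem (value_set f))) /=; last first.
  by move=> a _; apply/imsetP; exists a.
rewrite -sum_nat_const leq_sum // => s _.
have fs : f - s%:P != 0.
  by apply: contraTneq f0 => /eqP; rewrite subr_eq0 => /eqP->; rewrite degC.
have -> : deg f = deg (f - s%:P) by rewrite degDl // degN degC.
rewrite sum1dep_card; apply: root_count => // a; rewrite inE => /eqP e.
by rewrite rootE hornerD hornerN hornerC e subrr.
Qed.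

Lemma powset_card_lower S v : (0 < v)%N -> 0 \in S ->
  (#|S| - 1 <= v * (#|powset S v| - 1))%N.
Proof.
move=> v0 S0.
have Sv0 : 0 \in powset S v by apply/imsetP; exists 0; rewrite // expr0n gtn_eqF.
rewrite (cardsD1 0 S) S0 (cardsD1 0 (powset S v)) Sv0 !addKn.
rewrite -[leqLHS]sum1_card (partition_big (fun u => u ^+ v) (mem (powset S v :\ 0))) /=; last first.
  move=> u; rewrite !inE => /andP[u0 uS]; rewrite expf_neq0 //=.
  by apply/imsetP; exists u.
rewrite mulnC -sum_nat_const leq_sum // => s _.
rewrite sum1dep_card; have e : deg ('X^v - s%:P : {poly F}) = v.
  by rewrite degDl ?degN ?degC degXn.
rewrite -[X in (_ <= X)%N]e.
apply: root_count => [|a].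
  by apply: contraTneq v0 => h; rewrite -e h deg0.
by rewrite inE => /andP[_ /eqP h]; rewrite rootE hornerD hornerXn hornerN hornerC h subrr.
Qed.

End ValueSets.

(** * From the value set to the differential equation, the factorisation and the power criterion *)

Section Base.
Variables (F : finFieldType) (p n k v m : nat) (S : {set F}) (M : nat -> F).
Local Notation q := (p ^ n)%N.
Local Notation kap := (p ^ k)%N.
Local Notation Q := (p ^ (m * k))%N.
Local Notation rh := (rho p k v).
Hypotheses (charF : p \in [pchar F]) (cardF : #|F| = q) (k_gt0 : (0 < k)%N).
Hypotheses (m_gt0 : (0 < m)%N) (v_gt0 : (0 < v)%N) (v_dvd : (v %| kap - 1)%N).
Hypotheses (k_dvd : (k %| n)%N) (cardS : #|S| = Q) (S0 : 0 \in S).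
Hypothesis Szeta : forall z u, z ^+ v = 1 -> u \in S -> z * u \in S.
Hypotheses (Mm : M m = 1).
Hypothesis M_S : {in S, forall u, \sum_(l < m.+1) M l * u ^+ (kap ^ l) = 0}.
Hypothesis r_gt1 : (1 < rh m)%N.

Let pr : prime p := pcharf_prime charF.
Let p_gt1 : (1 < p)%N := prime_gt1 pr.
Let p_gt0 : (0 < p)%N := prime_gt0 pr.
Let kap1 : (1 < kap)%N := kap_gt1 charF k_gt0.
Let rhM l : (v * rh l + 1 = kap ^ l)%N := rho_mul kap1 v_dvd l.
Let Q0 : (0 < Q)%N := expp_gt0 charF (m * k).
Let QE : Q = (kap ^ m)%N := Q_kap p k m.
Let Sv := powset S v.

Let T : {poly F} := \sum_(l < m.+1) M l *: 'X^((rh l).+1).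

(** For [s = u^v] one has [s^(rho l + 1) = u^(v-1) u^(kap^l)]. *)
Lemma T_root s : s \in Sv -> root T s.
Proof.
case/imsetP=> u uS ->; apply/rootP; rewrite /T horner_sum.
transitivity (u ^+ v.-1 * 0); last by rewrite mulr0.
rewrite -[X in _ * X](M_S uS) mulr_sumr; apply: eq_bigr => l _.
rewrite hornerZ hornerXn -exprM mulrCA -exprD; congr (_ * _ ^+ _).
by rewrite mulnS -(rhM l) addn1 addnS -addSn prednK.
Qed.

Lemma deg_T : deg T = (rh m).+1.
Proof.
rewrite /T big_ord_recr /= Mm scale1r degDr ?degXn // ltnS.
apply: deg_sum_le => l _; apply: leq_trans (degZ_le _ _) _.
by rewrite degXn (rho_ltn kap1).
Qed.

Lemma T_neq0 : T != 0.
Proof. by apply/eqP => h; have := deg_T; rewrite h deg0. Qed.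

(** The roots of [T] give the upper bound; fibres of [u -> u^v] of size at most [v] give the lower
    one. *)
Lemma card_Sv : #|Sv| = (rh m).+1.
Proof.
apply/eqP; rewrite eqn_leq; apply/andP; split.
  by rewrite -deg_T; apply: root_count T_neq0 T_root.
have := powset_card_lower v_gt0 S0; rewrite cardS QE -(rhM m) addnK leq_pmul2l //.
have : (0 < #|Sv|)%N by apply/card_gt0P; exists (0 ^+ v); apply: imset_f.
by rewrite -/Sv; case: #|Sv| => // x _; rewrite subn1.
Qed.

Lemma Sv0 : 0 \in Sv.
Proof. by apply/imsetP; exists 0; rewrite // expr0n gtn_eqF. Qed.

Lemma T_monic : T \is monic.
Proof.
apply/monicP; rewrite /lead_coef -/(deg T) deg_T /T big_ord_recr /= Mm scale1r.
rewrite coefD coefXn eqxx coef_sum big1 ?add0r // => l _.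
by rewrite coefZ coefXn eqSS gtn_eqF ?mulr0 // (rho_ltn kap1).
Qed.

Lemma T_rootpoly : T = rootpoly Sv.
Proof.
apply/eqP; rewrite -eqp_monic ?T_monic ?rootpoly_monic // eqp_sym.
rewrite -dvdp_size_eqp; last by apply: dvdp_rootpoly => s; apply: T_root.
by rewrite !size_deg ?T_neq0 ?rootpoly_neq0 // deg_rootpoly card_Sv deg_T.
Qed.

(* [v * rho l = -1] in [F] for [l > 0]. *)
Lemma T_deriv : v%:R *: ('X * T^`()) = M 0%N *: 'X + (v%:R - 1) *: T.
Proof.
rewrite /T raddf_sum /= mulr_sumr scaler_sumr big_ord_recl /=.
rewrite [in RHS]big_ord_recl rho0 expr1 scalerDr addrA.
congr (_ + _).
  by rewrite derivZ derivX -scalerAr mulr1 !scalerA -scalerDl; congr (_ *: _); ring.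
rewrite scaler_sumr; apply: eq_bigr => l _; rewrite derivZ derivXn -scalerAr scalerA scalerA.
have e : v%:R * (rh (bump 0 l)).+1%:R = v%:R - 1 :> F.
  by rewrite mulrSr mulrDr mulr1 (vrho_eqN1 charF k_gt0 v_dvd) // addrC.
rewrite mulrnAr -exprS -scaler_nat scalerA mulrAC e; congr (_ *: _).
Qed.

(** [M 0] is [T'(0)], and 0 is a simple root of [T]. *)
Lemma M0_neq0 : M 0%N != 0.
Proof.
have := rootpoly_separable Sv; rewrite -T_rootpoly => coT.
have T0 : root T 0 := T_root Sv0.
have := coprimep_root coT T0; rewrite horner_coef0 coef_deriv mulr1n.
rewrite /T coef_sum big_ord_recl coefZ coefXn rho0 mulr1 big1 ?addr0 // => l _.
have h : (0 < rh (lift ord0 l))%N by exact: (rho_gt0 kap1 v_gt0 v_dvd).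
by rewrite coefZ coefXn eqSS ltn_eqF // mulr0.
Qed.

Section WithPhi.
Variable Phi : {poly F}.
Hypothesis mvsPhi : mvsps Sv Phi.
Let Z := [set x | Phi.[x] == 0].
Local Notation L := (rootpoly Z).
Let w l := M l / M 0%N.

Lemma Phi_deg : (0 < deg Phi)%N. Proof. by case: mvsPhi => [[]]. Qed.

Let Phi0 : Phi != 0.
Proof. by apply: contraTneq Phi_deg => ->; rewrite deg0. Qed.

Lemma Phi_val x : Phi.[x] \in Sv.
Proof. by case: mvsPhi => _ <-; apply/imsetP; exists x. Qed.

Lemma Phi_quo : ((q - 1) %/ deg Phi)%N = rh m.
Proof.
case: mvsPhi => [[_ h] e]; move: h; rewrite e card_Sv cardF addn1; by case.
Qed.

Lemma Phi_deg_le : (rh m * deg Phi <= q - 1)%N.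
Proof. by rewrite -Phi_quo leq_trunc_div. Qed.

Lemma Phi_deg_lt : (rh m * deg Phi < q)%N.
Proof. by apply: leq_ltn_trans Phi_deg_le _; rewrite subn1 ltn_predL expn_gt0 p_gt0. Qed.

Lemma rootpolyT : rootpoly [set: F] = 'X^q - 'X.
Proof.
by rewrite -cardF finField_genPoly /rootpoly big_enum; apply: eq_bigl => x; rewrite inE.
Qed.

Lemma derivXqX : deriv ('X^q - 'X : {poly F}) = -1.
Proof.
have n0 : (0 < n)%N.
  rewrite lt0n; apply/eqP => h; have : (Q <= #|F|)%N by rewrite -cardS max_card.
  by rewrite cardF h expn0 leqNgt -(expn0 p) ltn_exp2l // muln_gt0 m_gt0 k_gt0.
by rewrite derivB derivX (deriv_expp charF) // sub0r.
Qed.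

Lemma root_all (f : {poly F}) : (forall x, f.[x] = 0) -> exists g, f = ('X^q - 'X) * g.
Proof.
move=> h; have /dvdpP[g ->] : rootpoly [set: F] %| f.
  by apply: dvdp_rootpoly => x _; apply/rootP.
by exists g; rewrite rootpolyT mulrC.
Qed.

Lemma v_neq0 : v%:R != 0 :> F.
Proof.
apply/eqP => h; have := vrho_eqN1 charF k_gt0 v_dvd (isT : (0 < 1)%N).
by rewrite h mul0r => /eqP; rewrite eq_sym oppr_eq0 oner_eq0.
Qed.

Lemma card_Z_le : (#|Z| <= deg Phi)%N.
Proof. by apply: root_count Phi0 _ => x; rewrite inE => /eqP/rootP. Qed.

(* After division by [X^q - X] both sides have degree less than [deg Phi];    *)
(* they agree where [Phi] does not vanish, because [v * T'(s) = M 0] at every *)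
(* nonzero [s] in [Sv].                                                       *)
Lemma T_Phi : v%:R *: (T \Po Phi) = M 0%N *: (('X - 'X^q) * Phi^`()).
Proof.
have [g eg] : exists g, T \Po Phi = ('X^q - 'X) * g.
  by apply: root_all => x; rewrite horner_comp; apply/rootP/T_root/Phi_val.
have dT : deg (T \Po Phi) = ((rh m).+1 * deg Phi)%N by rewrite /deg size_comp_poly -!/(deg _) deg_T.
have g0 : g != 0.
  apply/eqP => h; move: dT; rewrite eg h mulr0 deg0 => /esym/eqP.
  by rewrite muln_eq0 /= gtn_eqF ?Phi_deg.
have q1 : (1 < q)%N by move: Phi_deg_lt Phi_deg r_gt1; clear; nia.
have dX : deg ('X^q - 'X : {poly F}) = q.
  by rewrite degDl ?degN ?degXn // -['X]expr1 degXn.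
have X0 : 'X^q - 'X != 0 :> {poly F}.
  by apply: contraTneq q1 => h; rewrite -dX h deg0.
have dg : (deg g < deg Phi)%N.
  move: dT Phi_deg_lt; rewrite eg degM // dX mulSn; clear; lia.
have hW : v%:R *: g + M 0%N *: Phi^`() = 0.
  apply/eqP; apply/negPn/negP => W0.
  have h : (#|~: Z| <= deg (v%:R *: g + M 0%N *: Phi^`()))%N.
    apply: root_count W0 _ => x; rewrite !inE => Px.
    have Tx : T.[Phi.[x]] = 0 by apply/rootP/T_root/Phi_val.
    have hT : v%:R * T^`().[Phi.[x]] = M 0%N.
      have := congr1 (fun f => f.[Phi.[x]]) T_deriv.
      rewrite !hornerE /= Tx mulr0 addr0 => h.
      by apply: (mulIf Px); rewrite -h; ring.
    have := congr1 (fun f => f^`().[x]) eg; rewrite /= deriv_comp derivM derivXqX.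
    have xq : x ^+ q = x by rewrite -cardF expf_card.
    rewrite !hornerE horner_comp xq subrr mul0r addr0 => h.
    apply/rootP; rewrite !hornerE -hT -mulrA h.
    by rewrite mulN1r mulrN subrr.
  have h2 : (deg (v%:R *: g + M 0%N *: Phi^`())%R <= (deg Phi).-1)%N.
    apply: degD_le; apply: leq_trans (degZ_le _ _) _; last exact: deg_deriv_le.
    by rewrite -ltnS prednK ?Phi_deg.
  have := cardsC Z; rewrite cardF.
  move: h h2 card_Z_le Phi_deg_lt Phi_deg r_gt1; clear; nia.
rewrite eg mulrC scalerAl -[v%:R *: g](addrK (M 0%N *: Phi^`())) hW sub0r.
by rewrite mulNr -mulrN opprB -scalerAl mulrC.
Qed.

Lemma Z_gt0 : (0 < #|Z|)%N.
Proof.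
have := Sv0; case: mvsPhi => _ <- /imsetP[x _ e].
by apply/card_gt0P; exists x; rewrite inE -e.
Qed.

Lemma L_dvd : L %| Phi.
Proof. by apply: dvdp_rootpoly => x; rewrite inE => /eqP/rootP. Qed.

Let L1 := rootpoly (~: Z).

Lemma rootpoly_compl : L * L1 = 'X^q - 'X.
Proof.
rewrite -rootpolyT /L1 /rootpoly !big_enum /=.
rewrite [RHS](bigID (mem Z)) /=; congr (_ * _); apply: eq_bigl => x; by rewrite !inE.
Qed.

(** This is [T(Phi)] divided by [M 0 * Phi]. *)
Let Sig : {poly F} := \sum_(l < m.+1) w l *: Phi ^+ rh l.

Lemma weight0 : w 0%N = 1.
Proof. by rewrite /w divff // M0_neq0. Qed.

Lemma weight_last : w m != 0.
Proof. by rewrite /w Mm mul1r invr_neq0 // M0_neq0. Qed.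

Lemma Sig_eq : v%:R *: (Phi * Sig) = - (L * L1 * Phi^`()).
Proof.
have M0 := M0_neq0; apply: (scalerI M0).
rewrite -mulNr rootpoly_compl opprB -T_Phi scalerA mulrC -scalerA; congr (_ *: _).
rewrite /T linear_sum /= /Sig mulr_sumr scaler_sumr; apply: eq_bigr => l _.
by rewrite comp_polyZ comp_Xn_poly exprS scalerAr scalerA /w mulrCA divff ?mulr1 // -scalerAr.
Qed.

Lemma Sig_root x : x \in Z -> Sig.[x] = 1.
Proof.
rewrite inE => /eqP h; rewrite /Sig horner_sum big_ord_recl weight0 rho0 big1 => [|l _].
  by rewrite hornerZ expr0 hornerC mulr1 addr0.
have hr : (0 < rh (lift ord0 l))%N by exact: (rho_gt0 kap1 v_gt0 v_dvd).
by rewrite hornerZ horner_exp h expr0n gtn_eqF // mulr0.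
Qed.

(** [Phi] is coprime to [L1], so it divides [L Phi'], with a quotient [E] of degree below [#|Z|]. On
    [Z] one has [Sig = 1] and [L' L1 = -1], so [E] and [v L'] agree at [#|Z|] points and
    coincide. *)
Lemma Sig_deriv : Sig = - (L1 * L^`()).
Proof.
have coL1 : coprimep Phi L1.
  rewrite /L1 /rootpoly big_enum /=; apply: (big_ind (coprimep Phi)) => [|x y hx hy|x].
  - exact: coprimep1.
  - by rewrite coprimepMr hx.
  by rewrite !inE coprimep_XsubC => h; apply/negP => /rootP/eqP; apply/negP.
have [E eE] : exists E, L * Phi^`() = E * Phi.
  apply/dvdpP; rewrite -(Gauss_dvdpr _ coL1).
  have : Phi %| v%:R *: (Phi * Sig) by rewrite dvdpZr ?v_neq0 // dvdp_mulr.
  by rewrite Sig_eq dvdpNr mulrCA mulrA.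
have eS : v%:R *: Sig = - (L1 * E).
  apply: (mulfI Phi0); rewrite -scalerAr Sig_eq [L * L1]mulrC -mulrA eE mulrN.
  by congr (- _); ring.
have hE : E = v%:R *: L^`().
  apply/eqP; rewrite -subr_eq0; apply/negPn/negP => W0.
  have h : (#|Z| <= deg (E - v%:R *: L^`()))%N.
    apply: root_count W0 _ => x xZ.
    have := congr1 (fun f => f.[x]) eS; rewrite /= !hornerE Sig_root // mulr1 => h.
    have := congr1 (fun f => f^`().[x]) rootpoly_compl; rewrite /= derivM derivXqX !hornerE.
    have /rootP -> : root L x by rewrite root_rootpoly.
    rewrite mul0r addr0 => h2.
    apply/rootP; rewrite !hornerE h mulNr opprK mulrAC [L1.[x] * _]mulrC h2.
    by rewrite mulN1r subrr.
  have h2 : (deg (E - v%:R *: L^`())%R <= #|Z|.-1)%N.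
    apply: degD_le; last first.
      rewrite degN; apply: leq_trans (degZ_le _ _) _.
      by apply: leq_trans (deg_deriv_le _) _; rewrite deg_rootpoly.
    have [->|E0] := eqVneq E 0; first by rewrite deg0.
    have P0 : Phi^`() != 0.
      by apply: contraNneq E0 => h1; move/eqP: eE;
        rewrite h1 mulr0 eq_sym mulf_eq0 (negPf Phi0) orbF.
    have := congr1 (@deg F) eE; rewrite !degM ?rootpoly_neq0 // deg_rootpoly.
    have := deg_deriv_le Phi; have := Phi_deg; have := Z_gt0; clear; lia.
  by move: h h2 Z_gt0; clear; lia.
apply: (scalerI v_neq0); rewrite eS hE scalerN -scalerAr //.
Qed.

Lemma base_mvs_eq : \sum_(l < m.+1) w l *: (L * Phi ^+ rh l) = ('X - 'X^q) * L^`().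
Proof.
rewrite -opprB -rootpoly_compl mulNr -mulrA -mulrN -Sig_deriv /Sig mulr_sumr.
by apply: eq_bigr => l _; rewrite scalerAr.
Qed.

Lemma base_coprime : coprimep L^`() Phi.
Proof.
have := Sig_deriv; rewrite /Sig big_ord_recl weight0 scale1r rho0 expr0.
have [D ->] : exists D, \sum_(i < m) w (lift ord0 i) *: Phi ^+ rh (lift ord0 i) = D * Phi.
  apply/dvdpP; apply: (big_ind (fun f => Phi %| f)) => [|x y|i _].
  - exact: dvdp0.
  - exact: dvdp_add.
  have hr : (0 < rh (lift ord0 i))%N by exact: (rho_gt0 kap1 v_gt0 v_dvd).
  by rewrite -mul_polyC dvdp_mull // -(prednK hr) exprS dvdp_mulr.
move=> e; apply/Bezout_coprimepP; exists (- L1, - D) => /=.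
suff -> : - L1 * L^`() + - D * Phi = 1 by rewrite eqpxx.
by rewrite mulNr -e mulNr addrK.
Qed.


Lemma mk_le : (m * k <= n)%N.
Proof.
have : (Q <= #|F|)%N by rewrite -cardS max_card.
by rewrite cardF leq_exp2l.
Qed.

Lemma v_dvd_q : (v %| q - 1)%N.
Proof.
case/dvdnP: k_dvd => h ->; apply: dvdn_trans v_dvd _.
by rewrite mulnC expnM -{2}(exp1n h) subn_exp dvdn_mulr.
Qed.

Hypothesis nondegenerate : (1 < m)%N \/
  m = 1%N /\ (1 < rh 1)%N /\ (forall i, (0 < i < k)%N -> ~~ (rh 1 %| p ^ i - 1)%N).

Lemma base_factor : exists C N : {poly F}, [/\ L^`() = C ^+ Q,
  Phi = L ^+ v * N ^+ Q, coprimep C N & coprimep C L].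
Proof.
exact: (mvsp_structure charF k_gt0 m_gt0 v_gt0 v_dvd mk_le weight0 weight_last Phi_deg Z_gt0 L_dvd
  base_mvs_eq base_coprime Phi_deg_lt nondegenerate).
Qed.

Section WithFactor.
Variables C N : {poly F}.
Hypotheses (eC : L^`() = C ^+ Q) (ePhi : Phi = L ^+ v * N ^+ Q).
Hypotheses (coCN : coprimep C N) (coCL : coprimep C L).

Lemma factor_neq0 : N != 0.
Proof. by apply: contraNneq Phi0 => h; rewrite ePhi h expr0n gtn_eqF // mulr0. Qed.

Lemma factor_eq : \sum_(l < m.+1) w l *: (L ^+ (kap ^ l) * N ^+ (Q * rh l))
  = ('X - 'X^q) * L^`().
Proof.
rewrite -base_mvs_eq; apply: eq_bigr => l _; congr (_ *: _).
by rewrite {1}ePhi exprMn -!exprM mulrA -exprS -(rhM l) addn1.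
Qed.

(** For the last bound, [deg Phi = v #|Z| + Q deg N], which is [v p^(n-mk) + v deg C + deg N] by the
    second relation. *)
Lemma factor_degrees : [/\ (Q * deg C + 1 <= #|Z|)%N,
  (#|Z| + rh m * deg N = p ^ (n - m * k) + deg C)%N &
  (v * p ^ (n - m * k) <= deg Phi)%N].
Proof.
have h1 := degC_lt Z_gt0 eC coCL.
have h2 := deg_relation charF k_gt0 m_gt0 v_gt0 v_dvd mk_le weight_last Z_gt0 factor_neq0 eC
  factor_eq coCL.
split=> //; have := congr1 (muln v) h2; rewrite ePhi degM ?expf_neq0 ?factor_neq0 ?rootpoly_neq0 //.
rewrite !degX deg_rootpoly !mulnDr mulnA QE -(rhM m) mulnDl mul1n; clear.
by move: (v * rh m * _)%N => y; lia.
Qed.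

(** A nonzero value of [Phi] is some [u^v], so its power [(q-1)/v] is 1; the factor [L^v] also
    contributes 1, and [Q]-th powers are injective. *)
Lemma factor_good x : x \notin Z -> N.[x] ^+ ((q - 1) %/ v) = 1.
Proof.
move=> xZ; have Lx : L.[x] != 0 by rewrite -rootE root_rootpoly.
have q1 (y : F) : y != 0 -> y ^+ (q - 1) = 1.
  move=> y0; apply: (mulfI y0); rewrite -exprS -addn1 subnK ?expn_gt0 ?p_gt0 //.
  by rewrite -cardF expf_card mulr1.
case/imsetP: (Phi_val x) => u uS e.
have u0 : u != 0.
  by apply: contraNneq xZ => h; rewrite inE e h expr0n gtn_eqF.
apply: (exprp_inj charF (i := m * k)); rewrite /= expr1n.
rewrite exprAC.
have /eqP := e; rewrite ePhi hornerM !horner_exp => /eqP/(congr1 (fun z => z ^+ ((q - 1) %/ v))).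
rewrite exprMn -!exprM mulnC divnK ?v_dvd_q // !q1 // mul1r => <-.
by rewrite exprM.
Qed.

(** One nonzero value of [Phi], a [v]-th power of an element of [S], fixes the constant, so
    [Phi = f^v]. Values of [f] differ from elements of [S] by [v]-th roots of unity, hence lie in
    [S]; counting shows that they fill [S]. *)
Lemma factor_power c (g : {poly F}) : N = c *: g ^+ v -> mvsps_pow S v Phi.
Proof.
move=> eN; pose h := L * g ^+ Q.
have eh : Phi = c ^+ Q *: h ^+ v.
  by rewrite ePhi eN exprZn -scalerAr exprMn -!exprM [(v * Q)%N]mulnC.
have [x xZ] : exists x, x \notin Z.
  have : (0 < #|~: Z|)%N.
    have := cardsC Z; rewrite cardF; have := card_Z_le; have := Phi_deg_lt.
    have := Phi_deg; move: r_gt1; clear; nia.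
  by case/card_gt0P=> x; rewrite inE => ?; exists x.
case/imsetP: (Phi_val x) => u uS e.
have hx : h.[x] != 0.
  apply: contraNneq xZ => e0; rewrite inE eh hornerZ horner_exp e0 expr0n gtn_eqF //.
  by rewrite mulr0.
pose f := (u / h.[x]) *: h.
have ef : Phi = f ^+ v.
  rewrite /f exprZn eh; congr (_ *: _).
  rewrite exprMn -e eh hornerZ horner_exp exprVn mulfK // expf_neq0 //.
exists f => //.
have f0 : f != 0 by apply: contraNneq Phi0 => h0; rewrite ef h0 expr0n gtn_eqF.
have dPhi : (deg Phi = v * deg f)%N by rewrite ef degX.
have df : (0 < deg f)%N by move: Phi_deg; rewrite dPhi muln_gt0 => /andP[].
have VS : value_set f \subset S.
  apply/subsetP => _ /imsetP[y _ ->]; case/imsetP: (Phi_val y) => t tS.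
  rewrite ef horner_exp => et; have [t0|t0] := eqVneq t 0.
    by move/eqP: et; rewrite t0 expr0n gtn_eqF // expf_eq0 v_gt0 => /eqP->.
  rewrite -[f.[y]](divfK t0); apply: Szeta => //.
  by rewrite exprMn exprVn et divff // expf_neq0.
have card_le : (#|value_set f| <= Q)%N by rewrite -cardS subset_leq_card.
have card_ge := value_set_lower df.
have quo : (Q <= (q - 1) %/ deg f + 1)%N.
  rewrite QE -(rhM m) leq_add2r leq_divRL // mulnAC -dPhi mulnC; exact: Phi_deg_le.
rewrite cardF in card_ge.
have cV : #|value_set f| = Q by move: card_le card_ge quo; clear; lia.
split; last by apply/eqP; rewrite eqEcard VS cardS cV leqnn.
by split=> //; rewrite cV cardF; move: card_le card_ge quo; clear; lia.
Qed.

End WithFactor.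

Lemma mvsp_degree_lower : (v * p ^ (n - m * k) <= deg Phi)%N.
Proof.
have [C [N [eC ePhi coCN coCL]]] := base_factor.
by case: (factor_degrees eC ePhi coCL).
Qed.

Lemma mvsp_power_const (N : {poly F}) : deg N = 0%N -> exists c (g : {poly F}), N = c *: g ^+ v.
Proof.
by move=> dN; exists N`_0, 1; rewrite expr1n -mul_polyC mulr1 -deg_eq0P.
Qed.

Lemma mvsp_power_m2 : (1 < m)%N -> (1 < v)%N -> (exists2 j, (0 < j < m)%N & M j != 0) ->
  (v * v * q < Q * Q * (Q * Q))%N -> mvsps_pow S v Phi.
Proof.
move=> m1 v1 [j jm Mj] hq; have [C [N [eC ePhi coCN coCL]]] := base_factor.
suff [c [g eN]] : exists c (g : {poly F}), N = c *: g ^+ v by exact: (factor_power ePhi eN).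
have [dN|dN] := posnP (deg N); first exact: mvsp_power_const.
have w_mid : exists2 j, (0 < j < m)%N & w j != 0.
  by exists j => //; rewrite mulf_neq0 ?invr_neq0 ?M0_neq0.
exact: (m2_power charF k_gt0 m1 v1 v_dvd mk_le weight0 weight_last Z_gt0 (factor_neq0 ePhi) cardF eC
  (factor_eq ePhi) coCN coCL w_mid (factor_good ePhi) dN k_dvd hq).
Qed.

Lemma mvsp_power_m1 : m = 1%N -> (1 < v)%N -> (forall i,
  (0 < i < k)%N -> ~~ (rh 1 %| p ^ i - 1)%N) ->
  n = k \/ n = (2 * k)%N \/ n = (3 * k)%N /\ (3 * v < kap + 3)%N -> mvsps_pow S v Phi.
Proof.
move=> m1 v1 nd nk; have [C [N [eC ePhi coCN coCL]]] := base_factor.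
suff [c [g eN]] : exists c (g : {poly F}), N = c *: g ^+ v by exact: (factor_power ePhi eN).
have [d1 d2 _] := factor_degrees eC ePhi coCL.
have wm' := weight_last; have mq := factor_eq ePhi; have mk := mk_le; have rm := r_gt1.
rewrite m1 mul1n in d1 d2 eC wm' mq mk rm.
rewrite !big_ord_recl big_ord0 addr0 weight0 scale1r rho0 muln0 !expr0 mulr1 expn0 !expr1 /= in mq.
exact: (m1_power charF k_gt0 v1 v_dvd mk cardF wm' Z_gt0 (factor_neq0 ePhi) (C_neq0 Z_gt0 coCL) eC
  mq coCL d1 d2 rm nd nk (factor_good ePhi)).
Qed.

End WithPhi.

Lemma mvsps_pow_mvsps Phi : mvsps_pow S v Phi -> mvsps Sv Phi.
Proof.
case=> f [[df hf] ef] ->.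
have eV : value_set (f ^+ v) = Sv.
  apply/setP=> y; apply/imsetP/imsetP => [[x _ ->]|[u]].
    by exists f.[x]; rewrite ?horner_exp // -ef; apply: imset_f.
  by rewrite -ef => /imsetP[x _ ->] ->; exists x; rewrite ?horner_exp.
split=> //; split; first by rewrite degX muln_gt0 v_gt0.
rewrite eV card_Sv degX mulnC divnMA addn1.
move: hf; rewrite ef cardS QE -(rhM m) => /addIn <-.
by rewrite mulKn.
Qed.

End Base.

(** * Subfields and annihilators *)

Section Subfields.
Variables (F : finFieldType) (p n : nat).
Hypotheses (p_prime : prime p) (cardF : #|F| = (p ^ n)%N).
Implicit Types (E S : {set F}) (x : F).

Let charF : p \in [pchar F] := card_finPcharP cardF p_prime.
Let p_gt1 : (1 < p)%N := prime_gt1 p_prime.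

Lemma subfield0 E : is_subfield E -> 0 \in E.
Proof. by case=> E1 EB _; rewrite -(subrr 1) EB. Qed.

Lemma subfieldM E : is_subfield E -> {in E &, forall x y, x * y \in E}.
Proof.
case=> E1 EB ED x y xE yE; rewrite -[y]invrK; apply: (ED) => //.
by rewrite -[y^-1]mul1r ED.
Qed.

Lemma subfield_card_gt1 E : is_subfield E -> (1 < #|E|)%N.
Proof.
move=> hE; rewrite (cardsD1 0) (subfield0 hE) add1n ltnS.
by apply/card_gt0P; exists 1; rewrite !inE oner_neq0; case: hE.
Qed.

Lemma subfield_pow E x : is_subfield E -> x \in E -> x ^+ #|E| = x.
Proof.
move=> hE xE; have E0 := subfield0 hE.
have [->|x0] := eqVneq x 0.
  by rewrite expr0n gtn_eqF // (ltnW (subfield_card_gt1 hE)).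
rewrite (cardsD1 0) E0 add1n exprS; suff -> : x ^+ #|E :\ 0| = 1 by rewrite mulr1.
pose P := \prod_(y in E :\ 0) y.
have P0 : P != 0.
  by apply/prodf_neq0 => y; rewrite !inE => /andP[].
apply: (mulIf P0); rewrite mul1r -prodr_const -big_split /=.
rewrite [RHS](reindex_inj (mulfI x0)); apply: eq_bigl => y; rewrite !inE.
rewrite mulf_eq0 (negPf x0) /=; congr (_ && _); apply/idP/idP => yE.
  exact: subfieldM.
rewrite -[y](mulKf x0) mulrC; case: hE => _ _; exact.
Qed.

Lemma card_frob_roots j : (0 < j)%N -> (#|[set x : F | x ^+ (p ^ j) == x]| <= p ^ j)%N.
Proof.
move=> j0; have pj : (1 < p ^ j)%N by rewrite -(expn0 p) ltn_exp2l.
have dX : deg ('X^(p ^ j) - 'X : {poly F}) = (p ^ j)%N.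
  by rewrite degDl ?degN ?degXn // -['X]expr1 degXn.
rewrite -[leqRHS]dX; apply: root_count => [|x].
  by apply: contraTneq pj => h; rewrite -dX h deg0.
by rewrite inE => /eqP h; rewrite rootE !hornerE h subrr.
Qed.

Lemma frob_subfield j : is_subfield [set x : F | x ^+ (p ^ j) == x].
Proof.
split=> [|x y|x y]; rewrite !inE ?expr1n //.
  by move=> /eqP hx /eqP hy; rewrite (exprBp charF) hx hy.
by move=> /eqP hx /eqP hy; rewrite exprMn exprVn hx hy.
Qed.

Lemma subfieldI E E' : is_subfield E -> is_subfield E' -> is_subfield (E :&: E').
Proof.
case=> a1 a2 a3 [b1 b2 b3]; split=> [|x y|x y]; rewrite !inE ?a1 ?b1 //.
  by move=> /andP[x1 x2] /andP[y1 y2]; rewrite a2 ?b2.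
by move=> /andP[x1 x2] /andP[y1 y2]; rewrite a3 ?b3.
Qed.

Lemma subfield_card E : is_subfield E -> exists2 j, (0 < j)%N & #|E| = (p ^ j)%N.
Proof.
move=> hE; have [E1 EB _] := hE; have E0 := subfield0 hE.
have gE : group_set E.
  apply/group_setP; split=> // x y xE yE.
  by rewrite -[(x * y)%g]/(x + y) -[y]opprK EB // -sub0r EB.
have : (#|Group gE| %| #|[set: F]|)%N by apply: cardSg; apply: subsetT.
rewrite /= cardsT cardF => /(dvdn_pfactor _ _ p_prime)[j _ e]; exists j => //.
by rewrite lt0n; apply: contraTneq (subfield_card_gt1 hE) => j0; rewrite e j0.
Qed.

Lemma subfieldE E j : is_subfield E -> #|E| = (p ^ j)%N -> E = [set x | x ^+ (p ^ j) == x].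
Proof.
move=> hE cE; have j0 : (0 < j)%N.
  by rewrite lt0n; apply: contraTneq (subfield_card_gt1 hE) => j0; rewrite cE j0.
apply/eqP; rewrite eqEcard cE card_frob_roots // andbT.
by apply/subsetP=> x xE; rewrite inE -cE subfield_pow.
Qed.

Lemma frob_iter j i x : x ^+ (p ^ j) = x -> x ^+ (p ^ (j * i)) = x.
Proof. by move=> h; elim: i => [|i IH]; rewrite ?muln0 // mulnS expnD exprM h. Qed.

Lemma frob_gcd a b x : (0 < a)%N -> x ^+ (p ^ a) = x -> x ^+ (p ^ b) = x ->
  x ^+ (p ^ gcdn a b) = x.
Proof.
move=> a0 ha hb; have [u v e _] := egcdnP b a0.
by rewrite -{1}(frob_iter v hb) -exprM -expnD [(b * _)%N]mulnC -e [(u * _)%N]mulnC frob_iter.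
Qed.

(** Elements of [E] are fixed by the Frobenius of exponent [gcd(e, j)], which has at most
    [p^gcd(e, j)] fixed points. *)
Lemma subfield_exp_dvd E e j : is_subfield E -> #|E| = (p ^ e)%N -> (0 < e)%N ->
  {in E, forall x, x ^+ (p ^ j) = x} -> (e %| j)%N.
Proof.
move=> hE cE e0 hj; suff : (e <= gcdn e j)%N.
  move=> h; have := dvdn_leq e0 (dvdn_gcdl e j) => h2.
  by have <- : gcdn e j = e; [apply/eqP; rewrite eqn_leq h h2|exact: dvdn_gcdr].
rewrite -(leq_exp2l _ _ p_gt1) -cE.
apply: leq_trans (card_frob_roots _); last by rewrite gcdn_gt0 e0.
apply: subset_leq_card; apply/subsetP=> x xE; rewrite inE frob_gcd ?hj //.
by rewrite -cE subfield_pow.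
Qed.

End Subfields.

Section Annihilator.
Variables (F : finFieldType) (p k : nat).
Hypothesis charF : p \in [pchar F].
Local Notation kap := (p ^ k)%N.

(** If [ev] kills [bs], then [ev^kap - ev(b)^(kap-1) ev] kills [b] as well. *)
Lemma annihilator (bs : seq F) : exists M : nat -> F, [/\ M (size bs) = 1,
  forall l, (size bs < l)%N -> M l = 0 &
  {in bs, forall b, \sum_(l < (size bs).+1) M l * b ^+ (kap ^ l) = 0}].
Proof.
have k0 : (0 < kap)%N := expp_gt0 charF k.
elim: bs => [|b bs [M [M1 M0 Mb]]] /=.
  exists (fun l => if l is 0 then 1 else 0); split=> // l; by case: l.
set s := size bs in M1 M0 Mb *.
pose ev x := \sum_(l < s.+1) M l * x ^+ (kap ^ l).
pose a := ev b ^+ (kap - 1).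
exists (fun l => (if l is l'.+1 then M l' ^+ kap else 0) - a * M l); split=> /=.
- by rewrite M1 M0 // mulr0 subr0 expr1n.
- by case=> // l; rewrite ltnS => h; rewrite !M0 ?(leqW h) // expr0n gtn_eqF // mulr0 subr0.
have H x : \sum_(l < s.+2) ((if (l : nat) is l'.+1 then M l' ^+ kap else 0 : F) - a * M l)
    * x ^+ (kap ^ l) = ev x ^+ kap - a * ev x.
  under eq_bigr do rewrite mulrBl; rewrite sumrB big_ord_recl mul0r add0r; congr (_ - _).
    rewrite (exprp_sum charF); apply: eq_bigr => l _.
    by rewrite exprMn -exprM -expnSr.
  rewrite big_ord_recr /= M0 // mulr0 mul0r addr0 mulr_sumr.
  by apply: eq_bigr => l _; rewrite mulrA.
move=> x; rewrite inE H => /predU1P[->|/Mb e]; last first.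
  by rewrite /ev e expr0n gtn_eqF // mulr0 subr0.
by rewrite /a -exprSr subn1 prednK // subrr.
Qed.

End Annihilator.

(** * The two cases of the theorem *)

Section Numeric.

Lemma far_degree R Y v : (3 < R)%N -> (0 < Y)%N -> (1 < v)%N ->
  (R <= v * (R * R * Y))%N /\
  (R * R * (R * R * Y) < (v * (R * R * Y) - R) * (v * (R * R * Y) - R))%N.
Proof.
move=> R4 Y0 v1.
have [W eW] : exists W, (v * (R * R * Y) = R + W)%N /\ (R * R * Y < W)%N.
  have : (2 * (R * R * Y) <= v * (R * R * Y))%N by rewrite leq_mul2r v1 orbT.
  have : (R * 4 <= R * (R * Y))%N by rewrite leq_mul2l (leq_trans R4) ?orbT // leq_pmulr.
  rewrite mulnA; exists (v * (R * R * Y) - R)%N; lia.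
case: eW => -> lW; rewrite leq_addr addKn; split=> //.
apply: leq_trans (ltn_mul lW lW).
by rewrite ltnS; apply: leq_mul => //; rewrite leq_pmulr.
Qed.

(** Writing [n = h k], the assumption [Q^4 <= v^2 q] with [v < kap] forces [h >= 4m - 1]. The
    conclusion is the squared form of [Q^2 (p^(n/2) + 1) < v q]. *)
Lemma not_power_degree p k m n v : (1 < p)%N -> (0 < k)%N -> (1 < m)%N -> (k %| n)%N ->
    (m * k <= n)%N -> (1 < v)%N -> (v %| p ^ k - 1)%N ->
    (p ^ (m * k) * p ^ (m * k) * (p ^ (m * k) * p ^ (m * k)) <= v * v * p ^ n)%N ->
  let R := (p ^ (m * k) * p ^ (m * k))%N in
  (R <= v * p ^ n)%N /\ (R * R * p ^ n < (v * p ^ n - R) * (v * p ^ n - R))%N.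
Proof.
move=> p1 k0 m1 /dvdnP[h ->] mk v1 vd; cbv zeta.
set kap := (p ^ k)%N in vd.
have kap1 : (1 < kap)%N by rewrite -(expn0 p) ltn_exp2l.
have E j : (p ^ (j * k) = kap ^ j)%N by rewrite mulnC expnM.
have -> : (p ^ (m * k) * p ^ (m * k) = kap ^ (2 * m))%N.
  by rewrite E -expnD addnn mul2n.
rewrite E => hv; rewrite -expnD in hv.
have vk : (v < kap)%N.
  by apply: leq_ltn_trans (dvdn_leq _ vd) _; rewrite ?subn_gt0 ?subn1 ?ltn_predL // ltnW.
have vv : (v * v < kap ^ 2)%N by rewrite -mulnn ltn_mul.
have hm : (2 * m + 2 * m < h + 2)%N.
  rewrite -(ltn_exp2l _ _ kap1); apply: leq_ltn_trans hv _.
  by rewrite mulnC [X in (_ < X)%N]expnD ltn_pmul2l // expn_gt0 ltnW.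
have R0 : (0 < kap ^ (2 * m))%N by rewrite expn_gt0 ltnW.
have [h1|h1] := leqP (2 * m + 2 * m) h.
  have [y eh] : exists y, (h = 2 * m + 2 * m + y)%N by exists (h - (2 * m + 2 * m))%N; lia.
  have R4 : (4 <= kap ^ (2 * m))%N.
    apply: (@leq_trans (2 ^ (2 * m))); last by rewrite leq_exp2r // muln_gt0 (ltnW m1).
    by rewrite (@leq_exp2l 2 2) // -{1}[2%N]muln1 leq_mul2l ltnW.
  have Y0 : (0 < kap ^ y)%N by rewrite expn_gt0 ltnW.
  have -> : (kap ^ h = kap ^ (2 * m) * kap ^ (2 * m) * kap ^ y)%N by rewrite eh !expnD.
  exact: far_degree.
have eh : (kap ^ h * kap = kap ^ (2 * m) * kap ^ (2 * m))%N.
  by rewrite -expnSr -expnD; congr (_ ^ _)%N; move: hm h1; clear; lia.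
have R4 : (kap * kap * (kap * kap) <= kap ^ (2 * m))%N.
  rewrite !mulnn -expnM leq_exp2l //; move: m1; clear; lia.
(* In the boundary case [h = 4m - 1] strictness matters: [v^2 = kap] is impossible because [v]
   divides [kap - 1]. *)
have vk2 : (kap < v * v)%N.
  have hk : (kap <= v * v)%N.
    have h0 : (0 < kap ^ h)%N by rewrite expn_gt0 ltnW.
    rewrite -(leq_pmul2r h0) mulnC eh.
    by rewrite -expnD.
  rewrite ltn_neqAle hk andbT; apply/eqP => ek.
  have : (v %| kap - (kap - 1))%N by rewrite dvdn_sub // ek dvdn_mulr.
  by rewrite subKn ?(ltnW kap1) // dvdn1 gtn_eqF.
move: (kap ^ (2 * m))%N (kap ^ h)%N eh R4 vk2 vk R0 kap1; clear => R q eR R4 vk2 vk R0 k1.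
have R1 : (2 * (kap * kap) <= R)%N.
  by apply: leq_trans R4; rewrite leq_mul2r (leq_trans k1) ?orbT // leq_pmulr // ltnW.
have q2 : (2 * (v * R) <= q)%N.
  rewrite -(leq_pmul2r (ltnW k1)) eR.
  have -> : (2 * (v * R) * kap = 2 * (v * kap) * R)%N by ring.
  by rewrite leq_mul2r (leq_trans _ R1) ?orbT // leq_mul2l leq_mul2r (ltnW vk) orbT.
have vR : (R <= v * q)%N.
  apply: leq_trans (leq_pmull q _); last by case: (v) vk2.
  apply: leq_trans q2; rewrite mulnA leq_pmull // muln_gt0; by case: (v) vk2.
split=> //; have [W eW] : exists W, (v * q = R + W)%N by exists (v * q - R)%N; rewrite subnKC.
rewrite eW addKn.
have h1 : (R * R * q + q * q <= (R + W) * (R + W))%N.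
  rewrite -eW -eR mulnACA [(q * kap * q)%N]mulnAC -[X in (_ + X <= _)%N]muln1 -mulnDr addn1.
  by rewrite mulnC leq_mul2r vk2 orbT.
have h2 : (2 * R * (R + W) <= q * q)%N.
  by rewrite -eW mulnA leq_mul2r -mulnA [(R * v)%N]mulnC q2 orbT.
have : (0 < R * R)%N by rewrite muln_gt0 R0.
move: h1 h2; rewrite !mulnDr !mulnDl -!mulnA [(W * R)%N]mulnC;
  move: (R * R)%N (R * W)%N (W * W)%N (q * q)%N (R * (R * q))%N.
by clear; lia.
Qed.

(** The case [n = 3e] with [kap = p^e] and [t] large; after squaring it reduces to
    [kap^3 <= (t kap - 1)^2]. *)
Lemma near_degree kap t : (4 < kap)%N -> (kap + 3 <= 3 * t)%N ->
  (kap * kap <= t * kap ^ 3)%N /\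
  (kap * kap * (kap * kap) * kap ^ 3 <=
    (t * kap ^ 3 - kap * kap) * (t * kap ^ 3 - kap * kap))%N.
Proof.
move=> k4 ht; have [W eW] : exists W, (t * kap = 1 + W)%N.
  by exists (t * kap - 1)%N; rewrite subnKC // muln_gt0; case: (t) (kap) ht k4 => [|a] [|b].
have -> : (t * kap ^ 3 = kap * kap + kap * kap * W)%N.
  have -> : (t * kap ^ 3 = t * kap * (kap * kap))%N by rewrite !expnS expn0 muln1 -!mulnA.
  by rewrite eW mulnDl mul1n [(W * _)%N]mulnC.
rewrite leq_addr addKn; split=> //.
have hW : (kap ^ 3 <= W * W)%N.
  have hW3 : (kap * kap + 3 * kap <= 3 * W + 3)%N.
    have : (kap * (kap + 3) <= kap * (3 * t))%N by rewrite leq_mul2l ht orbT.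
    by rewrite mulnDr mulnCA [(kap * t)%N]mulnC eW [(kap * 3)%N]mulnC; clear; lia.
  have [j ej] : exists j, kap = (j + 5)%N by exists (kap - 5)%N; rewrite subnK.
  have h9 : (9 * kap ^ 3 <= (kap * kap + 3 * kap - 3) * (kap * kap + 3 * kap - 3))%N.
    have [x ex] : exists x, (kap * kap + 3 * kap = x + 3)%N by exists (j * j + 13 * j + 37)%N;
      rewrite ej; ring.
    have -> : (kap * kap + 3 * kap - 3 = j * j + 13 * j + 37)%N.
      by apply: (@addIn 3); rewrite subnK ?ex ?leq_addl // -ex ej; ring.
    have -> : (9 * kap ^ 3 = 9 * (j * (j * j) + 15 * (j * j) + 75 * j + 125))%N.
      by rewrite ej !expnS expn0; ring.
    have -> : ((j * j + 13 * j + 37) * (j * j + 13 * j + 37) =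
      j * j * (j * j) + 26 * (j * (j * j)) + 243 * (j * j) + 962 * j + 1369)%N by ring.
    by move: (j * j * (j * j))%N (j * (j * j))%N (j * j)%N; clear; lia.
  have h3 : (kap * kap + 3 * kap - 3 <= 3 * W)%N by move: hW3; clear; lia.
  rewrite -(leq_pmul2l (isT : (0 < 9)%N)); apply: leq_trans h9 _.
  have -> : (9 * (W * W) = 3 * W * (3 * W))%N by ring.
  exact: leq_mul.
by rewrite [leqRHS]mulnACA leq_mul2l hW orbT.
Qed.

Lemma real_degree (R : realType) (X : R) (A B q : nat) : 0 <= X -> X ^+ 2 = q%:R ->
  (A <= B)%N -> (A * A * q < (B - A) * (B - A))%N -> A%:R * (X + 1) < B%:R.
Proof.
move=> X0 X2 AB h; rewrite mulrDr mulr1 -ltrBrDr ltNge; apply/negP => h2.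
move: h; rewrite ltnNge => /negP; apply; rewrite -(ler_nat R) !natrM natrB // -X2.
have BA : 0 <= B%:R - A%:R :> R by rewrite subr_ge0 ler_nat.
have := ler_pM BA BA h2 h2; rewrite mulrACA expr2; exact.
Qed.

Lemma real_degree_le (R : realType) (X : R) (A B q : nat) : 0 <= X -> X ^+ 2 = q%:R ->
  (A <= B)%N -> (A * A * q <= (B - A) * (B - A))%N -> A%:R * (X + 1) <= B%:R.
Proof.
move=> X0 X2 AB h; rewrite mulrDr mulr1 -lerBrDr leNgt; apply/negP => h2.
move: h; rewrite leqNgt => /negP; apply; rewrite -(ltr_nat R) !natrM natrB // -X2.
have BA : 0 <= B%:R - A%:R :> R by rewrite subr_ge0 ler_nat.
have := ltr_pM BA BA h2 h2; rewrite mulrACA expr2; exact.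
Qed.

Lemma cancel_degree (R : realType) (X : R) (Q G v d : nat) : (0 < Q)%N -> (v * G <= d)%N ->
  ((Q * Q)%:R * (X + 1) < (v * (G * Q))%:R -> (X + 1) * Q%:R < d%:R) /\
  ((Q * Q)%:R * (X + 1) <= (v * (G * Q))%:R -> (X + 1) * Q%:R <= d%:R).
Proof.
move=> Q0 vd; have Q1 : 0 < Q%:R :> R by rewrite ltr0n.
have h : (v * (G * Q))%:R <= d%:R * Q%:R :> R by rewrite -natrM ler_nat mulnA leq_mul2r vd orbT.
have e : (Q * Q)%:R * (X + 1) = (X + 1) * Q%:R * Q%:R by rewrite natrM mulrC mulrA.
split=> h2; first by rewrite -(ltr_pM2r Q1) -e (lt_le_trans h2 h).
by rewrite -(ler_pM2r Q1) -e (le_trans h2 h).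
Qed.

End Numeric.

(** * The case where [U] is not a field *)

Section NotField.
Variables (F : finFieldType) (p n k v m : nat) (S : {set F}) (M : nat -> F).
Local Notation q := (p ^ n)%N.
Local Notation kap := (p ^ k)%N.
Local Notation Q := (p ^ (m * k))%N.
Hypotheses (p_prime : prime p) (cardF : #|F| = q) (k_gt0 : (0 < k)%N).
Hypotheses (m_gt0 : (0 < m)%N) (v_gt1 : (1 < v)%N) (v_dvd : (v %| kap - 1)%N).
Hypotheses (k_dvd : (k %| n)%N) (cardS : #|S| = Q) (S0 : 0 \in S) (S1 : 1 \in S).
Hypothesis Szeta : forall z u, z ^+ v = 1 -> u \in S -> z * u \in S.
Hypotheses (Mm : M m = 1).
Hypothesis M_S : {in S, forall u, \sum_(l < m.+1) M l * u ^+ (kap ^ l) = 0}.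
Hypothesis Sv_gt2 : (2 < #|powset S v|)%N.
Hypothesis not_field : ~ is_subfield S.

Let charF : p \in [pchar F] := card_finPcharP cardF p_prime.
Let v_gt0 : (0 < v)%N := ltnW v_gt1.

(** Otherwise the annihilator is [M_0 u + u^Q]; its value at 1 gives [M_0 = -1], so [S] is the set
    of fixed points of [u -> u^Q], a field. *)
Lemma annihilator_mid : exists2 j, (0 < j < m)%N & M j != 0.
Proof.
have [h|h] := boolP [exists j : 'I_m, (0 < (j : nat))%N && (M j != 0)].
  by case/existsP: h => j /andP[j0 Mj]; exists j; rewrite ?j0 ?ltn_ord.
exfalso; apply: not_field.
have {}h j : (0 < j < m)%N -> M j = 0.
  case/andP=> j0 jm; apply/eqP/negPn/negP => Mj; case/negP: h.
  by apply/existsP; exists (Ordinal jm); rewrite j0.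
have e u : u \in S -> M 0%N * u + u ^+ Q = 0.
  move=> uS; rewrite -[RHS](M_S uS) big_ord_recr /= Mm mul1r -(Q_kap p k m); congr (_ + _).
  move: m_gt0 h; clear; case: (m) => // m' _ h.
  rewrite big_ord_recl expn0 expr1 big1 ?addr0 // => i _.
  by rewrite h ?mul0r //= ltnS ltn_ord.
have M0 : M 0%N = -1.
  by apply/eqP; rewrite -addr_eq0; have := e 1 S1; rewrite mulr1 expr1n => /eqP.
suff -> : S = [set x | x ^+ Q == x] by exact: (frob_subfield p_prime cardF).
apply/eqP; rewrite eqEcard cardS (card_frob_roots F p_prime) ?muln_gt0 ?m_gt0 // andbT.
apply/subsetP=> u uS; rewrite inE; have := e u uS.
by rewrite M0 mulN1r addrC => /eqP; rewrite subr_eq0.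
Qed.

Lemma not_field_dim : (1 < m)%N.
Proof. by have [j /andP[j0 jm] _] := annihilator_mid; apply: leq_ltn_trans jm. Qed.

Let r_gt1 : (1 < rho p k v m)%N.
Proof. by move: Sv_gt2; rewrite (card_Sv charF k_gt0 v_gt0 v_dvd cardS S0 Mm M_S). Qed.

Lemma not_field_power P : mvsps (powset S v) P -> (v * v * q < Q * Q * (Q * Q))%N ->
  mvsps_pow S v P.
Proof.
move=> hP; exact: (mvsp_power_m2 charF cardF k_gt0 m_gt0 v_gt0 v_dvd k_dvd cardS S0 Szeta Mm M_S
  r_gt1 hP (or_introl not_field_dim) not_field_dim v_gt1 annihilator_mid).
Qed.

Lemma not_field_degree P : mvsps (powset S v) P -> (v * p ^ (n - m * k) <= deg P)%N.
Proof.
move=> hP; exact: (mvsp_degree_lower charF cardF k_gt0 m_gt0 v_gt0 v_dvd cardS S0 Mm M_S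
  r_gt1 hP (or_introl not_field_dim)).
Qed.

Lemma not_field_pow_mvsps P : mvsps_pow S v P -> mvsps (powset S v) P.
Proof. exact: (mvsps_pow_mvsps charF k_gt0 v_gt0 v_dvd cardS S0 Mm M_S). Qed.

End NotField.

(** * The case where [U] is a field, reduced to [F_{p^e}] and the exponent [t] *)

Section IsField.
Variables (F : finFieldType) (p n k v m e : nat) (S E : {set F}).
Local Notation q := (p ^ n)%N.
Local Notation kap := (p ^ k)%N.
Local Notation Q := (p ^ (m * k))%N.
Hypotheses (p_prime : prime p) (cardF : #|F| = q) (k_gt0 : (0 < k)%N).
Hypotheses (m_gt0 : (0 < m)%N) (v_gt0 : (0 < v)%N) (v_dvd : (v %| kap - 1)%N).
Hypotheses (cardS : #|S| = Q) (S_field : is_subfield S).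
Hypothesis Sv_gt2 : (2 < #|powset S v|)%N.
Local Notation Sv := (powset S v).
Local Notation r := (rho p k v m).
Local Notation t := (texp p v m k e).
Hypothesis leastE : least_Fpe_between p Sv S e E.

Let charF : p \in [pchar F] := card_finPcharP cardF p_prime.
Let p_gt1 : (1 < p)%N := prime_gt1 p_prime.
Let p_gt0 : (0 < p)%N := prime_gt0 p_prime.
Let kap1 : (1 < kap)%N := kap_gt1 charF k_gt0.
Let rhM l : (v * rho p k v l + 1 = kap ^ l)%N := rho_mul kap1 v_dvd l.
Let QE : Q = (kap ^ m)%N := Q_kap p k m.
Let rQ : (v * r = Q - 1)%N. Proof. by rewrite QE -rhM addnK. Qed.

Let e_gt0 : (0 < e)%N. Proof. by case: leastE. Qed.
Let E_field : is_subfield E. Proof. by case: leastE => _ []. Qed.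
Let cardE : #|E| = (p ^ e)%N. Proof. by case: leastE => _ []. Qed.
Let SvE : Sv \subset E. Proof. by case: leastE. Qed.
Let ES : E \subset S. Proof. by case: leastE. Qed.

Lemma Sv_root s : s \in Sv -> s != 0 -> s ^+ r = 1.
Proof.
case/imsetP=> u uS -> us0; have u0 : u != 0.
  by apply: contraNneq us0 => ->; rewrite expr0n gtn_eqF.
apply: (mulIf u0); rewrite mul1r -exprM rQ -exprSr subn1 prednK ?expn_gt0 ?p_gt0 //.
by rewrite -cardS subfield_pow.
Qed.

Lemma roots_unity_card (A : {set F}) j : (0 < j)%N -> {in A, forall x, x ^+ j = 1} -> (#|A| <= j)%N.
Proof.
move=> j0 hA; have dX : deg ('X^j - 1 : {poly F}) = j.
  by rewrite degDl ?degN ?degXn // -[1]/(1%:P) degC.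
rewrite -[leqRHS]dX; apply: root_count => [|x xA].
  by apply: contraTneq j0 => h; rewrite -dX h deg0.
by rewrite rootE !hornerE hA // subrr.
Qed.

Let r_gt0 : (0 < r)%N. Proof. exact: (rho_gt0 kap1 v_gt0 v_dvd). Qed.

Let Sv0 : 0 \in Sv.
Proof. by apply/imsetP; exists 0; rewrite ?subfield0 // expr0n gtn_eqF. Qed.

Lemma field_card_Sv : #|Sv| = r.+1.
Proof.
rewrite (cardsD1 0) Sv0 add1n; congr _.+1; apply/eqP; rewrite eqn_leq; apply/andP; split.
  by apply: roots_unity_card => // x; rewrite !inE => /andP[x0 xS]; apply: Sv_root.
have := powset_card_lower v_gt0 (subfield0 S_field); rewrite cardS -rQ leq_pmul2l //.
by rewrite (cardsD1 0 Sv) Sv0 addKn.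
Qed.

Let r_gt1 : (1 < r)%N. Proof. by move: Sv_gt2; rewrite field_card_Sv. Qed.

Lemma Sv_exp_dvd j : (0 < j)%N -> {in Sv, forall s, s != 0 -> s ^+ j = 1} -> (r %| j)%N.
Proof.
move=> j0 hj; have g0 : (0 < gcdn r j)%N by rewrite gcdn_gt0 r_gt0.
suff h : (r <= gcdn r j)%N.
  suff <- : gcdn r j = r by exact: dvdn_gcdr.
  by apply/eqP; rewrite eqn_leq h dvdn_leq // dvdn_gcdl.
have c : #|Sv :\ 0| = r by have := field_card_Sv; rewrite (cardsD1 0) Sv0 add1n => -[].
rewrite -[leqLHS]c; apply: roots_unity_card => // s; rewrite !inE => /andP[s0 sS].
have [u w eg _] := egcdnP j r_gt0.
have : s ^+ (u * r) = 1 by rewrite mulnC exprM Sv_root // expr1n.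
by rewrite eg exprD mulnC exprM hj // expr1n mul1r.
Qed.

Lemma Sv_frob_dvd i : (0 < i)%N -> {in Sv, forall s, s ^+ (p ^ i) = s} -> (r %| p ^ i - 1)%N.
Proof.
move=> i0 h; have pi : (1 < p ^ i)%N by rewrite -(expn0 p) ltn_exp2l.
apply: Sv_exp_dvd => [|s sS s0]; first by rewrite subn_gt0.
by apply: (mulIf s0); rewrite -exprSr subn1 prednK ?h ?mul1r // ltnW.
Qed.

Let frobE x : x \in E -> x ^+ (p ^ e) = x.
Proof. by move=> xE; rewrite -cardE subfield_pow. Qed.

Let frobEP x : x ^+ (p ^ e) = x -> x \in E.
Proof. by move=> h; rewrite (subfieldE p_prime E_field cardE) inE h. Qed.

(** The nonzero elements of [S^v] are the [r]-th roots of unity, [r = (Q - 1) / v]. They lie in [E],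
    so [r] divides [p^e - 1]. *)
Lemma texp_mul : (t * r = p ^ e - 1)%N.
Proof.
have h : (r %| p ^ e - 1)%N.
  by apply: Sv_frob_dvd => // s sS; apply: frobE; apply: (subsetP SvE).
by rewrite /texp -rQ divnMl // divnK.
Qed.

Let pe1 : (1 < p ^ e)%N. Proof. by rewrite -(expn0 p) ltn_exp2l. Qed.

Lemma texp_gt0 : (0 < t)%N.
Proof. by have := pe1; rewrite -subn_gt0 -texp_mul muln_gt0 => /andP[]. Qed.

Let t_dvd : (t %| p ^ e - 1)%N. Proof. by rewrite -texp_mul dvdn_mulr. Qed.

Let rho_t : rho p e t 1 = r.
Proof. by rewrite /rho expn1 -texp_mul mulKn // texp_gt0. Qed.

(** Both sets consist of 0 and the [r]-th roots of unity; this lets [E] and [t] replace [S] and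
    [v]. *)
Lemma powset_E : powset E t = Sv.
Proof.
apply/eqP; rewrite eqEcard; apply/andP; split; last first.
  have := powset_card_lower texp_gt0 (subfield0 E_field).
  rewrite cardE -texp_mul leq_pmul2l ?texp_gt0 // field_card_Sv.
  have : (0 < #|powset E t|)%N by apply/card_gt0P; exists (1 ^+ t); apply: imset_f; case: E_field.
  by case: #|powset E t| => // y _; rewrite subn1.
have eR : Sv :\ 0 = [set x | x ^+ r == 1].
  apply/eqP; rewrite eqEcard; apply/andP; split.
    by apply/subsetP=> s; rewrite !inE => /andP[s0 sS]; rewrite Sv_root.
  have -> : #|Sv :\ 0| = r by have := field_card_Sv; rewrite (cardsD1 0) Sv0 add1n => -[].
  by apply: roots_unity_card => // x; rewrite inE => /eqP.
apply/subsetP=> _ /imsetP[x xE ->]; have [->|x0] := eqVneq x 0.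
  by rewrite expr0n gtn_eqF // texp_gt0.
suff : x ^+ t \in Sv :\ 0 by rewrite !inE => /andP[].
rewrite eR inE -exprM texp_mul; apply/eqP; apply: (mulIf x0).
by rewrite -exprSr subn1 prednK ?frobE ?mul1r // ltnW.
Qed.

(** If [r] divided [p^i - 1], then [S^v] would lie in the subfield of [E] fixed by [x -> x^(p^i)],
    of order at most [p^i], against the minimality of [e]. *)
Lemma least_ndvd i : (0 < i < e)%N -> ~~ (rho p e t 1 %| p ^ i - 1)%N.
Proof.
case/andP=> i0 ie; rewrite rho_t; apply/negP => ri.
have hS : {in Sv, forall s, s ^+ (p ^ i) = s}.
  move=> s sS; have [->|s0] := eqVneq s 0; first by rewrite expr0n gtn_eqF // expn_gt0 p_gt0.
  case/dvdnP: ri => j ej.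
  by rewrite -(subnK (_ : 0 < p ^ i)%N) ?expn_gt0 ?p_gt0 // addn1 exprS ej mulnC exprM Sv_root //
    expr1n mulr1.
pose E' := E :&: [set x | x ^+ (p ^ i) == x].
have E'f : is_subfield E' by apply: subfieldI => //; exact: (frob_subfield p_prime cardF).
have [e' e'0 ce'] := subfield_card p_prime cardF E'f.
have : (p ^ e' <= p ^ i)%N.
  rewrite -ce'; apply: leq_trans (card_frob_roots F p_prime i0).
  by apply: subset_leq_card; apply: subsetIr.
rewrite leq_exp2l // leqNgt => /negP; apply; apply: leq_trans ie _.
case: leastE => _ _ _ _ /(_ e' E'); apply=> //.
  by rewrite subsetI SvE; apply/subsetP => s /hS; rewrite inE => ->.
by apply: subset_trans ES; apply: subsetIl.
Qed.

Lemma field_e_dvd : (e %| n)%N.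
Proof.
apply: (subfield_exp_dvd p_prime E_field cardE e_gt0) => x _.
by rewrite -cardF expf_card.
Qed.

Lemma field_e_dvd_S : (e %| m * k)%N.
Proof.
apply: (subfield_exp_dvd p_prime E_field cardE e_gt0) => x xE.
by rewrite -cardS subfield_pow // (subsetP ES).
Qed.

Let Ezeta z u : z ^+ t = 1 -> u \in E -> z * u \in E.
Proof.
move=> zt uE; apply: subfieldM => //; apply: frobEP.
rewrite -(subnK (ltnW pe1)) addn1 exprS -texp_mul exprM zt expr1n mulr1 //.
Qed.

Let M (l : nat) : F := if l is 0 then -1 else 1.

Let M_E : {in E, forall u, \sum_(l < 2) M l * u ^+ ((p ^ e) ^ l) = 0}.
Proof.
move=> u uE; rewrite !big_ord_recl big_ord0 /= expn0 expn1 frobE //.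
by rewrite expr1 mulN1r mul1r addr0 addNr.
Qed.

Let cardE1 : #|E| = (p ^ (1 * e))%N. Proof. by rewrite mul1n. Qed.

Let r_gt1' : (1 < rho p e t 1)%N. Proof. by rewrite rho_t. Qed.

Lemma field_pow_mvsps P : mvsps_pow E t P -> mvsps Sv P.
Proof.
rewrite -powset_E.
exact: (mvsps_pow_mvsps (M := M) charF e_gt0 texp_gt0 t_dvd cardE1 (subfield0 E_field) erefl M_E).
Qed.

Section FieldMvsp.
Variable P : {poly F}.
Hypothesis hP : mvsps Sv P.
Let hP' : mvsps (powset E t) P. Proof. by rewrite powset_E. Qed.

Lemma field_degree : (t * p ^ (n - e) <= deg P)%N.
Proof.
rewrite -{2}[e]mul1n.
exact: (mvsp_degree_lower (M := M) charF cardF e_gt0 (ltnSn 0) texp_gt0 t_dvd cardE1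
  (subfield0 E_field) erefl M_E r_gt1' hP' (or_intror (conj erefl (conj r_gt1' least_ndvd)))).
Qed.

Lemma texp1_power : t = 1%N -> mvsps_pow E t P.
Proof.
move=> t1; exists P; last by rewrite t1 expr1.
suff <- : powset E t = E by [].
by rewrite t1 /powset (eq_imset _ (fun x : F => expr1 x)) imset_id.
Qed.

Lemma field_power : n = e \/ n = (2 * e)%N \/ n = (3 * e)%N /\ (3 * t < p ^ e + 3)%N ->
  mvsps_pow E t P.
Proof.
move=> hn; have := texp_gt0; rewrite leq_eqVlt => /predU1P[/esym/texp1_power //|t1].
exact: (mvsp_power_m1 (M := M) charF cardF e_gt0 (ltnSn 0) texp_gt0 t_dvd field_e_dvd cardE1
  (subfield0 E_field) Ezeta erefl M_E r_gt1' hP'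
  (or_intror (conj erefl (conj r_gt1' least_ndvd))) erefl t1 least_ndvd hn).
Qed.

End FieldMvsp.

(** By minimality a subfield [S^v] would have at least [p^e = t r + 1] elements, more than
    [r + 1]. *)
Lemma Sv_not_field : (1 < t)%N -> ~ is_subfield Sv.
Proof.
move=> t1 Svf; have [e' e'0 ce'] := subfield_card p_prime cardF Svf.
have : (e <= e')%N.
  case: leastE => _ _ _ _ /(_ e' Sv); apply=> //.
  exact: subset_trans SvE ES.
rewrite -(leq_exp2l _ _ p_gt1) -ce' field_card_Sv.
have := texp_mul; have := pe1; have : (2 * r <= t * r)%N by rewrite leq_mul2r t1 orbT.
by move: r_gt1; clear; lia.
Qed.

Lemma field_rt : (1 < r)%N /\ (t * r + 1 = p ^ e)%N.
Proof. by split=> //; rewrite texp_mul subnK // ltnW. Qed.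

End IsField.

(** * Vector spaces as instances of the set [S] *)

Section VspaceSet.
Variables (p n k v m : nat) (K : finFieldType) (L : fieldExtType K) (U : {vspace L}).
Hypotheses (p_prime : prime p) (cardL : #|finvect_type L| = (p ^ n)%N) (k_gt0 : (0 < k)%N).
Hypotheses (cardK : #|K| = (p ^ k)%N) (v_dvd : (v %| p ^ k - 1)%N).
Hypotheses (dimU : (\dim U)%VS = m) (U1 : 1 \in U).
Local Notation US := (vspace_set U).

Lemma card_vspace_set : #|US| = (p ^ (m * k))%N.
Proof. by rewrite cardsE card_vspace cardK dimU mulnC expnM. Qed.

Lemma dim_gt0 : (0 < m)%N.
Proof.
rewrite -dimU lt0n dimv_eq0; apply: contraTneq U1 => ->.
by rewrite memv0 oner_eq0.
Qed.

Lemma vspace_set0 : 0 \in US. Proof. by rewrite inE mem0v. Qed.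
Lemma vspace_set1 : 1 \in US. Proof. by rewrite inE. Qed.

(** As [v] divides [#|K| - 1], the [v]-th roots of unity are scalars from [K]. *)
Lemma vspace_set_zeta (z u : finvect_type L) : z ^+ v = 1 -> u \in US -> z * u \in US.
Proof.
rewrite !inE => zv uU.
have zk : (z : L) \in (1%VS : {vspace L}).
  rewrite (Fermat's_little_theorem 1%AS) dimv1 expn1 cardK.
  have k1 : (0 < p ^ k)%N by rewrite expn_gt0 prime_gt0.
  rewrite -(subnK k1) addn1 exprS; case/dvdnP: v_dvd => j ->.
  by rewrite mulnC exprM zv expr1n mulr1.
case/vlineP: zk => c ->; rewrite mulr_algl; exact: memvZ.
Qed.

(** An additive polynomial in powers of [kap = #|K|] is [K]-linear, so it is enough that it kills a
    basis. *)
Lemma vspace_annihilator : exists M : nat -> finvect_type L, M m = 1 /\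
  {in US, forall u, \sum_(l < m.+1) M l * u ^+ ((p ^ k) ^ l) = 0}.
Proof.
have charF : p \in [pchar finvect_type L] := card_finPcharP cardL p_prime.
pose bs : seq (finvect_type L) := vbasis U.
have sbs : size bs = m by rewrite size_tuple.
have [M [M1 _ Mb]] := annihilator k charF bs.
rewrite sbs in M1 Mb; exists M; split=> // u; rewrite inE => uU.
pose ev (x : finvect_type L) := \sum_(l < m.+1) M l * x ^+ ((p ^ k) ^ l).
have kE l : ((p ^ k) ^ l = p ^ (k * l))%N by rewrite expnM.
have evD x y : ev (x + y) = ev x + ev y.
  by rewrite -big_split; apply: eq_bigr => l _; rewrite kE (exprDp charF) mulrDr.
have evZ (c : K) (x : L) : ev (c *: x) = (c *: (ev x : L)).
  rewrite scaler_sumr; apply: eq_bigr => l _.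
  have -> : (c *: x : finvect_type L) ^+ ((p ^ k) ^ l) = c *: (x ^+ ((p ^ k) ^ l) : L).
    rewrite exprZn; congr (_ *: _); elim: (l : nat) => [|j IH]; first by rewrite expr1.
    by rewrite expnSr exprM IH -cardK expf_card.
  by rewrite -scalerAr.
rewrite -/(ev u) (coord_vbasis uU); apply: (big_ind (fun x => ev x = 0)) => [|x y hx hy|i _].
- by rewrite /ev big1 // => l _; rewrite expr0n gtn_eqF ?mulr0 // !expn_gt0 prime_gt0.
- by rewrite evD hx hy addr0.
by rewrite evZ /ev Mb ?scaler0 // /bs mem_nth // size_tuple.
Qed.

End VspaceSet.

(** * Conditions (a) and (b) imply the power regime *)

Section Ranges.
Variables (p n : nat).
Hypothesis p_gt1 : (1 < p)%N.
Let p_gt0 : (0 < p)%N := ltnW p_gt1.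

(** The squared condition (a) is multiplied by [v^2] and combined with [p v (r + 1) <= Q^2]. *)
Lemma not_field_range_a k m v r : (0 < k)%N -> (1 < m)%N -> (0 < v)%N -> (v <= p ^ k - 1)%N ->
    (v * r + 1 = p ^ (m * k))%N -> (p ^ n < p * p * ((r + 1) * (r + 1)))%N ->
  (v * v * p ^ n < p ^ (m * k) * p ^ (m * k) * (p ^ (m * k) * p ^ (m * k)))%N.
Proof.
move=> k0 m1 v0 vk rQ hq; set Q := (p ^ (m * k))%N in rQ *.
have pk : (p <= p ^ k)%N by rewrite -{1}(expn1 p) leq_exp2l.
have kQ : (p ^ k * p ^ k <= Q)%N by rewrite -expnD leq_exp2l // addnn -mul2n leq_mul2r m1 orbT.
have h : (p * (v * (r + 1)) <= Q * Q)%N.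
  apply: (@leq_trans (p ^ k * (2 * Q))); last first.
    rewrite mulnA [(_ * 2)%N]mulnC -mulnA mulnA leq_mul2r; apply/orP; right.
    apply: leq_trans kQ; rewrite leq_mul2r (leq_trans p_gt1) ?orbT //.
  apply: leq_mul => //; have : (p ^ k <= p ^ k * p ^ k)%N by rewrite leq_pmulr // expn_gt0 p_gt0.
  by move: vk rQ kQ; rewrite mulnDr muln1; clear; lia.
apply: leq_trans (leq_mul h h).
have -> : (p * (v * (r + 1)) * (p * (v * (r + 1))) = v * v * (p * p * ((r + 1) * (r + 1))))%N by
  ring.
by rewrite ltn_pmul2l // muln_gt0 v0.
Qed.

Lemma not_field_range_b k m v : (0 < k)%N -> (1 < m)%N -> (0 < v)%N -> (v <= p ^ k - 1)%N ->
    (n + 2 * k <= 4 * m * k)%N ->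
  (v * v * p ^ n < p ^ (m * k) * p ^ (m * k) * (p ^ (m * k) * p ^ (m * k)))%N.
Proof.
move=> k0 m1 v0 vk hn; have k1 : (0 < p ^ k)%N by rewrite expn_gt0 p_gt0.
apply: (@leq_trans (p ^ k * p ^ k * p ^ n)).
  have vk' : (v < p ^ k)%N by move: vk k1; clear; lia.
  by rewrite ltn_pmul2r ?expn_gt0 ?p_gt0 // ltn_mul.
by rewrite -!expnD leq_exp2l //; move: hn; rewrite -mulnA; clear; lia.
Qed.

(** Since [r + 1 < p^e], condition (a) gives [n < 2e + 2]. So [n] is [e] or [2e], except for
    [e = 1], [n = 3], where [p < (r + 1)^2] yields the bound on [t]. *)
Lemma field_range_a e t r : (0 < e)%N -> (0 < n)%N -> (e %| n)%N -> (1 < t)%N -> (1 < r)%N ->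
    (t * r + 1 = p ^ e)%N -> (p ^ n < p * p * ((r + 1) * (r + 1)))%N ->
  n = e \/ n = (2 * e)%N \/ n = (3 * e)%N /\ (3 * t < p ^ e + 3)%N.
Proof.
move=> e0 n0 /dvdnP[h hn] t1 r1 rt hq.
have r_lt : (r + 1 < p ^ e)%N.
  by rewrite -rt ltn_add2r ltn_Pmull // ltnW.
have hn2 : (n < 2 + 2 * e)%N.
  rewrite -(ltn_exp2l _ _ p_gt1) expnD; apply: leq_trans hq _.
  rewrite -mulnn leq_mul2l mul2n -addnn expnD leq_mul ?orbT // ltnW //.
have [h1|h2] : (h <= 2)%N \/ (h = 3)%N /\ e = 1%N.
  have [|h3] := leqP h 2; first by left.
  right; have : (3 * e <= h * e)%N by rewrite leq_mul2r h3 orbT.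
  move=> he; have e1 : e = 1%N by move: he hn2 e0; rewrite -hn; clear; lia.
  by move: hn2; rewrite hn e1 muln1; move: h3; clear; lia.
  case: h h1 hn => [|[|[|//]]] _ hn; [by rewrite hn in n0|left|right; left] => //.
  by rewrite hn mul1n.
case: h2 => h3 e1; right; right; split; first by rewrite hn h3.
move: rt hq; rewrite hn h3 e1 !muln1 expn1 !expnS expn0 muln1 => rt.
rewrite mulnA ltn_pmul2l ?muln_gt0 ?p_gt0 // => hp.
have [r2|r3] := leqP r 2.
  have er : r = 2%N by move: r1 r2; clear; lia.
  by move: rt hp; rewrite er; clear; lia.
have : (t * 3 <= t * r)%N by rewrite leq_mul2l r3 orbT.
by move: rt; clear; lia.
Qed.

(** A proper divisor [e] of [mk] would give [(r + 1)^2 <= v r + 1], hence [r < v], while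
    [p^(2k) <= v r + 1] gives [v < r]. So [e = mk], [t = v], and (b) makes [n < 4e]. *)
Lemma field_range_b e k m v t r : (0 < e)%N -> (0 < n)%N -> (0 < k)%N -> (1 < m)%N ->
    (0 < v)%N -> (v <= p ^ k - 1)%N -> (v * r + 1 = p ^ (m * k))%N ->
    (e %| n)%N -> (e %| m * k)%N -> (t * r + 1 = p ^ e)%N -> (n + 2 * k <= 4 * m * k)%N ->
  n = e \/ n = (2 * e)%N \/ n = (3 * e)%N /\ (3 * t < p ^ e + 3)%N.
Proof.
move=> e0 n0 k0 m1 v0 vk rQ /dvdnP[h hn] /dvdnP[g hg] rt hnk.
have r0 : (0 < r)%N.
  rewrite lt0n; apply/eqP => r0; move: rQ; rewrite r0 muln0 => /esym/eqP.
  by rewrite gtn_eqF // -(expn0 p) ltn_exp2l // muln_gt0 (ltnW m1).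
have g0 : (0 < g)%N by rewrite lt0n; apply: contraTneq k0 => g0; move: hg m1; rewrite g0; clear;
  lia.
have kQ : (p ^ k * p ^ k <= p ^ (m * k))%N.
  by rewrite -expnD leq_exp2l // addnn -mul2n leq_mul2r m1 orbT.
have g1 : g = 1%N.
  apply/eqP; rewrite eqn_leq g0 andbT leqNgt; apply/negP => g2.
  have he : (e + e <= m * k)%N by rewrite hg addnn -mul2n leq_mul2r g2 orbT.
  have hE : (p ^ e * p ^ e <= p ^ (m * k))%N by rewrite -expnD leq_exp2l.
  have hr : (r + 1 <= p ^ e)%N.
    have : (1 < p ^ e)%N by rewrite -(expn0 p) ltn_exp2l.
    by rewrite -rt leq_add2r; case: (t) => [|t']; rewrite ?mul0n // mulSn leq_addr.
  have := leq_trans (leq_mul hr hr) hE; rewrite -rQ.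
  move: kQ; rewrite -rQ; have := vk; have : (0 < p ^ k)%N by rewrite expn_gt0 p_gt0.
  case: (p ^ k)%N => // x _; rewrite subn1 /= => vx.
  have : (v * r <= x * r)%N by rewrite leq_mul2r vx orbT.
  by move: r0; clear; nia.
have emk : e = (m * k)%N by rewrite hg g1 mul1n.
have tv : t = v.
  apply/eqP; rewrite -(eqn_pmul2r r0) -(eqn_add2r 1) rt rQ emk //.
have h4 : (h < 4)%N.
  rewrite ltnNge; apply/negP => h4.
  have : (4 * (m * k) <= h * (m * k))%N by rewrite leq_mul2r h4 orbT.
  by move: hnk k0; rewrite hn emk mulnA; move: (h * (m * k))%N; clear; lia.
case: h h4 hn => [|[|[|[|//]]]] _ hn; [by rewrite hn in n0|left|right; left|right; right] => //.
  by rewrite hn mul1n.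
split=> //; rewrite tv emk; move: vk kQ; move: (p ^ k)%N (p ^ (m * k))%N => x y; clear; nia.
Qed.

End Ranges.

Section HalfPower.
Variables (R : realType) (p n : nat).
Hypothesis p_gt0 : (0 < p)%N.

Lemma half_power_sqr : (p%:R `^ (n%:R / 2) : R) ^+ 2 = (p ^ n)%:R.
Proof.
rewrite -powR_mulrn ?powR_ge0 // -powRrM mulfVK ?pnatr_eq0 //.
by rewrite powR_mulrn ?ler0n // natrX.
Qed.

Lemma half_power_lt (N : nat) : p%:R `^ (n%:R / 2 - 1) < N%:R :> R -> (p ^ n < p * p * (N * N))%N.
Proof.
have p0 : p%:R != 0 :> R by rewrite pnatr_eq0 -lt0n.
rewrite powRD ?p0 ?implybT // powRN powRr1 ?ler0n // ltr_pdivrMr ?ltr0n // => h.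
rewrite -(ltr_nat R) -half_power_sqr.
have X0 : 0 <= p%:R `^ (n%:R / 2) :> R by rewrite powR_ge0.
have := ltr_pM X0 X0 h h; rewrite -expr2 -!natrM; congr (_ < _%:R).
by rewrite mulnACA mulnC.
Qed.

Lemma half_exponent_le k m : (1 < m)%N -> n%:R / 2 <= (2 * m%:R - 1) * k%:R :> R ->
  (n + 2 * k <= 4 * m * k)%N.
Proof.
move=> m1; rewrite ler_pdivrMr ?ltr0n // -(ler_nat R) natrD !natrM => h.
lra.
Qed.

End HalfPower.

Theorem theorem2p6 (R : realType) (p n k v m : nat)
    (K : finFieldType) (L : fieldExtType K) (U : {vspace L})
    (p_prime : prime p)
    (cardL : #|finvect_type L| = (p ^ n)%N)
    (k_gt0 : (0 < k)%N) (k_dvd_n : (k %| n)%N)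
    (cardK : #|K| = (p ^ k)%N)
    (v_gt1 : (1 < v)%N) (v_dvd : (v %| p ^ k - 1)%N)
    (dimU : (\dim U)%VS = m)
    (cardUv : (2 < #|powset (vspace_set U) v|)%N)
    (U1 : 1 \in U) :
  let US := vspace_set U in
  let Uv := powset US v in
  [/\ (* (i) *)
      ~ is_Fpd p (m * k) US ->
      (1 < m)%N /\
      (forall P : {poly finvect_type L},
         mvsps Uv P -> ~ mvsps_pow US v P ->
         (p%:R `^ (n%:R / 2) + 1) * p%:R ^+ (m * k) < (deg P)%:R :> R),
      (* (ii) *)
      is_Fpd p (m * k) US ->
      forall (e : nat) (E : {set finvect_type L}),
        least_Fpe_between p Uv US e E ->
        let t := texp p v m k e in
        forall P : {poly finvect_type L},
          mvsps Uv P -> ~ mvsps_pow E t P ->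
          [/\ (1 < t)%N,
              ~ is_subfield Uv
            & (p%:R `^ (n%:R / 2) + 1) * p%:R ^+ e <= (deg P)%:R :> R]
    & (* In particular *)
      p%:R `^ (n%:R / 2 - 1) < #|Uv|%:R :> R
        \/ ((1 < m)%N /\ n%:R / 2 <= (2 * m%:R - 1) * k%:R :> R) ->
      (~ is_subfield US ->
         forall P : {poly finvect_type L},
           mvsps Uv P <-> mvsps_pow US v P) /\
      (is_subfield US ->
         forall (e : nat) (E : {set finvect_type L}),
           smallest_field p Uv e E ->
           forall P : {poly finvect_type L},
             mvsps Uv P <-> mvsps_pow E (texp p v m k e) P)].
Proof.
move=> US Uv.
have p_gt1 := prime_gt1 p_prime; have p_gt0 := prime_gt0 p_prime.
have m_gt0 : (0 < m)%N := dim_gt0 dimU U1.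
have v_gt0 : (0 < v)%N := ltnW v_gt1.
have cardS : #|US| = (p ^ (m * k))%N := card_vspace_set cardK dimU.
have S0 : 0 \in US := vspace_set0 U.
have S1 : 1 \in US := vspace_set1 U1.
have Szeta : forall z u : finvect_type L, z ^+ v = 1 -> u \in US -> z * u \in US.
  by move=> z u; apply: (vspace_set_zeta p_prime cardK v_dvd).
have [M [Mm M_S]] := vspace_annihilator p_prime cardL cardK dimU.
have charF := card_finPcharP cardL p_prime.
have cSv : #|Uv| = (rho p k v m).+1 := card_Sv charF k_gt0 v_gt0 v_dvd cardS S0 Mm M_S.
have mk : (m * k <= n)%N := mk_le charF cardL cardS.
have n_gt0 : (0 < n)%N by apply: leq_trans mk; rewrite muln_gt0 m_gt0.
have vk : (v <= p ^ k - 1)%N by apply: dvdn_leq v_dvd; rewrite subn_gt0 -(expn0 p) ltn_exp2l.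
have rQ : (v * rho p k v m + 1 = p ^ (m * k))%N.
  by rewrite (rho_mul _ v_dvd) -?expnM 1?mulnC // -(expn0 p) ltn_exp2l.
pose X : R := p%:R `^ (n%:R / 2).
have X0 : 0 <= X by rewrite powR_ge0.
have X2 : X ^+ 2 = (p ^ n)%:R by apply: half_power_sqr.
have card_field : is_subfield US -> is_Fpd p (m * k) US by [].
have nf := @not_field_power _ p n k v m US M p_prime cardL k_gt0 m_gt0 v_gt1 v_dvd k_dvd_n
  cardS S0 S1 Szeta Mm M_S cardUv.
(* Both conditions in integer form, the first one squared, with [#|Uv| = rho m + 1]. *)
have range : p%:R `^ (n%:R / 2 - 1) < #|Uv|%:R :> R \/
    ((1 < m)%N /\ n%:R / 2 <= (2 * m%:R - 1) * k%:R :> R) ->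
  (p ^ n < p * p * ((rho p k v m + 1) * (rho p k v m + 1)))%N \/
  ((1 < m)%N /\ (n + 2 * k <= 4 * m * k)%N).
  case=> [h|[m1 h]]; last by right; split=> //; apply: half_exponent_le h.
  by left; rewrite addn1 -cSv; apply: half_power_lt h.
split.
- move=> notF; have not_field : ~ is_subfield US by move/card_field.
  have m1 : (1 < m)%N by apply: (not_field_dim p_prime cardL k_gt0 m_gt0 cardS S1 Mm M_S).
  split=> // P hP notP.
  have hd : (v * p ^ (n - m * k) <= deg P)%N.
    exact: (not_field_degree p_prime cardL k_gt0 m_gt0 v_gt1 v_dvd cardS S0 S1 Mm M_S cardUv
      not_field hP).
  (* Below the threshold [P] is a [v]-th power, which is excluded; above it the lower bound
     [v q / Q] is large enough. *)
  have [h|h] := ltnP (v * v * p ^ n) (p ^ (m * k) * p ^ (m * k) * (p ^ (m * k) * p ^ (m * k))).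
    by case: notP; exact: (nf not_field P hP h).
  have [h1 h2] := not_power_degree p_gt1 k_gt0 m1 k_dvd_n mk v_gt1 v_dvd h.
  have Q0 : (0 < p ^ (m * k))%N by rewrite expn_gt0 p_gt0.
  rewrite -natrX; apply: (proj1 (cancel_degree X Q0 hd)).
  have -> : (p ^ (n - m * k) * p ^ (m * k) = p ^ n)%N by rewrite -expnD subnK.
  exact: real_degree X0 X2 h1 h2.
- move=> [fieldU _] e E leastE t P hP notP.
  have [r1 rt] := field_rt p_prime cardL k_gt0 m_gt0 v_gt0 v_dvd cardS fieldU cardUv leastE.
  have t_gt0 := texp_gt0 p_prime cardL k_gt0 m_gt0 v_gt0 v_dvd cardS fieldU leastE.
  have t1 : (1 < t)%N.
    rewrite ltn_neqAle eq_sym t_gt0 andbT; apply/eqP => t1; apply: notP.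
    exact: (texp1_power p_prime cardL k_gt0 m_gt0 v_gt0 v_dvd cardS fieldU leastE hP t1).
  split=> //.
    exact: (Sv_not_field p_prime cardL k_gt0 m_gt0 v_gt0 v_dvd cardS fieldU cardUv leastE t1).
  have hd := field_degree p_prime cardL k_gt0 m_gt0 v_gt0 v_dvd cardS fieldU cardUv leastE hP.
  have e_gt0 : (0 < e)%N by case: leastE.
  have en : (e %| n)%N by exact: (field_e_dvd p_prime cardL leastE).
  have npow : ~ (n = e \/ n = (2 * e)%N \/ n = (3 * e)%N /\ (3 * t < p ^ e + 3)%N).
    move=> hn; apply: notP.
    exact: (field_power p_prime cardL k_gt0 m_gt0 v_gt0 v_dvd cardS fieldU cardUv leastE hP hn).
  have pe0 : (0 < p ^ e)%N by rewrite expn_gt0 p_gt0.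
  have en' : (e <= n)%N by apply: dvdn_leq.
  rewrite -natrX; apply: (proj2 (cancel_degree X pe0 hd)).
  have -> : (p ^ (n - e) * p ^ e = p ^ n)%N by rewrite -expnD subnK.
  have pe4 : (4 < p ^ e)%N.
    by rewrite -rt addn1 ltnS; apply: (@leq_trans (2 * 2)); rewrite // leq_mul.
  have [h hn] := dvdnP en.
  have [h4|h4] := leqP 4 h.
    have eq : (p ^ n = p ^ e * p ^ e * (p ^ e * p ^ e) * p ^ (n - 4 * e))%N.
      rewrite -!expnD; congr (_ ^ _)%N.
      by have : (4 * e <= n)%N; [rewrite hn leq_mul2r h4 orbT|clear; lia].
    have R4 : (3 < p ^ e * p ^ e)%N by apply: leq_trans (ltnW pe4) _; rewrite leq_pmulr.
    have Y0 : (0 < p ^ (n - 4 * e))%N by rewrite expn_gt0 p_gt0.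
    have [g1 g2] := far_degree R4 Y0 t1.
    by apply: (real_degree_le X0 X2); rewrite eq // ltnW.
  have h3 : n = (3 * e)%N.
    case: h hn h4 => [|[|[|[|//]]]] hn _ //.
    - by rewrite hn in n_gt0.
    - by case: npow; left; rewrite hn mul1n.
    - by case: npow; right; left.
  have t3 : (p ^ e + 3 <= 3 * t)%N.
    by rewrite leqNgt; apply/negP => h0; apply: npow; right; right.
  have [g1 g2] := near_degree pe4 t3.
  have eq : (p ^ n = (p ^ e) ^ 3)%N by rewrite h3 mulnC expnM.
  by apply: (real_degree_le X0 X2); rewrite eq.
move=> /range hr; split=> [not_field P|fieldU e E smallE P].
  split; last exact: (not_field_pow_mvsps p_prime cardL k_gt0 v_gt1 v_dvd cardS S0 Mm M_S).
  move=> hP; apply: (nf not_field P hP).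
  have m1 : (1 < m)%N by apply: (not_field_dim p_prime cardL k_gt0 m_gt0 cardS S1 Mm M_S).
  case: hr => [h|[_ h]]; first exact: not_field_range_a rQ h.
  exact: not_field_range_b h.
(* The smallest field containing [U^v] lies in the field [U], so it is also the least one between
   [U^v] and [U]. *)
have leastE : least_Fpe_between p Uv US e E.
  case: smallE => [[fE cE] UvE Emin]; split=> //.
  - by rewrite lt0n; apply: contraTneq (subfield_card_gt1 fE) => e0; rewrite cE e0.
  - apply: Emin => //; apply/subsetP => _ /imsetP[u uU ->].
    elim: (v) => [|j IH]; first by rewrite expr0; case: fieldU.
    by rewrite exprS; apply: subfieldM.
  move=> e' E' _ [fE' cE'] UvE' _; rewrite -(leq_exp2l _ _ p_gt1) -cE -cE'.
  by apply: subset_leq_card; apply: Emin.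
have [r1 rt] := field_rt p_prime cardL k_gt0 m_gt0 v_gt0 v_dvd cardS fieldU cardUv leastE.
have t_gt0 := texp_gt0 p_prime cardL k_gt0 m_gt0 v_gt0 v_dvd cardS fieldU leastE.
have e_gt0 : (0 < e)%N by case: leastE.
have en : (e %| n)%N by exact: (field_e_dvd p_prime cardL leastE).
have emk : (e %| m * k)%N by exact: (field_e_dvd_S p_prime cardS fieldU leastE).
split; last first.
  exact: (field_pow_mvsps p_prime cardL k_gt0 m_gt0 v_gt0 v_dvd cardS fieldU leastE).
move=> hP; have [t1|t1] := leqP (texp p v m k e) 1.
  have {}t1 : texp p v m k e = 1%N by apply/eqP; rewrite eqn_leq t1.
  exact: (texp1_power p_prime cardL k_gt0 m_gt0 v_gt0 v_dvd cardS fieldU leastE hP t1).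
apply: (field_power p_prime cardL k_gt0 m_gt0 v_gt0 v_dvd cardS fieldU cardUv leastE hP).
case: hr => [h|[m1 h]]; first exact: field_range_a t1 r1 rt h.
exact: field_range_b rQ en emk rt h.
Qed.
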